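(* Let $\varepsilon\in\{1,-1\}$, let $\mathcal D\subset\mathbb R^2$ be a domain, and let $\lambda(u,v)$, $\mu(u,v)$, $\nu(u,v)$ be smooth real functions on $\mathcal D$ such that $\mu$ and $\nu$ vanish nowhere, $\nu$ is not constant, and $$\nu_u+\lambda_v=\lambda\,(\ln|\mu|)_v,$$ $$\lambda_u-\varepsilon\,\nu_v=\lambda\,(\ln|\mu|)_u,$$ $$|\mu|\,(\ln|\mu|)_{uv}=-\nu^2-\varepsilon(\lambda^2+\mu^2).$$ Let $(u_0,v_0)\in\mathcal D$, let $p_0\in\mathbb R^4_1$, and let $\{x_0,y_0,(n_1)_0,(n_2)_0\}$ be a pseudo-orthonormal frame at $p_0$. Then there exist a subdomain $\mathcal D_0\subset\mathcal D$ containing $(u_0,v_0)$ and a unique timelike surface $\mathcal M: z=z(u,v)$, $(u,v)\in\mathcal D_0$, in $\mathbb R^4_1$ with parallel normalized mean curvature vector field such that: (i) $z(u_0,v_0)=p_0$; (ii) $(u,v)$ are canonical isotropic parameters of $\mathcal M$; (iii) $\mathcal M$ has a geometric frame field $\{x,y,n_1,n_2\}$ on $\mathcal D_0$ equal to $\{x_0,y_0,(n_1)_0,(n_2)_0\}$ at $(u_0,v_0)$, and with respect to it $\lambda,\mu,\nu$ are the geometric functions of $\mathcal M$; (iv) $K-H^2>0$ if $\varepsilon=1$, and $K-H^2<0$ if $\varepsilon=-1$.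
   Context: $\mathbb R^4_1$ is $\mathbb R^4$ with the metric $\langle\cdot,\cdot\rangle=dx_1^2+dx_2^2+dx_3^2-dx_4^2$ and flat Levi-Civita connection $\widetilde\nabla$. A domain is an open connected set. A surface $\mathcal M: z=z(u,v)$ is a smooth immersion of a domain of $\mathbb R^2$ into $\mathbb R^4_1$; it is timelike if the induced metric is Lorentzian. $\sigma$ is the second fundamental tensor (normal part of $\widetilde\nabla_xy$ for tangent $x,y$), $D$ the normal connection (normal part of $\widetilde\nabla_x\xi$ for normal $\xi$), $H=\tfrac12\mathrm{tr}\,\sigma$ the mean curvature vector field, $K$ the Gauss curvature of the induced metric, and $H^2=\langle H,H\rangle$. A normal field $\xi$ is parallel if $D\xi=0$. $\mathcal M$ has parallel normalized mean curvature vector field if $H$ is nowhere zero, $H$ is not parallel, and there is a unit normal vector field in the direction of $H$ which is parallel. A pseudo-orthonormal frame at a point is a basis $\{x,y,n_1,n_2\}$ of $\mathbb R^4_1$ with $\langle x,x\rangle=\langle y,y\rangle=0$, $\langle x,y\rangle=-1$, $\langle n_1,n_1\rangle=\langle n_2,n_2\rangle=1$, and $\langle n_1,n_2\rangle=\langle x,n_i\rangle=\langle y,n_i\rangle=0$ for $i=1,2$. Parameters $(u,v)$ are isotropic if $\langle z_u,z_u\rangle=\langle z_v,z_v\rangle=0$ and $\langle z_u,z_v\rangle=-f^2$ for a smooth function $f>0$ (the metric function). For isotropic parameters with $H$ nowhere zero, a geometric frame field is a smooth pseudo-orthonormal frame field $\{x,y,n_1,n_2\}$ along $\mathcal M$ with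 $x=z_u/f$, $y=z_v/f$, $n_1$ a unit normal field collinear with $H$, and $n_2$ a unit normal field orthogonal to $n_1$. For a timelike surface with parallel normalized mean curvature vector field and $K-H^2\neq0$ everywhere, isotropic parameters are canonical if, with respect to a geometric frame field, $$\sigma(x,x)=\lambda n_1+\mu n_2,\quad \sigma(x,y)=-\nu n_1,\quad \sigma(y,y)=-\varepsilon(\lambda n_1+\mu n_2),$$ where $\varepsilon$ is the sign of $K-H^2$, $\mu\ne0$, and $f=\dfrac{1}{\sqrt{|\mu|}}$. The functions $\lambda,\mu,\nu$ appearing here are the geometric functions of the surface (thus $H=\nu n_1$). *)

(* Defs.v *)
From Stdlib Require Import Reals.
From Coquelicot Require Import Coquelicot.
Open Scope R_scope.

(* The vector space operations are those of Coquelicot's product modules. *)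
Definition R41 : Type := (R * R * R * R)%type.

Definition x1 (w : R41) : R := fst (fst (fst w)).
Definition x2 (w : R41) : R := snd (fst (fst w)).
Definition x3 (w : R41) : R := snd (fst w).
Definition x4 (w : R41) : R := snd w.

Definition ip (a b : R41) : R :=
  x1 a * x1 b + x2 a * x2 b + x3 a * x3 b - x4 a * x4 b.

Definition lincomb (a b c d : R) (x y n1 n2 : R41) : R41 :=
  plus (plus (plus (scal a x) (scal b y)) (scal c n1)) (scal d n2).

Definition is_basis (x y n1 n2 : R41) : Prop :=
  (forall a b c d : R, lincomb a b c d x y n1 n2 = zero ->
     a = 0 /\ b = 0 /\ c = 0 /\ d = 0) /\
  (forall w : R41, exists a b c d : R, w = lincomb a b c d x y n1 n2).

Record pseudo_orthonormal (x y n1 n2 : R41) : Prop := {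
  po_basis : is_basis x y n1 n2;
  po_xx : ip x x = 0;
  po_yy : ip y y = 0;
  po_xy : ip x y = -1;
  po_11 : ip n1 n1 = 1;
  po_22 : ip n2 n2 = 1;
  po_12 : ip n1 n2 = 0;
  po_x1 : ip x n1 = 0;
  po_x2 : ip x n2 = 0;
  po_y1 : ip y n1 = 0;
  po_y2 : ip y n2 = 0
}.

Definition is_connected_set (D : R * R -> Prop) : Prop :=
  forall A B : R * R -> Prop, open A -> open B ->
    (forall p, D p -> A p \/ B p) ->
    (forall p, D p -> A p -> B p -> False) ->
    (forall p, D p -> A p) \/ (forall p, D p -> B p).

(* Since a domain is open, testing connectedness with open sets of the plane
   is the same as testing it with relatively open subsets. *)
Definition is_domain (D : R * R -> Prop) : Prop := open D /\ is_connected_set D.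

Inductive param : Type := pU | pV.

Definition pd (i : param) (f : R -> R -> R) : R -> R -> R :=
  match i with
  | pU => fun u v => Derive (fun t => f t v) u
  | pV => fun u v => Derive (fun t => f u t) v
  end.

Definition pdv (i : param) (w : R -> R -> R41) : R -> R -> R41 :=
  fun u v =>
    (pd i (fun s t => x1 (w s t)) u v, pd i (fun s t => x2 (w s t)) u v,
     pd i (fun s t => x3 (w s t)) u v, pd i (fun s t => x4 (w s t)) u v).

(* [ex_diff_n f n u v]: all iterated partial derivatives of f up to order n
   exist and are continuous at (u, v).  Functions are total, but on an open D
   everything below only depends on their values on D. *)
Definition smooth (D : R * R -> Prop) (f : R -> R -> R) : Prop :=
  forall (n : nat) (u v : R), D (u, v) -> ex_diff_n f n u v.

Definition smooth_field (D : R * R -> Prop) (w : R -> R -> R41) : Prop :=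
  smooth D (fun u v => x1 (w u v)) /\ smooth D (fun u v => x2 (w u v)) /\
  smooth D (fun u v => x3 (w u v)) /\ smooth D (fun u v => x4 (w u v)).

Definition sum_param (F : param -> R) : R := F pU + F pV.

Definition metric : Type := param -> param -> R -> R -> R.

Definition det_g (g : metric) (u v : R) : R :=
  g pU pU u v * g pV pV u v - g pU pV u v * g pV pU u v.

Definition g_inv (g : metric) (i j : param) (u v : R) : R :=
  match i, j with
  | pU, pU => g pV pV u v / det_g g u v
  | pV, pV => g pU pU u v / det_g g u v
  | pU, pV => - g pU pV u v / det_g g u v
  | pV, pU => - g pV pU u v / det_g g u v
  end.

(* Christoffel symbol Gamma^k_{ij} of the Levi-Civita connection of g. *)
Definition christoffel (g : metric) (k i j : param) (u v : R) : R :=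
  / 2 * sum_param (fun l =>
    g_inv g k l u v *
    (pd i (g j l) u v + pd j (g i l) u v - pd l (g i j) u v)).

(* l-th component of
   R(d_i, d_j) d_k = nabla_i nabla_j d_k - nabla_j nabla_i d_k. *)
Definition riemann (g : metric) (l i j k : param) (u v : R) : R :=
  pd i (christoffel g l j k) u v - pd j (christoffel g l i k) u v +
  sum_param (fun m =>
    christoffel g m j k u v * christoffel g l i m u v -
    christoffel g m i k u v * christoffel g l j m u v).

(* <R(d_u, d_v) d_v, d_u> / (E G - F^2) *)
Definition gauss_curvature (g : metric) (u v : R) : R :=
  sum_param (fun l => riemann g l pU pV pV u v * g l pU u v) / det_g g u v.

Definition first_form (z : R -> R -> R41) : metric :=
  fun i j u v => ip (pdv i z u v) (pdv j z u v).

Definition tangent (z : R -> R -> R41) (u v : R) (X : R41) : Prop :=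
  exists a b : R, X = plus (scal a (pdv pU z u v)) (scal b (pdv pV z u v)).

Definition normal (z : R -> R -> R41) (u v : R) (w : R41) : Prop :=
  forall X : R41, tangent z u v X -> ip w X = 0.

Definition immersion (D : R * R -> Prop) (z : R -> R -> R41) : Prop :=
  forall u v : R, D (u, v) -> forall a b : R,
    plus (scal a (pdv pU z u v)) (scal b (pdv pV z u v)) = zero ->
    a = 0 /\ b = 0.

(* The induced metric has signature (1, 1). *)
Definition lorentzian (D : R * R -> Prop) (z : R -> R -> R41) : Prop :=
  forall u v : R, D (u, v) -> exists e1 e2 : R41,
    tangent z u v e1 /\ tangent z u v e2 /\
    ip e1 e1 = 1 /\ ip e2 e2 = -1 /\ ip e1 e2 = 0.

Definition timelike_surface (D : R * R -> Prop) (z : R -> R -> R41) : Prop :=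
  smooth_field D z /\ immersion D z /\ lorentzian D z.

(* i-th coordinate, in the basis (z_u, z_v), of the tangential part of w. *)
Definition tangent_coord (z : R -> R -> R41) (u v : R) (w : R41) (i : param)
  : R :=
  sum_param (fun j => g_inv (first_form z) i j u v * ip w (pdv j z u v)).

Definition tangent_part (z : R -> R -> R41) (u v : R) (w : R41) : R41 :=
  plus (scal (tangent_coord z u v w pU) (pdv pU z u v))
       (scal (tangent_coord z u v w pV) (pdv pV z u v)).

Definition normal_part (z : R -> R -> R41) (u v : R) (w : R41) : R41 :=
  minus w (tangent_part z u v w).

(* Flat derivative, along the tangent vector X at (u, v), of the vector
   field Y along the surface. *)
Definition flat_conn (z : R -> R -> R41) (X : R41) (Y : R -> R -> R41)
    (u v : R) : R41 :=
  plus (scal (tangent_coord z u v X pU) (pdv pU Y u v))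
       (scal (tangent_coord z u v X pV) (pdv pV Y u v)).

(* Second fundamental tensor; Y is a tangent vector field. *)
Definition sigma (z : R -> R -> R41) (X : R41) (Y : R -> R -> R41)
    (u v : R) : R41 :=
  normal_part z u v (flat_conn z X Y u v).

(* Normal connection D_X xi; xi is a normal vector field. *)
Definition normal_conn (z : R -> R -> R41) (X : R41) (xi : R -> R -> R41)
    (u v : R) : R41 :=
  normal_part z u v (flat_conn z X xi u v).

(* (1/2) g^{ij} sigma(d_i, d_j) *)
Definition mean_curvature (z : R -> R -> R41) (u v : R) : R41 :=
  let term i j :=
    scal (g_inv (first_form z) i j u v) (sigma z (pdv i z u v) (pdv j z) u v)
  in
  scal (/ 2)
    (plus (plus (term pU pU) (term pU pV)) (plus (term pV pU) (term pV pV))).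

Definition K_minus_H2 (z : R -> R -> R41) (u v : R) : R :=
  gauss_curvature (first_form z) u v
  - ip (mean_curvature z u v) (mean_curvature z u v).

Definition parallel (D : R * R -> Prop) (z xi : R -> R -> R41) : Prop :=
  forall u v : R, D (u, v) -> forall X : R41, tangent z u v X ->
    normal_conn z X xi u v = zero.

(* Normal spaces of a timelike surface are positive definite, so a unit normal
   field has square 1. *)
Definition parallel_normalized_mean_curvature
    (D : R * R -> Prop) (z : R -> R -> R41) : Prop :=
  (forall u v : R, D (u, v) -> mean_curvature z u v <> zero) /\
  ~ parallel D z (mean_curvature z) /\
  exists xi : R -> R -> R41,
    smooth_field D xi /\
    (forall u v : R, D (u, v) ->
       normal z u v (xi u v) /\ ip (xi u v) (xi u v) = 1 /\
       exists c : R, 0 < c /\ mean_curvature z u v = scal c (xi u v)) /\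
    parallel D z xi.

Definition isotropic_parameters (D : R * R -> Prop) (z : R -> R -> R41)
    (f : R -> R -> R) : Prop :=
  smooth D f /\
  forall u v : R, D (u, v) ->
    0 < f u v /\
    first_form z pU pU u v = 0 /\ first_form z pV pV u v = 0 /\
    first_form z pU pV u v = - (f u v) ^ 2.

(* Being pseudo-orthonormal makes n1, n2 orthogonal unit normal fields. *)
Definition geometric_frame_field (D : R * R -> Prop) (z : R -> R -> R41)
    (f : R -> R -> R) (x y n1 n2 : R -> R -> R41) : Prop :=
  smooth_field D x /\ smooth_field D y /\
  smooth_field D n1 /\ smooth_field D n2 /\
  forall u v : R, D (u, v) ->
    pseudo_orthonormal (x u v) (y u v) (n1 u v) (n2 u v) /\
    x u v = scal (/ f u v) (pdv pU z u v) /\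
    y u v = scal (/ f u v) (pdv pV z u v) /\
    exists c : R, mean_curvature z u v = scal c (n1 u v).

(* [sign] is Coquelicot's sign function, with values in {-1, 0, 1}. *)
Definition geometric_functions (D : R * R -> Prop) (z : R -> R -> R41)
    (f : R -> R -> R) (x y n1 n2 : R -> R -> R41)
    (lam mu nu : R -> R -> R) : Prop :=
  forall u v : R, D (u, v) ->
    let eps := sign (K_minus_H2 z u v) in
    let w := plus (scal (lam u v) (n1 u v)) (scal (mu u v) (n2 u v)) in
    mu u v <> 0 /\
    sigma z (x u v) x u v = w /\
    sigma z (x u v) y u v = scal (- nu u v) (n1 u v) /\
    sigma z (y u v) y u v = scal (- eps) w /\
    f u v = 1 / sqrt (Rabs (mu u v)).

Definition canonical_isotropic_parameters
    (D : R * R -> Prop) (z : R -> R -> R41) : Prop :=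
  (forall u v : R, D (u, v) -> K_minus_H2 z u v <> 0) /\
  exists (f : R -> R -> R) (x y n1 n2 : R -> R -> R41)
         (lam mu nu : R -> R -> R),
    isotropic_parameters D z f /\
    geometric_frame_field D z f x y n1 n2 /\
    geometric_functions D z f x y n1 n2 lam mu nu.

(* Main.v *)
From Stdlib Require Import Reals Lra Lia List Classical ClassicalEpsilon.
From Coquelicot Require Import Coquelicot.
Require Import Defs.
Open Scope R_scope.
Import ListNotations.

(** With the metric function f = |mu|^(-1/2), the Gauss and Weingarten formulas
    of the surface sought express all first derivatives of the position z and
    of the frame x, y, n1, n2 linearly in z, x, y, n1, n2 themselves, with
    coefficients built from f, lam, mu, nu and L = ln |mu|.  This is a linear
    system dF = omega F in the plane, the same one for each of the four
    coordinates of the ambient space ([frame_equations]).  Its integrability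
    condition is exactly the system of three differential equations imposed on
    lam, mu, nu ([frame_coef_flat]): two Codazzi equations and the Gauss
    equation.

    Existence for a flat linear system: on a small square one solves an ordinary
    differential equation along a horizontal segment and then one along each
    vertical segment.  That the result also satisfies the horizontal equation
    ([W_horizontal]) follows from a Gronwall estimate for the defect of its
    linear approximation, in which flatness cancels the first-order terms.  All
    segments are so short that integrating once halves every error, so the
    Picard iteration converges geometrically and the Gronwall estimate only
    costs a factor 2 ([short_gronwall], [linear_ode_short]).  Smoothness follows
    because the derivatives of a solution are again linear in it
    ([solves_smooth]).

    A local solution is not enough: the mean curvature vector nu n1 must not be
    parallel on the final domain, that is, nu must not be constant there, whereas
    nu may well be constant near the initial point.  So D0 has to reach a
    prescribed point q of D, and since D may have holes, solutions cannot be
    continued over all of D.  The way out is a [tower] of squares from the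
    initial point to q in which each square meets the union of the preceding
    ones only inside the last of them.  Overlaps are then intersections of two
    squares, hence connected, and solutions glue by uniqueness
    ([flat_system_solvable]).

    The matrices omega lie in the Lie algebra of the isometry group.  So the
    Gram matrix of the frame and the expansion of a fixed vector in the frame
    stay constant, and the frame stays pseudo-orthonormal
    ([frame_pseudo_orthonormal]).  The invariants of the surface can then be
    read off; in particular K = nu^2 + eps (lam^2 + mu^2) and H = nu n1, so
    K - H^2 has the sign of eps.

    For uniqueness, the frame of any other solution satisfies the same linear
    system ([adapted_frame_equations]): normal components of the derivatives are
    given by sigma, tangential ones by z_uv = z_vu and the constancy of the inner
    products, and n1 is parallel because it is the normalized mean curvature
    vector up to a constant sign ([normalized_parallel_n1]).  Two solutions of
    the system that agree at one point of a domain agree on it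
    ([solves_unique]). *)

(** * Finite sums indexed by a list *)

Section ListSum.
Context {I : Type}.

Definition lsum (l : list I) (F : I -> R) : R :=
  fold_right (fun i s => F i + s) 0 l.

Lemma lsum_ext (l : list I) (F G : I -> R) :
  (forall i, F i = G i) -> lsum l F = lsum l G.
Proof. intros H; induction l as [|i l IH]; simpl; [easy|]. now rewrite H, IH. Qed.

Lemma lsum_0 (l : list I) (F : I -> R) : (forall i, F i = 0) -> lsum l F = 0.
Proof. intros H; induction l as [|i l IH]; simpl; [easy|]. rewrite H, IH. ring. Qed.

Lemma lsum_plus (l : list I) (F G : I -> R) :
  lsum l (fun i => F i + G i) = lsum l F + lsum l G.
Proof. induction l as [|i l IH]; simpl; [ring|]. rewrite IH. ring. Qed.

Lemma lsum_minus (l : list I) (F G : I -> R) :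
  lsum l (fun i => F i - G i) = lsum l F - lsum l G.
Proof. induction l as [|i l IH]; simpl; [ring|]. rewrite IH. ring. Qed.

Lemma lsum_scal (l : list I) (c : R) (F : I -> R) :
  lsum l (fun i => c * F i) = c * lsum l F.
Proof. induction l as [|i l IH]; simpl; [ring|]. rewrite IH. ring. Qed.

Lemma lsum_scal_r (l : list I) (c : R) (F : I -> R) :
  lsum l (fun i => F i * c) = lsum l F * c.
Proof. induction l as [|i l IH]; simpl; [ring|]. rewrite IH. ring. Qed.

Lemma lsum_exchange (l m : list I) (F : I -> I -> R) :
  lsum l (fun i => lsum m (fun j => F i j)) =
  lsum m (fun j => lsum l (fun i => F i j)).
Proof.
induction l as [|i l IH]; simpl.
- now rewrite lsum_0.
- now rewrite IH, lsum_plus.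
Qed.

Lemma lsum_le (l : list I) (F G : I -> R) :
  (forall i, F i <= G i) -> lsum l F <= lsum l G.
Proof.
intros H; induction l as [|i l IH]; simpl; [lra|].
specialize (H i); lra.
Qed.

Lemma lsum_le_const (l : list I) (F : I -> R) (c : R) :
  (forall i, F i <= c) -> lsum l F <= INR (length l) * c.
Proof.
intros H; induction l as [|i l IH]; [simpl; lra|].
change (length (i :: l)) with (S (length l)); rewrite S_INR; simpl.
specialize (H i); lra.
Qed.

Lemma Rabs_lsum (l : list I) (F : I -> R) :
  Rabs (lsum l F) <= lsum l (fun i => Rabs (F i)).
Proof.
induction l as [|i l IH]; simpl.
- rewrite Rabs_R0; lra.
- eapply Rle_trans; [apply Rabs_triang|lra].
Qed.

Lemma lsum_nonneg (l : list I) (F : I -> R) :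
  (forall i, 0 <= F i) -> 0 <= lsum l F.
Proof.
intros H; induction l as [|i l IH]; simpl; [lra|].
specialize (H i); lra.
Qed.

Lemma le_lsum (l : list I) (F : I -> R) (i : I) :
  (forall j, 0 <= F j) -> In i l -> F i <= lsum l F.
Proof.
intros H; induction l as [|j l IH]; simpl; [easy|].
pose proof (lsum_nonneg l F H).
intros [-> | Hi]; [lra|].
specialize (IH Hi); specialize (H j); lra.
Qed.

Lemma Rabs_lsum_mul (l : list I) (a w : I -> R) (M : R) :
  (forall i, Rabs (a i) <= M) ->
  Rabs (lsum l (fun i => a i * w i)) <= M * lsum l (fun i => Rabs (w i)).
Proof.
intros H.
eapply Rle_trans; [apply Rabs_lsum|].
rewrite <- lsum_scal.
apply lsum_le; intros i; rewrite Rabs_mult.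
apply Rmult_le_compat_r; [apply Rabs_pos|apply H].
Qed.

Lemma is_derive_lsum (l : list I) (F : I -> R -> R) (dF : I -> R) (t : R) :
  (forall i, is_derive (F i) t (dF i)) ->
  is_derive (fun s => lsum l (fun i => F i s)) t (lsum l dF).
Proof.
intros H; induction l as [|i l IH]; simpl.
- apply @is_derive_const.
- apply @is_derive_plus; [apply H|exact IH].
Qed.

Lemma continuity_pt_lsum (l : list I) (F : I -> R -> R) (t : R) :
  (forall i, continuity_pt (F i) t) ->
  continuity_pt (fun s => lsum l (fun i => F i s)) t.
Proof.
intros H; induction l as [|i l IH]; simpl.
- apply continuity_pt_const; intros a b; reflexivity.
- apply (continuity_pt_plus (F i) (fun s => lsum l (fun i => F i s))); [apply H|exact IH].
Qed.

Lemma continuity_2d_pt_lsum (l : list I) (F : I -> R -> R -> R) (u v : R) :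
  (forall i, continuity_2d_pt (F i) u v) ->
  continuity_2d_pt (fun s t => lsum l (fun i => F i s t)) u v.
Proof.
intros H; induction l as [|i l IH]; simpl.
- apply continuity_2d_pt_const.
- apply continuity_2d_pt_plus; [apply H|exact IH].
Qed.

End ListSum.

(** * Linear ordinary differential equations on short intervals *)

Lemma continuity_pt_of_is_derive (f : R -> R) (t d : R) :
  is_derive f t d -> continuity_pt f t.
Proof.
intros H; apply continuity_pt_filterlim.
apply @ex_derive_continuous; now exists d.
Qed.

Lemma between_in (a b s t r : R) :
  a < s < b -> a < t < b -> Rmin s t <= r <= Rmax s t -> a < r < b.
Proof.
intros Hs Ht; unfold Rmin, Rmax; destruct (Rle_dec s t); lra.
Qed.

Lemma open_between (a b t : R) : a < t < b -> locally t (fun s => a < s < b).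
Proof.
intros Ht.
apply (filter_and (fun s => a < s)).
- now apply (open_gt a).
- now apply (open_lt b).
Qed.

Lemma increment_bound (f df : R -> R) (s t M : R) :
  (forall r, Rmin s t <= r <= Rmax s t ->
     is_derive f r (df r) /\ Rabs (df r) <= M) ->
  Rabs (f t - f s) <= M * Rabs (t - s).
Proof.
intros H.
destruct (MVT_gen f s t df) as [c [Hc E]].
- intros r Hr; apply H; lra.
- intros r Hr; eapply continuity_pt_of_is_derive; apply H, Hr.
- rewrite E, Rabs_mult.
  apply Rmult_le_compat_r; [apply Rabs_pos|apply H, Hc].
Qed.


Lemma half_pow_small (c eps : R) :
  0 < eps -> exists N : nat, forall n, (N <= n)%nat -> c * (/ 2) ^ n < eps.
Proof.
intros He.
assert (H : is_lim_seq (fun n => c * (/ 2) ^ n) (c * 0)).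
{ apply (is_lim_seq_scal_l (fun n => (/ 2) ^ n) c 0).
  apply is_lim_seq_geom; rewrite Rabs_pos_eq; lra. }
rewrite Rmult_0_r in H; apply is_lim_seq_spec in H.
destruct (H (mkposreal eps He)) as [N HN]; exists N; intros n Hn.
specialize (HN n Hn); rewrite Rminus_0_r in HN.
now apply Rabs_def2 in HN.
Qed.

Lemma cauchy_of_geometric (f : nat -> R -> R) (D : R -> Prop) (c : R) :
  (forall n m t, D t -> (n <= m)%nat -> Rabs (f m t - f n t) <= c * (/ 2) ^ n) ->
  CVU_dom f D.
Proof.
intros H; apply CVU_dom_cauchy; intros eps.
destruct (half_pow_small c eps (cond_pos eps)) as [N HN]; exists N.
intros n m t Ht Hn Hm.
destruct (Nat.le_ge_cases n m) as [Hnm|Hnm].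
- rewrite Rabs_minus_sym.
  eapply Rle_lt_trans; [now apply H|now apply HN].
- eapply Rle_lt_trans; [now apply H|now apply HN].
Qed.

Lemma CVU_dom_is_lim (f : nat -> R -> R) (D : R -> Prop) (t : R) :
  CVU_dom f D -> D t ->
  is_lim_seq (fun n => f n t) (real (Lim_seq (fun n => f n t))).
Proof.
intros H Ht; apply is_lim_seq_spec; intros eps.
destruct (H eps) as [N HN]; exists N; intros n Hn; now apply HN.
Qed.

Lemma is_lim_seq_lsum {I : Type} (l : list I) (F : I -> nat -> R) (L : I -> R) :
  (forall i, is_lim_seq (F i) (L i)) ->
  is_lim_seq (fun n => lsum l (fun i => F i n)) (lsum l L).
Proof.
intros H; induction l as [|i l IH]; simpl.
- apply is_lim_seq_const.
- apply (is_lim_seq_plus' (F i) (fun n => lsum l (fun i => F i n))); [apply H|exact IH].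
Qed.

Section ShortInterval.
Context {I : Type} (l : list I).
Variables (a b M : R).
Hypothesis M_nonneg : 0 <= M.
Hypothesis short : INR (length l) * M * (b - a) <= / 2.

Let dist_lt (s t : R) : a < s < b -> a < t < b -> Rabs (t - s) <= b - a.
Proof. intros; apply Rabs_le; lra. Qed.

(** On an interval this short, integrating the differential inequality once
    halves the maximum of the left-hand side; this replaces Gronwall's
    exponential by the factor 2. *)
Lemma short_gronwall (E dE : I -> R -> R) (d s t : R) :
  0 <= d -> a < s < b -> a < t < b ->
  (forall i r, Rmin s t <= r <= Rmax s t -> is_derive (E i) r (dE i r)) ->
  (forall i r, Rmin s t <= r <= Rmax s t ->
     Rabs (dE i r) <= M * lsum l (fun j => Rabs (E j r)) + d) ->
  lsum l (fun i => Rabs (E i t)) <=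
  2 * (lsum l (fun i => Rabs (E i s)) + INR (length l) * d * (b - a)).
Proof.
intros Hd Hs Ht HE HdE.
set (g := fun r => lsum l (fun i => Rabs (E i r))).
change (g t <= 2 * (g s + INR (length l) * d * (b - a))).
destruct (continuity_ab_maj g (Rmin s t) (Rmax s t)) as [m [Hm Hm']].
{ apply Rmin_Rmax. }
{ intros r Hr; apply continuity_pt_lsum; intros i.
  apply (continuity_pt_comp (E i) Rabs); [|apply Rcontinuity_abs].
  eapply continuity_pt_of_is_derive; apply HE, Hr. }
assert (Hmab : a < m < b) by exact (between_in _ _ _ _ _ Hs Ht Hm').
assert (Hsub : forall r, Rmin s m <= r <= Rmax s m -> Rmin s t <= r <= Rmax s t).
{ intros r; revert Hm'; unfold Rmin, Rmax.
  destruct (Rle_dec s m), (Rle_dec s t); lra. }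
assert (Hinc : forall i, Rabs (E i m - E i s) <= (M * g m + d) * (b - a)).
{ intros i.
  eapply Rle_trans; [apply (increment_bound _ (dE i) s m (M * g m + d))|].
  - intros r Hr; apply Hsub in Hr; split; [now apply HE|].
    eapply Rle_trans; [now apply HdE|].
    apply Rplus_le_compat_r, Rmult_le_compat_l; [easy|].
    now apply Hm.
  - apply Rmult_le_compat_l; [|now apply dist_lt].
    apply Rplus_le_le_0_compat; [|easy].
    apply Rmult_le_pos; [easy|].
    apply lsum_nonneg; intros; apply Rabs_pos. }
assert (Hgm : g m <= g s + INR (length l) * ((M * g m + d) * (b - a))).
{ unfold g at 1 2.
  eapply Rle_trans; [|apply Rplus_le_compat_l, (lsum_le_const l _ _ Hinc)].
  rewrite <- lsum_plus; apply lsum_le; intros i.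
  replace (E i m) with (E i s + (E i m - E i s)) at 1 by ring.
  apply Rabs_triang. }
assert (Hg0 : 0 <= g m) by (apply lsum_nonneg; intros; apply Rabs_pos).
assert (Hgt : g t <= g m).
{ apply Hm; split; [apply Rmin_r|apply Rmax_r]. }
assert (INR (length l) * M * (b - a) * g m <= / 2 * g m)
  by now apply Rmult_le_compat_r.
nra.
Qed.

Variable A : I -> I -> R -> R.
Hypothesis A_continuous : forall i j t, a < t < b -> continuity_pt (A i j) t.
Hypothesis A_bounded : forall i j t, a < t < b -> Rabs (A i j t) <= M.

Definition row_apply (w : I -> R -> R) (i : I) (t : R) : R :=
  lsum l (fun j => A i j t * w j t).

Section Picard.
Variables (t0 : R) (w0 : I -> R).
Hypothesis Ht0 : a < t0 < b.

Fixpoint picard (n : nat) (i : I) (t : R) : R :=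
  match n with
  | O => w0 i
  | S n => w0 i + RInt (row_apply (picard n) i) t0 t
  end.

Definition dpicard (n : nat) (i : I) (t : R) : R :=
  match n with
  | O => 0
  | S n => row_apply (picard n) i t
  end.

Lemma continuity_pt_row_apply (w : I -> R -> R) (i : I) (t : R) :
  a < t < b -> (forall j, continuity_pt (w j) t) ->
  continuity_pt (row_apply w i) t.
Proof.
intros Ht Hw; apply (continuity_pt_lsum l (fun j s => A i j s * w j s)).
intros j; apply (continuity_pt_mult (A i j) (w j)); auto.
Qed.

Lemma is_derive_picard (n : nat) (i : I) (t : R) :
  a < t < b -> is_derive (picard n i) t (dpicard n i t).
Proof.
revert i t; induction n as [|n IH]; intros i t Ht; simpl.
{ apply @is_derive_const. }
assert (Hc : forall s, a < s < b -> continuous (row_apply (picard n) i) s).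
{ intros s Hs; apply continuity_pt_filterlim.
  apply continuity_pt_row_apply; [easy|].
  intros j; eapply continuity_pt_of_is_derive; now apply IH. }
rewrite <- (Rplus_0_l (row_apply _ _ _)).
apply @is_derive_plus; [apply @is_derive_const|].
apply is_derive_RInt with t0; [|now apply Hc].
apply (filter_imp (fun s => a < s < b)); [|now apply open_between].
intros s Hs; apply @RInt_correct.
apply ex_RInt_continuous; intros r Hr; apply Hc.
now apply (between_in a b t0 s).
Qed.

Lemma picard_init (n : nat) (i : I) : picard n i t0 = w0 i.
Proof.
destruct n; simpl; [easy|].
rewrite RInt_point; unfold zero; simpl; ring.
Qed.

Let C : R := M * lsum l (fun j => Rabs (w0 j)) * (b - a).

Let C_nonneg : 0 <= C.
Proof.
unfold C; apply Rmult_le_pos; [apply Rmult_le_pos; [easy|]|lra].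
apply lsum_nonneg; intros; apply Rabs_pos.
Qed.

(** Both factors M and b - a enter one integration, and their product with the
    number of unknowns is at most 1/2. *)
Lemma picard_step (n : nat) (i : I) (t : R) :
  a < t < b -> Rabs (picard (S n) i t - picard n i t) <= C * (/ 2) ^ n.
Proof.
revert i t; induction n as [|n IH]; intros i t Ht.
- replace (picard 1 i t - picard 0 i t) with (picard 1 i t - picard 1 i t0)
    by (rewrite picard_init; reflexivity).
  rewrite Rmult_1_r.
  eapply Rle_trans;
    [apply (increment_bound _ (dpicard 1 i) t0 t
       (M * lsum l (fun j => Rabs (w0 j))))|].
  + intros r Hr; apply (between_in a b) in Hr; [|easy|easy].
    split; [now apply is_derive_picard|].
    unfold dpicard, row_apply; simpl.
    apply Rabs_lsum_mul; intros; now apply A_bounded.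
  + apply Rmult_le_compat_l; [|now apply dist_lt].
    apply Rmult_le_pos; [easy|].
    apply lsum_nonneg; intros; apply Rabs_pos.
- set (f := fun s => picard (S (S n)) i s - picard (S n) i s).
  replace (picard (S (S n)) i t - picard (S n) i t) with (f t - f t0)
    by (unfold f; rewrite !picard_init; ring).
  set (c := C * (/ 2) ^ n) in *.
  assert (Hc : 0 <= c) by (apply Rmult_le_pos; [easy|apply pow_le; lra]).
  eapply Rle_trans;
    [apply (increment_bound f
       (fun s => dpicard (S (S n)) i s - dpicard (S n) i s) t0 t
       (M * (INR (length l) * c)))|].
  + intros r Hr; apply (between_in a b) in Hr; [|easy|easy].
    split; [apply @is_derive_minus; now apply is_derive_picard|].
    unfold dpicard, row_apply; rewrite <- lsum_minus.
    erewrite lsum_ext;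
      [|intros j; symmetry; apply Rmult_minus_distr_l].
    eapply Rle_trans;
      [apply (Rabs_lsum_mul _ _ _ M); intros; now apply A_bounded|].
    apply Rmult_le_compat_l; [easy|].
    apply lsum_le_const; intros j; now apply IH.
  + eapply Rle_trans; [apply Rmult_le_compat_l; [|now apply (dist_lt t0 t)]|].
    * apply Rmult_le_pos; [easy|apply Rmult_le_pos; [apply pos_INR|easy]].
    * apply Rle_trans with (INR (length l) * M * (b - a) * c); [right; ring|].
      apply Rle_trans with (/ 2 * c); [now apply Rmult_le_compat_r|].
      right; unfold c; simpl; ring.
Qed.

Lemma picard_cauchy (n m : nat) (i : I) (t : R) :
  a < t < b -> (n <= m)%nat ->
  Rabs (picard m i t - picard n i t) <= 2 * C * (/ 2) ^ n.
Proof.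
intros Ht Hnm.
assert (H : Rabs (picard m i t - picard n i t)
            <= 2 * C * ((/ 2) ^ n - (/ 2) ^ m)).
{ induction Hnm as [|m Hnm IH].
  - rewrite Rminus_diag, Rabs_R0; lra.
  - replace (picard (S m) i t - picard n i t) with
      ((picard (S m) i t - picard m i t) + (picard m i t - picard n i t)) by ring.
    eapply Rle_trans; [apply Rabs_triang|].
    pose proof (picard_step m i t Ht) as Hs.
    replace (2 * C * ((/ 2) ^ n - (/ 2) ^ S m))
      with (C * (/ 2) ^ m + 2 * C * ((/ 2) ^ n - (/ 2) ^ m)) by (simpl; field).
    lra. }
assert (0 <= 2 * C * (/ 2) ^ m).
{ apply Rmult_le_pos; [lra|apply pow_le; lra]. }
lra.
Qed.

End Picard.

(** Since the iterates and their derivatives converge geometrically and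
    uniformly, the limit may be differentiated termwise. *)
Theorem linear_ode_short (t0 : R) (w0 : I -> R) :
  a < t0 < b ->
  exists w : I -> R -> R,
    (forall i, w i t0 = w0 i) /\
    forall i t, a < t < b -> is_derive (w i) t (row_apply w i t).
Proof.
intros Ht0.
set (P := picard t0 w0).
exists (fun i t => real (Lim_seq (fun n => P n i t))); split.
{ intros i; rewrite (Lim_seq_ext _ (fun _ => w0 i)).
  - now rewrite Lim_seq_const.
  - intros n; apply picard_init. }
set (J := fun t => a < t < b).
set (C := M * lsum l (fun j => Rabs (w0 j)) * (b - a)).
assert (HP : forall i, CVU_dom (fun n t => P n i t) J).
{ intros i; apply (cauchy_of_geometric _ _ (2 * C)).
  intros n m t Ht Hnm; now apply picard_cauchy. }
assert (HD : forall n i t, J t -> Derive (P n i) t = dpicard t0 w0 n i t).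
{ intros n i t Ht; apply is_derive_unique; now apply is_derive_picard. }
intros i t Ht.
assert (HJ : open J).
{ apply open_and; [apply open_gt|apply open_lt]. }
replace (row_apply _ i t) with (real (Lim_seq (fun n => Derive (P n i) t))).
- apply (CVU_Derive (fun n t => P n i t) J); try easy.
  + intros x y z Hx Hy Hz; unfold J in *; lra.
  + intros n s Hs; eexists; now apply is_derive_picard.
  + intros n s Hs.
    apply continuity_pt_ext_loc with (dpicard t0 w0 n i).
    { apply (filter_imp J); [|now apply HJ].
      intros r Hr; symmetry; now apply HD. }
    destruct n as [|n]; simpl.
    { apply continuity_pt_const; intros x y; reflexivity. }
    apply continuity_pt_row_apply; [easy|]; intros j.
    eapply continuity_pt_of_is_derive; now apply is_derive_picard.
  + apply (cauchy_of_geometric _ _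
      (2 * (M * lsum l (fun j => Rabs (w0 j)) + M * (INR (length l) * (2 * C))))).
    intros n m s Hs Hnm; rewrite !HD by easy.
    assert (Hsum : 0 <= lsum l (fun j => Rabs (w0 j)))
      by (apply lsum_nonneg; intros; apply Rabs_pos).
    assert (HC : 0 <= C).
    { unfold C; apply Rmult_le_pos; [now apply Rmult_le_pos|lra]. }
    assert (HN : 0 <= INR (length l)) by apply pos_INR.
    assert (HMS : 0 <= M * lsum l (fun j => Rabs (w0 j))) by now apply Rmult_le_pos.
    assert (HMC : 0 <= M * (INR (length l) * (2 * C))).
    { repeat apply Rmult_le_pos; lra. }
    destruct n as [|n], m as [|m]; simpl; try lia.
    { rewrite Rminus_diag, Rabs_R0; lra. }
    { rewrite Rminus_0_r, Rmult_1_r.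
      apply Rle_trans with (M * lsum l (fun j => Rabs (P m j s))).
      { apply Rabs_lsum_mul; intros; now apply A_bounded. }
      apply Rle_trans with
        (M * (lsum l (fun j => Rabs (w0 j)) + INR (length l) * (2 * C))); [|lra].
      apply Rmult_le_compat_l; [easy|].
      eapply Rle_trans;
        [|apply Rplus_le_compat_l, (lsum_le_const l (fun j => Rabs (P m j s - w0 j)))].
      - rewrite <- lsum_plus; apply lsum_le; intros j.
        replace (P m j s) with (w0 j + (P m j s - w0 j)) at 1 by ring.
        apply Rabs_triang.
      - intros j; rewrite <- (Rmult_1_r (2 * C)).
        apply (picard_cauchy t0 w0 Ht0 0 m); [easy|lia]. }
    unfold row_apply; rewrite <- lsum_minus.
    erewrite lsum_ext; [|intros j; symmetry; apply Rmult_minus_distr_l].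
    apply Rle_trans with (M * (INR (length l) * (2 * C * (/ 2) ^ n))).
    { eapply Rle_trans; [apply Rabs_lsum_mul; intros; now apply A_bounded|].
      apply Rmult_le_compat_l; [easy|].
      apply lsum_le_const; intros j; apply picard_cauchy; [easy|easy|lia]. }
    assert (0 <= (/ 2) ^ n) by (apply pow_le; lra).
    assert (0 <= M * lsum l (fun j => Rabs (w0 j)) * (/ 2) ^ n)
      by now apply Rmult_le_pos.
    lra.
- erewrite Lim_seq_ext; [|intros n; now apply HD].
  rewrite <- Lim_seq_incr_1.
  match goal with |- _ = ?x => change x with (real (Finite x)) end.
  apply f_equal, is_lim_seq_unique; simpl.
  apply (is_lim_seq_lsum l (fun j n => A i j t * P n j t)); intros j.
  apply (is_lim_seq_scal_l (fun n => P n j t) (A i j t)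
    (real (Lim_seq (fun n => P n j t)))).
  now apply (CVU_dom_is_lim (fun n t => P n j t) J).
Qed.

End ShortInterval.

(** * Partial derivatives and smoothness in the plane *)

Lemma open_locally_2d (D : R * R -> Prop) (u v : R) :
  open D -> D (u, v) -> locally_2d (fun s t => D (s, t)) u v.
Proof.
intros HD Huv; apply locally_2d_locally.
apply (filter_imp D); [|now apply HD].
now intros [s t].
Qed.

Lemma locally_2d_open (D : R * R -> Prop) :
  (forall u v, D (u, v) -> locally_2d (fun s t => D (s, t)) u v) -> open D.
Proof.
intros H [u v] Huv; generalize (proj1 (locally_2d_locally _ _ _) (H u v Huv)).
apply filter_imp; now intros [s t].
Qed.

Definition is_pd (e : param) (f : R -> R -> R) (u v d : R) : Prop :=
  match e with
  | pU => is_derive (fun t => f t v) u d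
  | pV => is_derive (fun t => f u t) v d
  end.

Lemma is_pd_unique e f u v d : is_pd e f u v d -> pd e f u v = d.
Proof. destruct e; apply is_derive_unique. Qed.

Lemma is_pd_ext_loc e f g u v d :
  locally_2d (fun s t => f s t = g s t) u v ->
  is_pd e f u v d -> is_pd e g u v d.
Proof.
intros H; destruct e; apply is_derive_ext_loc.
- exact (locally_2d_1d_const_y _ _ _ H).
- exact (locally_2d_1d_const_x _ _ _ H).
Qed.

Lemma is_pd_ext_on (D : R * R -> Prop) e f g u v d :
  open D -> D (u, v) -> (forall s t, D (s, t) -> f s t = g s t) ->
  is_pd e f u v d -> is_pd e g u v d.
Proof.
intros HD Huv H; apply is_pd_ext_loc.
destruct (open_locally_2d D u v HD Huv) as [r Hr].
exists r; intros s t Hs Ht; now apply H, Hr.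
Qed.

Lemma pd_ext_on (D : R * R -> Prop) e f g u v :
  open D -> D (u, v) -> (forall s t, D (s, t) -> f s t = g s t) ->
  pd e f u v = pd e g u v.
Proof.
intros HD Huv H.
destruct (open_locally_2d D u v HD Huv) as [r Hr].
assert (HL : locally_2d (fun s t => f s t = g s t) u v).
{ exists r; intros s t Hs Ht; now apply H, Hr. }
destruct e; apply Derive_ext_loc.
- exact (locally_2d_1d_const_y _ _ _ HL).
- exact (locally_2d_1d_const_x _ _ _ HL).
Qed.

Lemma is_pd_const e c u v : is_pd e (fun _ _ => c) u v 0.
Proof. destruct e; [exact (is_derive_const c u)|exact (is_derive_const c v)]. Qed.

Lemma is_pd_plus e f g u v df dg :
  is_pd e f u v df -> is_pd e g u v dg ->
  is_pd e (fun s t => f s t + g s t) u v (df + dg).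
Proof.
destruct e.
- exact (is_derive_plus (fun t => f t v) (fun t => g t v) u df dg).
- exact (is_derive_plus (fun t => f u t) (fun t => g u t) v df dg).
Qed.

Lemma is_pd_minus e f g u v df dg :
  is_pd e f u v df -> is_pd e g u v dg ->
  is_pd e (fun s t => f s t - g s t) u v (df - dg).
Proof.
destruct e.
- exact (is_derive_minus (fun t => f t v) (fun t => g t v) u df dg).
- exact (is_derive_minus (fun t => f u t) (fun t => g u t) v df dg).
Qed.

Lemma is_pd_mult e f g u v df dg :
  is_pd e f u v df -> is_pd e g u v dg ->
  is_pd e (fun s t => f s t * g s t) u v (df * g u v + f u v * dg).
Proof.
destruct e; intros Hf Hg.
- apply (is_derive_mult (fun t => f t v) (fun t => g t v)); auto; intros; apply Rmult_comm.
- apply (is_derive_mult (fun t => f u t) (fun t => g u t)); auto; intros; apply Rmult_comm.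
Qed.

Lemma is_pd_inv e f u v df :
  is_pd e f u v df -> f u v <> 0 ->
  is_pd e (fun s t => / f s t) u v (- df * (/ f u v * / f u v)).
Proof.
intros Hf Hn.
replace (- df * (/ f u v * / f u v)) with (- df / (f u v) ^ 2) by (field; easy).
destruct e.
- now apply (is_derive_inv (fun t => f t v)).
- now apply (is_derive_inv (fun t => f u t)).
Qed.

Lemma is_pd_comp e (h : R -> R) f u v df dh :
  is_derive h (f u v) dh -> is_pd e f u v df ->
  is_pd e (fun s t => h (f s t)) u v (dh * df).
Proof.
intros Hh Hf; rewrite Rmult_comm; destruct e.
- now apply (is_derive_comp h (fun t => f t v)).
- now apply (is_derive_comp h (fun t => f u t)).
Qed.

(** Smoothness is proved order by order, through the intermediate classes C^n. *)
Definition Cn (D : R * R -> Prop) (n : nat) (f : R -> R -> R) : Prop :=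
  forall u v, D (u, v) -> ex_diff_n f n u v.

Lemma Cn_continuous D n f u v : Cn D n f -> D (u, v) -> continuity_2d_pt f u v.
Proof. intros H Huv; specialize (H u v Huv); destruct n; apply H. Qed.

Lemma Cn_is_pd D n f e u v :
  Cn D (S n) f -> D (u, v) -> is_pd e f u v (pd e f u v).
Proof.
intros H Huv; destruct (H u v Huv) as (_ & H1 & H2 & _).
destruct e; now apply Derive_correct.
Qed.

Lemma Cn_pd D n f e : Cn D (S n) f -> Cn D n (pd e f).
Proof.
intros H u v Huv; destruct (H u v Huv) as (_ & _ & _ & H1 & H2).
now destruct e.
Qed.

Lemma Cn_pred D n f : Cn D (S n) f -> Cn D n f.
Proof. intros H u v Huv; apply ex_diff_n_m with (S n); [lia|now apply H]. Qed.

Section Smooth.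
Variable D : R * R -> Prop.
Hypothesis D_open : open D.

Lemma Cn_ext n f g :
  (forall u v, D (u, v) -> f u v = g u v) -> Cn D n f -> Cn D n g.
Proof.
intros E H u v Huv; apply ex_diff_n_ext_loc with f; [|now apply H].
destruct (open_locally_2d D u v D_open Huv) as [r Hr].
exists r; intros s t Hs Ht; now apply E, Hr.
Qed.

(** The induction step in all regularity proofs: the partial derivatives only
    have to be known on D. *)
Lemma Cn_step n f (g : param -> R -> R -> R) :
  (forall u v, D (u, v) -> continuity_2d_pt f u v) ->
  (forall e u v, D (u, v) -> is_pd e f u v (g e u v)) ->
  (forall e, Cn D n (g e)) -> Cn D (S n) f.
Proof.
intros Hc Hf Hg u v Huv.
assert (H : forall e, Cn D n (pd e f)).
{ intros e; apply Cn_ext with (g e); [|apply Hg].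
  intros s t Hst; symmetry; now apply is_pd_unique, Hf. }
repeat split; [now apply Hc| | | |].
- eexists; exact (Hf pU u v Huv).
- eexists; exact (Hf pV u v Huv).
- exact (H pU u v Huv).
- exact (H pV u v Huv).
Qed.

Lemma Cn_const n c : Cn D n (fun _ _ => c).
Proof.
revert c; induction n as [|n IH]; intros c.
- intros u v _; split; [apply continuity_2d_pt_const|easy].
- apply Cn_step with (fun _ _ _ => 0); [|intros; apply is_pd_const|intros; apply IH].
  intros; apply continuity_2d_pt_const.
Qed.

Lemma Cn_plus n f g : Cn D n f -> Cn D n g -> Cn D n (fun u v => f u v + g u v).
Proof.
revert f g; induction n as [|n IH]; intros f g Hf Hg.
- intros u v Huv; split; [|easy].
  apply continuity_2d_pt_plus; eapply Cn_continuous; eauto.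
- apply Cn_step with (fun e u v => pd e f u v + pd e g u v).
  + intros u v Huv; apply continuity_2d_pt_plus; eapply Cn_continuous; eauto.
  + intros e u v Huv; apply is_pd_plus; eapply Cn_is_pd; eauto.
  + intros e; apply IH; now apply Cn_pd.
Qed.

Lemma Cn_mult n f g : Cn D n f -> Cn D n g -> Cn D n (fun u v => f u v * g u v).
Proof.
revert f g; induction n as [|n IH]; intros f g Hf Hg.
- intros u v Huv; split; [|easy].
  apply continuity_2d_pt_mult; eapply Cn_continuous; eauto.
- apply Cn_step with (fun e u v => pd e f u v * g u v + f u v * pd e g u v).
  + intros u v Huv; apply continuity_2d_pt_mult; eapply Cn_continuous; eauto.
  + intros e u v Huv; apply is_pd_mult; eapply Cn_is_pd; eauto.
  + intros e; apply Cn_plus; apply IH; auto using Cn_pd, Cn_pred.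
Qed.

Lemma Cn_lsum {I : Type} (l : list I) n (F : I -> R -> R -> R) :
  (forall i, Cn D n (F i)) -> Cn D n (fun u v => lsum l (fun i => F i u v)).
Proof.
intros H; induction l as [|i l IH]; simpl.
- apply Cn_const.
- now apply Cn_plus.
Qed.

Lemma smooth_const c : smooth D (fun _ _ => c).
Proof. intros n; apply Cn_const. Qed.

Lemma smooth_plus f g :
  smooth D f -> smooth D g -> smooth D (fun u v => f u v + g u v).
Proof. intros Hf Hg n; apply Cn_plus; [exact (Hf n)|exact (Hg n)]. Qed.

Lemma smooth_mult f g :
  smooth D f -> smooth D g -> smooth D (fun u v => f u v * g u v).
Proof. intros Hf Hg n; apply Cn_mult; [exact (Hf n)|exact (Hg n)]. Qed.

Lemma smooth_ext f g :
  (forall u v, D (u, v) -> f u v = g u v) -> smooth D f -> smooth D g.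
Proof. intros E Hf n; apply Cn_ext with f; [exact E|exact (Hf n)]. Qed.

Lemma smooth_opp f : smooth D f -> smooth D (fun u v => - f u v).
Proof.
intros Hf; apply smooth_ext with (fun u v => -1 * f u v).
- intros; ring.
- apply smooth_mult; [apply smooth_const|easy].
Qed.

Lemma smooth_pd e f : smooth D f -> smooth D (pd e f).
Proof. intros H n; apply Cn_pd; exact (H (S n)). Qed.

Lemma smooth_continuous f u v : smooth D f -> D (u, v) -> continuity_2d_pt f u v.
Proof. intros H; apply (Cn_continuous D 0); exact (H 0%nat). Qed.

Lemma smooth_is_pd e f u v : smooth D f -> D (u, v) -> is_pd e f u v (pd e f u v).
Proof. intros H; apply (Cn_is_pd D 0); exact (H 1%nat). Qed.

Lemma smooth_inv f :
  (forall u v, D (u, v) -> f u v <> 0) -> smooth D f ->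
  smooth D (fun u v => / f u v).
Proof.
intros Hn Hf n; change (Cn D n (fun u v => / f u v)).
assert (Hc : forall u v, D (u, v) -> continuity_2d_pt (fun u v => / f u v) u v).
{ intros u v Huv; apply continuity_2d_pt_inv; [|now apply Hn].
  now apply smooth_continuous. }
induction n as [|n IH].
- intros u v Huv; split; [now apply Hc|easy].
- apply Cn_step with (fun e u v => - pd e f u v * (/ f u v * / f u v)); [easy| |].
  + intros e u v Huv; apply is_pd_inv; [now apply smooth_is_pd|now apply Hn].
  + intros e; apply Cn_mult; [|now apply Cn_mult].
    exact (smooth_opp _ (smooth_pd e f Hf) n).
Qed.

Lemma smooth_pd_comm f u v :
  smooth D f -> D (u, v) -> pd pU (pd pV f) u v = pd pV (pd pU f) u v.
Proof.
intros Hf Huv.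
apply Schwarz.
- destruct (open_locally_2d D u v D_open Huv) as [r Hr].
  exists r; intros s t Hs Ht; specialize (Hr s t Hs Ht).
  repeat split; eexists.
  + exact (smooth_is_pd pU f s t Hf Hr).
  + exact (smooth_is_pd pV f s t Hf Hr).
  + exact (smooth_is_pd pU _ s t (smooth_pd pV f Hf) Hr).
  + exact (smooth_is_pd pV _ s t (smooth_pd pU f Hf) Hr).
- exact (smooth_continuous _ u v (smooth_pd pU _ (smooth_pd pV f Hf)) Huv).
- exact (smooth_continuous _ u v (smooth_pd pV _ (smooth_pd pU f Hf)) Huv).
Qed.

End Smooth.

Lemma smooth_sub (D D' : R * R -> Prop) f :
  (forall p, D' p -> D p) -> smooth D f -> smooth D' f.
Proof. intros H Hf n u v Huv; now apply Hf, H. Qed.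

(** * Connected sets of the plane *)

(** The function equal to -1 on P and to 1 on Q would be continuous and skip the
    value 0. *)
Lemma line_connected (P Q : R -> Prop) :
  open P -> open Q -> (forall t, P t \/ Q t) -> (forall t, P t -> Q t -> False) ->
  P 0 -> Q 1 -> False.
Proof.
intros HP HQ Hc Hd H0 H1.
set (h := fun t => if excluded_middle_informative (P t) then -1 else 1).
assert (Hh : continuity h).
{ intros t; destruct (Hc t) as [Ht|Ht].
  - apply continuity_pt_ext_loc with (fun _ => -1).
    + apply (filter_imp P); [|now apply HP].
      intros s Hs; unfold h; destruct (excluded_middle_informative (P s)); tauto.
    + apply continuity_pt_const; intros x y; reflexivity.
  - apply continuity_pt_ext_loc with (fun _ => 1).
    + apply (filter_imp Q); [|now apply HQ].
      intros s Hs; unfold h; destruct (excluded_middle_informative (P s)); [|easy].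
      now destruct (Hd s).
    + apply continuity_pt_const; intros x y; reflexivity. }
assert (E0 : h 0 = -1).
{ unfold h; destruct (excluded_middle_informative (P 0)); tauto. }
assert (E1 : h 1 = 1).
{ unfold h; destruct (excluded_middle_informative (P 1)); [|easy].
  now destruct (Hd 1). }
destruct (IVT h 0 1) as [z [_ Hz]]; [easy|lra|lra|lra|].
revert Hz; unfold h; destruct (excluded_middle_informative (P z)); lra.
Qed.

(** A separation of a convex set would separate a segment, extended to the
    line by the retraction of the line onto [0, 1]. *)
Lemma convex_connected (D : R * R -> Prop) :
  (forall p q t, D p -> D q -> 0 <= t <= 1 ->
     D (fst p + t * (fst q - fst p), snd p + t * (snd q - snd p))) ->
  is_connected_set D.
Proof.
intros HD A B HA HB Hc Hd.
apply NNPP; intros HN; apply not_or_and in HN; destruct HN as [NA NB].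
apply not_all_ex_not in NA; destruct NA as [q Hq].
apply not_all_ex_not in NB; destruct NB as [p Hp].
apply imply_to_and in Hq; destruct Hq as [Dq Aq].
apply imply_to_and in Hp; destruct Hp as [Dp Bp].
set (c := fun t => (Rabs t + 1 - Rabs (t - 1)) / 2).
set (g := fun t => (fst p + c t * (fst q - fst p), snd p + c t * (snd q - snd p))).
assert (Hct : forall t, 0 <= c t <= 1).
{ intros t; unfold c, Rabs; destruct (Rcase_abs t), (Rcase_abs (t - 1)); lra. }
assert (Hg : forall t, D (g t)) by (intros t; now apply HD).
assert (Hgc : forall t, continuous g t).
{ assert (Hcc : forall t, continuous c t).
  { intros t; unfold c, Rdiv, Rminus.
    apply continuity_pt_filterlim.
    repeat first [ apply continuity_pt_mult | apply continuity_pt_plus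
      | apply continuity_pt_const; intros ? ?; reflexivity
      | apply Rcontinuity_abs | apply continuity_pt_opp ].
    apply (continuity_pt_comp (fun t => t + - (1)) Rabs); [|apply Rcontinuity_abs].
    apply continuity_pt_plus; [apply continuity_pt_id|].
    apply continuity_pt_const; intros ? ?; reflexivity. }
  intros t; unfold g.
  apply (continuous_comp_2 (fun t => fst p + c t * (fst q - fst p))
    (fun t => snd p + c t * (snd q - snd p)) (fun x y => (x, y))).
  - apply (continuous_plus (fun _ => fst p) (fun t => c t * (fst q - fst p))).
    apply continuous_const.
    apply (continuous_mult c (fun _ => fst q - fst p)); [apply Hcc|apply continuous_const].
  - apply (continuous_plus (fun _ => snd p) (fun t => c t * (snd q - snd p))).
    apply continuous_const.
    apply (continuous_mult c (fun _ => snd q - snd p)); [apply Hcc|apply continuous_const].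
  - apply continuous_ext with (fun z => z); [now intros [x y]|apply continuous_id]. }
apply (line_connected (fun t => A (g t)) (fun t => B (g t))).
- apply open_comp; [intros t _; apply Hgc|easy].
- apply open_comp; [intros t _; apply Hgc|easy].
- intros t; now apply Hc.
- intros t; now apply Hd.
- replace (g 0) with p.
  + destruct (Hc p Dp); tauto.
  + unfold g, c; rewrite Rabs_R0, Rabs_left by lra.
    destruct p, q; simpl; f_equal; field.
- replace (g 1) with q.
  + destruct (Hc q Dq); tauto.
  + unfold g, c; rewrite Rminus_diag, Rabs_R1, Rabs_R0.
    destruct p, q; simpl; f_equal; field.
Qed.

Lemma union_connected (U V : R * R -> Prop) (p : R * R) :
  is_connected_set U -> is_connected_set V -> U p -> V p ->
  is_connected_set (fun q => U q \/ V q).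
Proof.
intros HU HV Up Vp A B HA HB Hc Hd.
assert (HA' := HU A B HA HB (fun q H => Hc q (or_introl H))
  (fun q H => Hd q (or_introl H))).
assert (HB' := HV A B HA HB (fun q H => Hc q (or_intror H))
  (fun q H => Hd q (or_intror H))).
destruct HA' as [HA'|HA'], HB' as [HB'|HB'].
- left; intros q [Hq|Hq]; auto.
- exfalso; apply (Hd p); auto.
- exfalso; apply (Hd p); auto.
- right; intros q [Hq|Hq]; auto.
Qed.

Definition square (a b r : R) (p : R * R) : Prop :=
  Rabs (fst p - a) < r /\ Rabs (snd p - b) < r.

Lemma square_iff (a b r s t : R) :
  square a b r (s, t) <-> a - r < s < a + r /\ b - r < t < b + r.
Proof.
unfold square; simpl; split.
- intros [H1 H2]; apply Rabs_def2 in H1, H2; lra.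
- intros H; split; apply Rabs_def1; lra.
Qed.

Lemma square_open (a b r : R) : open (square a b r).
Proof.
apply locally_2d_open; intros u v H; apply square_iff in H.
set (d := Rmin (Rmin (u - (a - r)) (a + r - u)) (Rmin (v - (b - r)) (b + r - v))).
assert (Hd : 0 < d) by (unfold d; repeat apply Rmin_glb_lt; lra).
exists (mkposreal d Hd); simpl; intros s t Hs Ht; apply square_iff.
apply Rabs_def2 in Hs, Ht.
assert (d <= u - (a - r)) by (eapply Rle_trans; [apply Rmin_l|apply Rmin_l]).
assert (d <= a + r - u) by (eapply Rle_trans; [apply Rmin_l|apply Rmin_r]).
assert (d <= v - (b - r)) by (eapply Rle_trans; [apply Rmin_r|apply Rmin_l]).
assert (d <= b + r - v) by (eapply Rle_trans; [apply Rmin_r|apply Rmin_r]).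
lra.
Qed.

Lemma segment_in (a b x y t : R) :
  a < x < b -> a < y < b -> 0 <= t <= 1 -> a < x + t * (y - x) < b.
Proof. intros Hx Hy Ht; destruct (Rle_dec x y); split; nra. Qed.

Lemma squares_meet_connected (a b r a' b' r' : R) :
  is_connected_set (fun p => square a b r p /\ square a' b' r' p).
Proof.
apply convex_connected; intros [x y] [x' y'] t [H1 H2] [H1' H2'] Ht; simpl.
apply square_iff in H1, H2, H1', H2'.
split; apply square_iff; split; apply segment_in; tauto.
Qed.

Lemma square_connected (a b r : R) : is_connected_set (square a b r).
Proof.
apply convex_connected; intros [x y] [x' y'] t H1 H1' Ht; simpl.
apply square_iff in H1, H1'.
apply square_iff; split; apply segment_in; tauto.
Qed.

(** * Flat linear systems in the plane *)

Lemma filter_forall_in {T I : Type} (F : (T -> Prop) -> Prop) {FF : Filter F}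
    (l : list I) (P : I -> T -> Prop) :
  (forall i, F (P i)) -> F (fun x => forall i, In i l -> P i x).
Proof.
intros H; induction l as [|i l IH].
- apply filter_forall; intros x i [].
- apply (filter_imp (fun x => P i x /\ forall j, In j l -> P j x)).
  + intros x [Hi Hl] j [<-|Hj]; [exact Hi|now apply Hl].
  + now apply filter_and.
Qed.

Lemma is_derive_little_o (f : R -> R) (x d : R) :
  is_derive f x d <->
  forall eps : posreal,
    locally 0 (fun h => Rabs (f (x + h) - f x - h * d) <= eps * Rabs h).
Proof.
split.
- intros H eps; apply is_derive_Reals in H.
  destruct (H eps (cond_pos eps)) as [r Hr]; exists r; intros h Hh.
  change (Rabs (h - 0) < r) in Hh; rewrite Rminus_0_r in Hh.
  destruct (Req_dec h 0) as [->|Hn].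
  { rewrite Rplus_0_r, Rmult_0_l, Rminus_diag, Rminus_0_r, Rabs_R0; lra. }
  specialize (Hr h Hn Hh).
  replace (f (x + h) - f x - h * d) with (((f (x + h) - f x) / h - d) * h)
    by (field; easy).
  rewrite Rabs_mult; apply Rmult_le_compat_r; [apply Rabs_pos|lra].
- intros H; apply is_derive_Reals; intros eps Heps.
  assert (Heps2 : 0 < eps / 2) by lra.
  destruct (H (mkposreal _ Heps2)) as [r Hr]; exists r; intros h Hn Hh.
  assert (Hb : ball 0 r h) by (change (Rabs (h - 0) < r); now rewrite Rminus_0_r).
  specialize (Hr h Hb); simpl in Hr.
  assert (Hp : 0 < Rabs h) by now apply Rabs_pos_lt.
  replace ((f (x + h) - f x) / h - d) with ((f (x + h) - f x - h * d) / h)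
    by (field; easy).
  unfold Rdiv; rewrite Rabs_mult, Rabs_inv.
  apply Rmult_lt_reg_r with (Rabs h); [easy|].
  rewrite Rmult_assoc, Rinv_l by lra.
  assert (eps / 2 * Rabs h < eps * Rabs h) by (apply Rmult_lt_compat_r; lra).
  lra.
Qed.

Section LinearSystem.
Context {I : Type} (l : list I).
Hypothesis l_full : forall i, In i l.
Variable A : param -> I -> I -> R -> R -> R.

Definition act (e : param) (W : I -> R -> R -> R) (i : I) (u v : R) : R :=
  lsum l (fun j => A e i j u v * W j u v).

Definition solves (D : R * R -> Prop) (W : I -> R -> R -> R) : Prop :=
  forall u v, D (u, v) -> forall i,
    continuity_2d_pt (W i) u v /\ forall e, is_pd e (W i) u v (act e W i u v).

Definition smooth_coefs (D : R * R -> Prop) : Prop :=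
  forall e i j, smooth D (A e i j).

Definition flat (D : R * R -> Prop) : Prop :=
  forall i k u v, D (u, v) ->
    pd pV (A pU i k) u v + lsum l (fun j => A pU i j u v * A pV j k u v) =
    pd pU (A pV i k) u v + lsum l (fun j => A pV i j u v * A pU j k u v).

Lemma solves_ext D W W' :
  open D -> (forall i u v, D (u, v) -> W i u v = W' i u v) ->
  solves D W -> solves D W'.
Proof.
intros HD E H u v Huv i; destruct (H u v Huv i) as [Hc Hp]; split.
- apply continuity_2d_pt_ext_loc with (W i); [|easy].
  destruct (open_locally_2d D u v HD Huv) as [r Hr].
  exists r; intros s t Hs Ht; now apply E, Hr.
- intros e; replace (act e W' i u v) with (act e W i u v).
  + apply (is_pd_ext_on D) with (W i); auto.
  + apply lsum_ext; intros j; now rewrite E.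
Qed.

Lemma solves_sub (D D' : R * R -> Prop) W :
  (forall p, D' p -> D p) -> solves D W -> solves D' W.
Proof. intros H HW u v Huv; now apply HW, H. Qed.

(** Each differentiation of a solution is a linear expression in it, so
    regularity is gained one order at a time. *)
Lemma solves_smooth D W :
  open D -> smooth_coefs D -> solves D W -> forall i, smooth D (W i).
Proof.
intros HD HA HW i n; revert i.
enough (H : forall i, Cn D n (W i)) by exact H.
induction n as [|n IH]; intros i.
- intros u v Huv; split; [now apply HW|easy].
- apply (Cn_step D HD) with (fun e => act e W i).
  + intros u v Huv; now apply HW.
  + intros e u v Huv; now apply HW.
  + intros e; apply Cn_lsum; [easy|]; intros j.
    apply Cn_mult; [easy|exact (HA e i j n)|apply IH].
Qed.

(** * Cells *)

(** A cell is so small that along each of its horizontal and vertical segments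
    the system is a short linear ordinary differential equation; the bounds on
    the u-derivatives control the dependence of vertical solutions on u. *)
Definition cell (D B : R * R -> Prop) : Prop :=
  exists a b r M, B = square a b r /\ 0 < r /\ 0 <= M /\
    INR (length l) * M * (2 * r) <= / 2 /\
    forall s t, B (s, t) -> D (s, t) /\ forall i j,
      (forall e, Rabs (A e i j s t) <= M) /\
      Rabs (pd pU (A pV i j) s t) <= M /\
      Rabs (pd pU (pd pU (A pV i j)) s t) <= M.

Lemma cell_around D u v :
  open D -> smooth_coefs D -> D (u, v) -> exists B, cell D B /\ B (u, v).
Proof.
intros HD HA Huv.
set (F := fun i j s t => Rabs (A pU i j s t) + Rabs (A pV i j s t) +
  Rabs (pd pU (A pV i j) s t) + Rabs (pd pU (pd pU (A pV i j)) s t)).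
set (G := fun s t => lsum l (fun i => lsum l (fun j => F i j s t))).
assert (Habs : forall f, smooth D f -> continuity_2d_pt (fun s t => Rabs (f s t)) u v).
{ intros f Hf; apply (continuity_1d_2d_pt_comp Rabs f); [apply Rcontinuity_abs|].
  exact (smooth_continuous D f u v Hf Huv). }
assert (HF : forall i j, continuity_2d_pt (F i j) u v).
{ intros i j; unfold F.
  repeat apply continuity_2d_pt_plus; apply Habs.
  - apply HA.
  - apply HA.
  - apply (smooth_pd D); apply HA.
  - apply (smooth_pd D), (smooth_pd D); apply HA. }
assert (HG : continuity_2d_pt G u v).
{ apply continuity_2d_pt_lsum; intros i.
  apply continuity_2d_pt_lsum; intros j; apply HF. }
assert (F0 : forall i j s t, 0 <= F i j s t).
{ intros i j s t; unfold F; repeat apply Rplus_le_le_0_compat; apply Rabs_pos. }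
assert (FG : forall i j s t, F i j s t <= G s t).
{ intros i j s t; unfold G.
  eapply Rle_trans; [|apply (le_lsum l (fun i => lsum l (fun j => F i j s t)) i)];
    [|intros; now apply lsum_nonneg|easy].
  now apply (le_lsum l (fun j => F i j s t) j). }
assert (G0 : 0 <= G u v) by (repeat (apply lsum_nonneg; intros); apply F0).
set (M := G u v + 1).
assert (HN := pos_INR (length l)); set (N := INR (length l)) in *.
destruct (HG (mkposreal 1 Rlt_0_1)) as [r1 Hr1].
destruct (open_locally_2d D u v HD Huv) as [r2 Hr2].
assert (HNM : 0 <= N * M) by (apply Rmult_le_pos; unfold M; lra).
set (r3 := / (4 * (N * M + 1))).
assert (Hr3 : 0 < r3) by (apply Rinv_0_lt_compat; lra).
set (r := Rmin (Rmin r1 r2) r3).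
assert (Hr : 0 < r).
{ unfold r; repeat apply Rmin_glb_lt; [apply cond_pos|apply cond_pos|easy]. }
exists (square u v r); split.
- exists u, v, r, M; split; [easy|split; [easy|split; [unfold M; lra|split]]].
  + fold N; apply Rle_trans with (N * M * (2 * r3)).
    { apply Rmult_le_compat_l; [easy|].
      apply Rmult_le_compat_l; [lra|apply Rmin_r]. }
    unfold r3; replace (N * M * (2 * / (4 * (N * M + 1))))
      with (/ 2 * ((N * M) / (N * M + 1))) by (field; lra).
    rewrite <- (Rmult_1_r (/ 2)) at 2.
    apply Rmult_le_compat_l; [lra|].
    apply Rmult_le_reg_r with (N * M + 1); [lra|].
    unfold Rdiv; rewrite Rmult_assoc, Rinv_l by lra; lra.
  + intros s t [Hs Ht]; simpl in Hs, Ht.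
    assert (Hs1 : Rabs (s - u) < Rmin r1 r2)
      by (eapply Rlt_le_trans; [exact Hs|apply Rmin_l]).
    assert (Ht1 : Rabs (t - v) < Rmin r1 r2)
      by (eapply Rlt_le_trans; [exact Ht|apply Rmin_l]).
    split.
    * apply Hr2; (eapply Rlt_le_trans; [eassumption|apply Rmin_r]).
    * intros i j.
      assert (HM : F i j s t <= M).
      { eapply Rle_trans; [apply FG|].
        assert (H1 : Rabs (G s t - G u v) < 1).
        { apply Hr1; (eapply Rlt_le_trans; [eassumption|apply Rmin_l]). }
        apply Rabs_def2 in H1; unfold M; lra. }
      unfold F in HM.
      pose proof (Rabs_pos (A pU i j s t)); pose proof (Rabs_pos (A pV i j s t)).
      pose proof (Rabs_pos (pd pU (A pV i j) s t)).
      pose proof (Rabs_pos (pd pU (pd pU (A pV i j)) s t)).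
      split; [intros []|split]; lra.
- split; simpl; rewrite Rminus_diag, Rabs_R0; easy.
Qed.

(** * Uniqueness for linear systems *)

(** Any point of a square is reached from any other by a horizontal segment
    followed by a vertical one, and both are short. *)
Lemma solves_zero_on_cell D B W u v :
  cell D B -> solves B W -> B (u, v) -> (forall i, W i u v = 0) ->
  forall s t, B (s, t) -> forall i, W i s t = 0.
Proof.
intros (a & b & r & M & -> & Hr & HM & Hshort & HB) HW Huv H0 s t Hst.
pose proof (proj1 (square_iff _ _ _ _ _) Huv) as [Hu Hv].
pose proof (proj1 (square_iff _ _ _ _ _) Hst) as [Hs Ht].
assert (Hsv : square a b r (s, v)) by now apply square_iff.
assert (Hnull : forall F : I -> R, lsum l (fun i => Rabs (F i)) <= 0 ->
  forall i, F i = 0).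
{ intros F HF i.
  assert (Rabs (F i) <= 0).
  { eapply Rle_trans; [|exact HF].
    apply (le_lsum l (fun i => Rabs (F i)) i); [intros; apply Rabs_pos|easy]. }
  destruct (Req_dec (F i) 0) as [|Hn]; [easy|].
  apply Rabs_pos_lt in Hn; lra. }
assert (Hz : forall p q, (forall i, W i p q = 0) ->
  lsum l (fun i => Rabs (W i p q)) = 0).
{ intros p q H; apply lsum_0; intros i; rewrite H; apply Rabs_R0. }
assert (Hh : forall i, W i s v = 0).
{ apply Hnull.
  eapply Rle_trans.
  - apply (short_gronwall l (a - r) (a + r) M HM) with
      (E := fun i x => W i x v) (dE := fun i x => act pU W i x v) (d := 0) (s := u).
    + replace (a + r - (a - r)) with (2 * r) by ring; exact Hshort.
    + lra.
    + lra.
    + lra.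
    + intros i x Hx.
      assert (Hxv : square a b r (x, v)).
      { apply square_iff; split; [|lra]; now apply (between_in _ _ u s). }
      exact (proj2 (HW x v Hxv i) pU).
    + intros i x Hx; rewrite Rplus_0_r; apply Rabs_lsum_mul; intros j.
      apply HB, square_iff; split; [|lra]; now apply (between_in _ _ u s).
  - rewrite Hz by easy; lra. }
apply Hnull.
eapply Rle_trans.
- apply (short_gronwall l (b - r) (b + r) M HM) with
    (E := fun i y => W i s y) (dE := fun i y => act pV W i s y) (d := 0) (s := v).
  + replace (b + r - (b - r)) with (2 * r) by ring; exact Hshort.
  + lra.
  + lra.
  + lra.
  + intros i y Hy.
    assert (Hxv : square a b r (s, y)).
    { apply square_iff; split; [lra|]; now apply (between_in _ _ v t). }
    exact (proj2 (HW s y Hxv i) pV).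
  + intros i y Hy; rewrite Rplus_0_r; apply Rabs_lsum_mul; intros j.
    apply HB, square_iff; split; [lra|]; now apply (between_in _ _ v t).
- rewrite Hz by easy; lra.
Qed.

(** The set where two solutions agree is closed in D by continuity and open by
    uniqueness on cells. *)
Theorem solves_unique D W W' u0 v0 :
  open D -> is_connected_set D -> smooth_coefs D ->
  solves D W -> solves D W' -> D (u0, v0) ->
  (forall i, W i u0 v0 = W' i u0 v0) ->
  forall u v, D (u, v) -> forall i, W i u v = W' i u v.
Proof.
intros HD HC HA HW HW' H0 E0.
set (E := fun i u v => W i u v - W' i u v).
assert (HE : solves D E).
{ intros u v Huv i; destruct (HW u v Huv i) as [Hc Hp].
  destruct (HW' u v Huv i) as [Hc' Hp']; split.
  - now apply continuity_2d_pt_minus.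
  - intros e; replace (act e E i u v) with (act e W i u v - act e W' i u v).
    + now apply is_pd_minus.
    + unfold act; rewrite <- lsum_minus; apply lsum_ext; intros j; unfold E; ring. }
set (Z := fun p : R * R => locally_2d (fun s t => forall i, E i s t = 0) (fst p) (snd p)).
set (N := fun p : R * R => D p /\ exists i, E i (fst p) (snd p) <> 0).
destruct (HC Z N) as [H|H].
- apply locally_2d_open; intros u v H.
  apply (locally_2d_impl_strong (fun s t => forall i, E i s t = 0));
    [|exact H].
  apply locally_2d_forall; intros s t Hst; exact Hst.
- apply locally_2d_open; intros u v [Huv [i Hi]].
  apply (locally_2d_impl (fun s t => D (s, t) /\ E i s t <> 0)).
  + apply locally_2d_forall; intros s t [Hst Hn]; split; [easy|now exists i].
  + apply locally_2d_and; [now apply open_locally_2d|].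
    apply continuity_2d_pt_neq_0; [now apply HE|easy].
- intros [u v] Huv; destruct (classic (exists i, E i u v <> 0)) as [Hn|Hn].
  { right; now split. }
  left; unfold Z; simpl.
  assert (Hz : forall i, E i u v = 0).
  { intros i; apply NNPP; intros Hi; apply Hn; now exists i. }
  destruct (cell_around D u v HD HA Huv) as [B [HB Buv]].
  assert (HBD : forall p, B p -> D p).
  { destruct HB as (a & b & r & M & -> & _ & _ & _ & HB); intros [s t] Hst.
    now apply HB. }
  assert (Bo : open B).
  { destruct HB as (a & b & r & M & -> & _); apply square_open. }
  destruct (open_locally_2d B u v Bo Buv) as [r Hr].
  exists r; intros s t Hs Ht.
  apply (solves_zero_on_cell D B E u v HB); auto.
  now apply solves_sub with D.
- intros [u v] Huv HZ [_ [i Hi]].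
  apply Hi; exact (locally_2d_singleton _ _ _ HZ i).
- intros u v Huv i.
  pose proof (locally_2d_singleton _ _ _ (H (u, v) Huv) i) as Hi.
  unfold E in Hi; simpl in Hi; lra.
- destruct (H (u0, v0) H0) as [_ [i Hi]]; exfalso; apply Hi; simpl.
  unfold E; rewrite E0; ring.
Qed.

End LinearSystem.

(** * Solutions of flat systems on a cell *)

Section CellExistence.
Context {I : Type} (l : list I).
Hypothesis l_full : forall i, In i l.
Variable A : param -> I -> I -> R -> R -> R.
Variables (a b r M : R).
Let B := square a b r.
Hypothesis r_pos : 0 < r.
Hypothesis M_nonneg : 0 <= M.
Hypothesis short : INR (length l) * M * (2 * r) <= / 2.
Hypothesis A_smooth : smooth_coefs A B.
Hypothesis A_bounded : forall e i j s t, B (s, t) -> Rabs (A e i j s t) <= M.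
Hypothesis A_d1 : forall i j s t, B (s, t) -> Rabs (pd pU (A pV i j) s t) <= M.
Hypothesis A_d2 : forall i j s t, B (s, t) ->
  Rabs (pd pU (pd pU (A pV i j)) s t) <= M.
Hypothesis A_flat : flat l A B.

Variables (u1 v1 : R) (w0 : I -> R).
Hypothesis base : B (u1, v1).

Let N : R := INR (length l).
Let W0 : R := lsum l (fun i => Rabs (w0 i)).

Variable W : I -> R -> R -> R.
Hypothesis W_init : forall i, W i u1 v1 = w0 i.
Hypothesis W_base_line : forall i u, a - r < u < a + r ->
  is_derive (fun s => W i s v1) u (act l A pU W i u v1).
Hypothesis W_vertical : forall i u v, B (u, v) ->
  is_derive (fun t => W i u t) v (act l A pV W i u v).

Let baseU : a - r < u1 < a + r.
Proof. apply (proj1 (square_iff _ _ _ _ _) base). Qed.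

Let baseV : b - r < v1 < b + r.
Proof. apply (proj1 (square_iff _ _ _ _ _) base). Qed.

Let N_nonneg : 0 <= N.
Proof. apply pos_INR. Qed.

Let W0_nonneg : 0 <= W0.
Proof. apply lsum_nonneg; intros; apply Rabs_pos. Qed.

(** One Gronwall factor 2 for the base line and one for the vertical segment. *)
Lemma W_bound u v : B (u, v) -> lsum l (fun i => Rabs (W i u v)) <= 4 * W0.
Proof.
intros Huv; apply square_iff in Huv; destruct Huv as [Hu Hv].
assert (H1 : lsum l (fun i => Rabs (W i u v1)) <= 2 * W0).
{ eapply Rle_trans.
  - apply (short_gronwall l (a - r) (a + r) M M_nonneg) with
      (E := fun i x => W i x v1) (dE := fun i x => act l A pU W i x v1)
      (d := 0) (s := u1); try lra.
    + intros i x Hx; apply W_base_line; now apply (between_in _ _ u1 u).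
    + intros i x Hx; rewrite Rplus_0_r; apply Rabs_lsum_mul; intros j.
      apply A_bounded, square_iff; split; [|lra]; now apply (between_in _ _ u1 u).
  - rewrite (lsum_ext l (fun i => Rabs (W i u1 v1)) (fun i => Rabs (w0 i)));
      [|intros i; now rewrite W_init].
    fold W0; lra. }
eapply Rle_trans.
- apply (short_gronwall l (b - r) (b + r) M M_nonneg) with
    (E := fun i y => W i u y) (dE := fun i y => act l A pV W i u y)
    (d := 0) (s := v1); try lra.
  + intros i y Hy; apply W_vertical, square_iff.
    split; [lra|]; now apply (between_in _ _ v1 v).
  + intros i y Hy; rewrite Rplus_0_r; apply Rabs_lsum_mul; intros j.
    apply A_bounded, square_iff; split; [lra|]; now apply (between_in _ _ v1 v).
- lra.
Qed.

Lemma act_bound e i u v : B (u, v) -> Rabs (act l A e W i u v) <= M * (4 * W0).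
Proof.
intros Huv; eapply Rle_trans.
- apply (Rabs_lsum_mul l _ _ M); intros j; now apply A_bounded.
- apply Rmult_le_compat_l; [easy|now apply W_bound].
Qed.

Lemma coef_increment i j u h v :
  B (u, v) -> B (u + h, v) ->
  Rabs (A pV i j (u + h) v - A pV i j u v) <= M * Rabs h.
Proof.
intros Huv Hh.
pose proof (proj1 (square_iff _ _ _ _ _) Huv) as [Hu Hv].
pose proof (proj1 (square_iff _ _ _ _ _) Hh) as [Hu' _].
replace (Rabs h) with (Rabs (u + h - u)) by (f_equal; ring).
apply (increment_bound (fun s => A pV i j s v) (fun s => pd pU (A pV i j) s v)).
intros x Hx.
assert (Hxv : B (x, v)).
{ apply square_iff; split; [|lra]; now apply (between_in _ _ u (u + h)). }
split; [|now apply A_d1].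
exact (smooth_is_pd B pU (A pV i j) x v (A_smooth pV i j) Hxv).
Qed.

Lemma coef_increment2 i j u h v :
  B (u, v) -> B (u + h, v) ->
  Rabs (A pV i j (u + h) v - A pV i j u v - h * pd pU (A pV i j) u v)
  <= M * h ^ 2.
Proof.
intros Huv Hh.
pose proof (proj1 (square_iff _ _ _ _ _) Huv) as [Hu Hv].
pose proof (proj1 (square_iff _ _ _ _ _) Hh) as [Hu' _].
set (f := fun s => A pV i j s v - s * pd pU (A pV i j) u v).
replace (A pV i j (u + h) v - A pV i j u v - h * pd pU (A pV i j) u v)
  with (f (u + h) - f u) by (unfold f; ring).
eapply Rle_trans.
- apply (increment_bound f (fun s => pd pU (A pV i j) s v - 1 * pd pU (A pV i j) u v)
    u (u + h) (M * Rabs h)).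
  intros x Hx.
  assert (Hxv : B (x, v)).
  { apply square_iff; split; [|lra]; now apply (between_in _ _ u (u + h)). }
  split.
  + apply @is_derive_minus.
    * exact (smooth_is_pd B pU (A pV i j) x v (A_smooth pV i j) Hxv).
    * apply (is_derive_scal_l (fun s => s) x 1 (pd pU (A pV i j) u v)).
      apply @is_derive_id.
  + rewrite Rmult_1_l.
    eapply Rle_trans; [apply (increment_bound (fun s => pd pU (A pV i j) s v)
      (fun s => pd pU (pd pU (A pV i j)) s v) u x M)|].
    * intros y Hy.
      assert (Hyv : B (y, v)).
      { apply square_iff; split; [|lra].
        apply (between_in _ _ u x); [easy| |easy].
        now apply (between_in _ _ u (u + h)). }
      split; [|now apply A_d2].
      exact (smooth_is_pd B pU _ y v (smooth_pd B pU _ (A_smooth pV i j)) Hyv).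
    * apply Rmult_le_compat_l; [easy|].
      revert Hx; unfold Rmin, Rmax; destruct (Rle_dec u (u + h));
        unfold Rabs; destruct (Rcase_abs (x - u)), (Rcase_abs h); lra.
- right; replace (u + h - u) with h by ring.
  rewrite Rmult_assoc, <- Rabs_mult, Rabs_pos_eq; [ring|].
  apply Rle_0_sqr.
Qed.

(** The error of the linear approximation W(u + h) - W(u) - h A_U W solves, by
    flatness, the vertical equation up to a defect of order h^2, and it is
    o(h) on the base line; the Gronwall estimate propagates this upwards. *)
Lemma W_horizontal i u v : B (u, v) ->
  is_derive (fun s => W i s v) u (act l A pU W i u v).
Proof.
intros Huv.
pose proof (proj1 (square_iff _ _ _ _ _) Huv) as [Hu Hv].
set (E := fun h j s => W j (u + h) s - W j u s - h * act l A pU W j u s).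
set (dE := fun h j s => act l A pV W j (u + h) s - act l A pV W j u s -
  h * lsum l (fun k => pd pV (A pU j k) u s * W k u s +
                       A pU j k u s * act l A pV W k u s)).
set (C := M * (4 * W0) + M * (N * (M * (4 * W0)))).
assert (HC : 0 <= C).
{ unfold C; apply Rplus_le_le_0_compat;
    repeat apply Rmult_le_pos; try easy; lra. }
assert (HE : forall h j s, B (u, s) -> B (u + h, s) ->
  is_derive (E h j) s (dE h j s)).
{ intros h j s Hs Hhs; unfold E, dE.
  apply @is_derive_minus; [apply @is_derive_minus; now apply W_vertical|].
  apply (is_derive_scal (fun t => act l A pU W j u t)).
  apply (is_derive_lsum l (fun k t => A pU j k u t * W k u t)); intros k.
  apply (is_derive_mult (fun t => A pU j k u t) (fun t => W k u t)).
  - exact (smooth_is_pd B pV (A pU j k) u s (A_smooth pU j k) Hs).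
  - now apply W_vertical.
  - intros; apply Rmult_comm. }
assert (HdE : forall h j s, B (u, s) -> B (u + h, s) ->
  dE h j s = lsum l (fun k => A pV j k (u + h) s * E h k s) +
    (lsum l (fun k => (A pV j k (u + h) s - A pV j k u s -
                       h * pd pU (A pV j k) u s) * W k u s) +
     h * lsum l (fun k => (A pV j k (u + h) s - A pV j k u s) *
                          act l A pU W k u s))).
{ intros h j s Hs Hhs; unfold dE.
  rewrite lsum_plus.
  (* Flatness exchanges the v-derivative of A_U for the u-derivative of A_V. *)
  assert (Hfl : lsum l (fun k => pd pV (A pU j k) u s * W k u s) +
    lsum l (fun k => A pU j k u s * act l A pV W k u s) =
    lsum l (fun k => pd pU (A pV j k) u s * W k u s) +
    lsum l (fun k => A pV j k u s * act l A pU W k u s)).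
  { assert (Hx : forall e e', lsum l (fun k => A e j k u s * act l A e' W k u s) =
      lsum l (fun k => lsum l (fun m => A e j m u s * A e' m k u s) * W k u s)).
    { intros e e'.
      rewrite (lsum_ext l _ (fun k => lsum l (fun m => A e j k u s * (A e' k m u s * W m u s)))).
      2: { intros k; unfold act; now rewrite lsum_scal. }
      rewrite lsum_exchange; apply lsum_ext; intros k.
      rewrite <- lsum_scal_r; apply lsum_ext; intros m; ring. }
    rewrite !Hx, <- !lsum_plus; apply lsum_ext; intros k.
    rewrite <- !Rmult_plus_distr_r; f_equal; now apply A_flat. }
  rewrite Hfl; unfold act at 1 2.
  rewrite Rmult_plus_distr_l, <- !lsum_scal.
  rewrite <- !lsum_plus, <- !lsum_minus.
  apply lsum_ext; intros k; unfold E; ring. }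
assert (Hlin : forall eps : posreal, locally 0 (fun h =>
  forall j, In j l -> Rabs (E h j v1) <= eps * Rabs h)).
{ intros eps; apply filter_forall_in; [apply locally_filter|]; intros j.
  apply (proj1 (is_derive_little_o (fun s => W j s v1) u (act l A pU W j u v1))).
  now apply W_base_line. }
apply is_derive_little_o; intros eps.
assert (Heps : 0 < eps) by apply cond_pos.
(* e1 bounds the error from the base line and e2 the quadratic one, each by
   half of eps |h|. *)
set (e1 := eps / (4 * N + 4)).
assert (He1 : 0 < e1) by (apply Rdiv_lt_0_compat; lra).
assert (HNC : 0 <= N * C * r) by (repeat apply Rmult_le_pos; lra).
set (e2 := eps / (2 * (4 * (N * C * r) + 1))).
assert (He2 : 0 < e2) by (apply Rdiv_lt_0_compat; lra).
assert (Hloc : locally 0 (fun h => a - r < u + h < a + r)).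
{ assert (Hd : 0 < Rmin (u - (a - r)) (a + r - u)) by (apply Rmin_glb_lt; lra).
  exists (mkposreal _ Hd); intros h Hh.
  change (Rabs (h - 0) < Rmin (u - (a - r)) (a + r - u)) in Hh.
  rewrite Rminus_0_r in Hh; apply Rabs_def2 in Hh.
  pose proof (Rmin_l (u - (a - r)) (a + r - u)).
  pose proof (Rmin_r (u - (a - r)) (a + r - u)); lra. }
assert (Hsm : locally 0 (fun h => Rabs h < e2)).
{ exists (mkposreal _ He2); intros h Hh.
  change (Rabs (h - 0) < e2) in Hh; now rewrite Rminus_0_r in Hh. }
apply (filter_imp (fun h => (forall j, In j l -> Rabs (E h j v1) <= e1 * Rabs h) /\
  (a - r < u + h < a + r /\ Rabs h < e2))).
2: { apply filter_and; [exact (Hlin (mkposreal _ He1))|now apply filter_and]. }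
intros h (Hb & Hh & Hhe).
change (Rabs (E h i v) <= eps * Rabs h).
assert (Hcol : forall s, Rmin v1 v <= s <= Rmax v1 v -> B (u, s) /\ B (u + h, s)).
{ intros s Hs; apply (between_in (b - r) (b + r)) in Hs; [|lra|lra].
  split; apply square_iff; split; lra. }
eapply Rle_trans;
  [apply (le_lsum l (fun j => Rabs (E h j v)) i); [intros; apply Rabs_pos|easy]|].
eapply Rle_trans.
{ apply (short_gronwall l (b - r) (b + r) M M_nonneg) with
    (E := E h) (dE := dE h) (d := C * h ^ 2) (s := v1).
  - replace (b + r - (b - r)) with (2 * r) by ring; exact short.
  - apply Rmult_le_pos; [easy|apply pow2_ge_0].
  - lra.
  - lra.
  - intros j s Hs; apply Hcol in Hs; now apply HE.
  - intros j s Hs; apply Hcol in Hs; destruct Hs as [Hs1 Hs2].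
    rewrite HdE by easy.
    eapply Rle_trans; [apply Rabs_triang|]; apply Rplus_le_compat.
    + apply Rabs_lsum_mul; intros k; now apply A_bounded.
    + unfold C; rewrite Rmult_plus_distr_r.
      eapply Rle_trans; [apply Rabs_triang|]; apply Rplus_le_compat.
      * eapply Rle_trans.
        { apply (Rabs_lsum_mul l _ _ (M * h ^ 2)); intros k; now apply coef_increment2. }
        replace (M * (4 * W0) * h ^ 2) with (M * h ^ 2 * (4 * W0)) by ring.
        apply Rmult_le_compat_l; [|now apply W_bound].
        apply Rmult_le_pos; [easy|apply pow2_ge_0].
      * rewrite Rabs_mult.
        replace (M * (N * (M * (4 * W0))) * h ^ 2)
          with (Rabs h * ((M * Rabs h) * (N * (M * (4 * W0))))).
        2: { rewrite <- (pow2_abs h); ring. }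
        apply Rmult_le_compat_l; [apply Rabs_pos|].
        eapply Rle_trans.
        { apply (Rabs_lsum_mul l _ _ (M * Rabs h)); intros k; now apply coef_increment. }
        apply Rmult_le_compat_l; [apply Rmult_le_pos; [easy|apply Rabs_pos]|].
        apply lsum_le_const; intros k; now apply act_bound. }
fold N.
assert (Hbase : lsum l (fun j => Rabs (E h j v1)) <= N * (e1 * Rabs h)).
{ apply lsum_le_const; intros j; now apply Hb. }
assert (Hp := Rabs_pos h).
assert (P1 : N * e1 <= eps / 4).
{ unfold e1; apply Rmult_le_reg_r with (4 * N + 4); [lra|].
  replace (N * (eps / (4 * N + 4)) * (4 * N + 4)) with (N * eps) by (field; lra).
  lra. }
assert (P2 : 4 * (N * C * r) * e2 <= eps / 2).
{ unfold e2; apply Rmult_le_reg_r with (2 * (4 * (N * C * r) + 1)); [lra|].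
  replace (4 * (N * C * r) * (eps / (2 * (4 * (N * C * r) + 1))) *
    (2 * (4 * (N * C * r) + 1))) with (4 * (N * C * r) * eps) by (field; lra).
  lra. }
assert (P3 : N * (e1 * Rabs h) <= eps / 4 * Rabs h).
{ rewrite <- Rmult_assoc; now apply Rmult_le_compat_r. }
assert (P4 : 4 * (N * C * r) * (Rabs h * Rabs h) <= eps / 2 * Rabs h).
{ apply Rle_trans with (4 * (N * C * r) * e2 * Rabs h).
  - rewrite (Rmult_assoc _ e2); apply Rmult_le_compat_l; [lra|].
    apply Rmult_le_compat_r; lra.
  - now apply Rmult_le_compat_r. }
replace (N * (C * h ^ 2) * (b + r - (b - r)))
  with (2 * (N * C * r) * (Rabs h * Rabs h)).
2: { rewrite <- (pow2_abs h); ring. }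
lra.
Qed.

Lemma W_continuous i u v : B (u, v) -> continuity_2d_pt (W i) u v.
Proof.
intros Huv eps.
pose proof (proj1 (square_iff _ _ _ _ _) Huv) as [Hu Hv].
set (L := M * (4 * W0)).
assert (HL : 0 <= L) by (apply Rmult_le_pos; lra).
assert (Heps : 0 < eps) by apply cond_pos.
destruct (open_locally_2d B u v (square_open a b r) Huv) as [d Hd].
assert (Hd' : 0 < Rmin d (eps / (2 * L + 1))).
{ apply Rmin_glb_lt; [apply cond_pos|apply Rdiv_lt_0_compat; lra]. }
exists (mkposreal _ Hd'); simpl; intros s t Hs Ht.
assert (Hst : B (s, t)).
{ apply Hd; (eapply Rlt_le_trans; [eassumption|apply Rmin_l]). }
apply square_iff in Hst.
assert (H1 : Rabs (W i s t - W i u t) <= L * Rabs (s - u)).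
{ apply (increment_bound (fun x => W i x t) (fun x => act l A pU W i x t)).
  intros x Hx; apply (between_in (a - r) (a + r)) in Hx; [|lra|lra].
  assert (B (x, t)) by (apply square_iff; lra).
  split; [now apply W_horizontal|now apply act_bound]. }
assert (H2 : Rabs (W i u t - W i u v) <= L * Rabs (t - v)).
{ apply (increment_bound (fun y => W i u y) (fun y => act l A pV W i u y)).
  intros y Hy; apply (between_in (b - r) (b + r)) in Hy; [|lra|lra].
  assert (B (u, y)) by (apply square_iff; lra).
  split; [now apply W_vertical|now apply act_bound]. }
replace (W i s t - W i u v) with ((W i s t - W i u t) + (W i u t - W i u v)) by ring.
eapply Rle_lt_trans; [apply Rabs_triang|].
set (q := eps / (2 * L + 1)) in *.
assert (Hq : (2 * L + 1) * q = eps) by (unfold q; field; lra).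
assert (Rabs (s - u) < q) by (eapply Rlt_le_trans; [exact Hs|apply Rmin_r]).
assert (Rabs (t - v) < q) by (eapply Rlt_le_trans; [exact Ht|apply Rmin_r]).
assert (L * Rabs (s - u) <= L * q) by (apply Rmult_le_compat_l; lra).
assert (L * Rabs (t - v) <= L * q) by (apply Rmult_le_compat_l; lra).
assert (0 < q) by (apply Rdiv_lt_0_compat; lra).
lra.
Qed.

End CellExistence.

Lemma choice_function {X Y : Type} (P : X -> Y -> Prop) :
  (forall x, exists y, P x y) -> exists f : X -> Y, forall x, P x (f x).
Proof.
intros H.
exists (fun x => proj1_sig (constructive_indefinite_description _ (H x))).
intros x; apply proj2_sig.
Qed.

Section Existence.
Context {I : Type} (l : list I).
Hypothesis l_full : forall i, In i l.
Variable A : param -> I -> I -> R -> R -> R.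
Variable D : R * R -> Prop.
Hypothesis A_smooth : smooth_coefs A D.
Hypothesis A_flat : flat l A D.

(** Solve along the horizontal line through the base point, and along each
    vertical line with these values as initial data. *)
Lemma solve_on_cell B u1 v1 (w0 : I -> R) :
  cell l A D B -> B (u1, v1) ->
  exists W, solves l A B W /\ forall i, W i u1 v1 = w0 i.
Proof.
intros (a & b & r & M & -> & Hr & HM & Hshort & HB) Hbase.
pose proof (proj1 (square_iff _ _ _ _ _) Hbase) as [Hu1 Hv1].
assert (HsubD : forall p, square a b r p -> D p).
{ intros [s t] Hst; now apply HB. }
assert (HAs : smooth_coefs A (square a b r)).
{ intros e i j; now apply smooth_sub with D. }
assert (Hcont : forall e i j s t, square a b r (s, t) ->
  continuity_pt (fun x => A e i j x t) s /\ continuity_pt (fun y => A e i j s y) t).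
{ intros e i j s t Hst; split; eapply continuity_pt_of_is_derive.
  - exact (smooth_is_pd _ pU _ s t (HAs e i j) Hst).
  - exact (smooth_is_pd _ pV _ s t (HAs e i j) Hst). }
destruct (linear_ode_short l (a - r) (a + r) M HM) with
  (A := fun i j s => A pU i j s v1) (t0 := u1) (w0 := w0) as [h [Hh0 Hh]].
{ replace (a + r - (a - r)) with (2 * r) by ring; exact Hshort. }
{ intros i j s Hs; apply Hcont, square_iff; lra. }
{ intros i j s Hs; apply HB, square_iff; lra. }
{ easy. }
destruct (choice_function (fun u (w : I -> R -> R) =>
  a - r < u < a + r ->
  (forall i, w i v1 = h i u) /\
  forall i t, b - r < t < b + r ->
    is_derive (w i) t (row_apply l (fun i j y => A pV i j u y) w i t)))
  as [F HF].
{ intros u; destruct (classic (a - r < u < a + r)) as [Hu|Hu].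
  2: { exists (fun _ _ => 0); tauto. }
  destruct (linear_ode_short l (b - r) (b + r) M HM) with
    (A := fun i j t => A pV i j u t) (t0 := v1) (w0 := fun i => h i u) as [w Hw].
  - replace (b + r - (b - r)) with (2 * r) by ring; exact Hshort.
  - intros i j t Ht; apply Hcont, square_iff; lra.
  - intros i j t Ht; apply HB, square_iff; lra.
  - easy.
  - now exists w. }
set (W := fun i u v => F u i v).
assert (Hinit : forall i, W i u1 v1 = w0 i).
{ intros i; unfold W; rewrite (proj1 (HF u1 Hu1)); apply Hh0. }
assert (Hline : forall i u, a - r < u < a + r ->
  is_derive (fun s => W i s v1) u (act l A pU W i u v1)).
{ intros i u Hu.
  replace (act l A pU W i u v1) with (row_apply l (fun i j s => A pU i j s v1) h i u).
  - apply is_derive_ext_loc with (h i); [|now apply Hh].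
    apply (filter_imp (fun s => a - r < s < a + r)); [|now apply open_between].
    intros s Hs; unfold W; now rewrite (proj1 (HF s Hs)).
  - apply lsum_ext; intros j; unfold W; now rewrite (proj1 (HF u Hu)). }
assert (Hvert : forall i u v, square a b r (u, v) ->
  is_derive (fun t => W i u t) v (act l A pV W i u v)).
{ intros i u v Huv; apply square_iff in Huv; now apply (HF u). }
assert (Hfl : flat l A (square a b r)).
{ intros i k u v Huv; apply A_flat; now apply HsubD. }
exists W; split; [|exact Hinit].
intros u v Huv i.
assert (Bb : forall e i j s t, square a b r (s, t) -> Rabs (A e i j s t) <= M)
  by (intros; now apply HB).
assert (Bd : forall i j s t, square a b r (s, t) -> Rabs (pd pU (A pV i j) s t) <= M)
  by (intros; now apply HB).
assert (Bd2 : forall i j s t, square a b r (s, t) ->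
  Rabs (pd pU (pd pU (A pV i j)) s t) <= M) by (intros; now apply HB).
split.
- now apply (W_continuous l l_full A a b r M) with (u1 := u1) (v1 := v1) (w0 := w0).
- intros [].
  + now apply (W_horizontal l l_full A a b r M) with (u1 := u1) (v1 := v1) (w0 := w0).
  + now apply Hvert.
Qed.

(** * Towers of cells *)

(** [tower p B U]: U is a union of cells starting with one that contains p and
    ending with B, where each new cell meets the union of the earlier ones
    within the last of them.  As the intersection of two squares is connected,
    no monodromy can arise along a tower. *)
Inductive tower (p : R * R) : (R * R -> Prop) -> (R * R -> Prop) -> Prop :=
| tower_one B : cell l A D B -> B p -> tower p B B
| tower_add B C U : cell l A D B -> tower p C U ->
    (exists q, B q /\ C q) -> (forall q, B q -> U q -> C q) ->
    tower p B (fun q => B q \/ U q).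

Lemma cell_open B : cell l A D B -> open B.
Proof. intros (a & b & r & M & -> & _); apply square_open. Qed.

Lemma cell_sub B : cell l A D B -> forall p, B p -> D p.
Proof. intros (a & b & r & M & -> & _ & _ & _ & H) [s t] Hst; now apply H. Qed.

Lemma cell_connected B : cell l A D B -> is_connected_set B.
Proof. intros (a & b & r & M & -> & _); apply square_connected. Qed.

Lemma cells_meet_connected B C :
  cell l A D B -> cell l A D C -> is_connected_set (fun p => B p /\ C p).
Proof.
intros (a & b & r & M & -> & _) (a' & b' & r' & M' & -> & _).
apply squares_meet_connected.
Qed.

Lemma tower_head p B U :
  tower p B U -> cell l A D B /\ (forall q, B q -> U q).
Proof. intros []; split; auto. Qed.

Lemma tower_base p B U : tower p B U -> U p.
Proof. intros H; induction H; auto. Qed.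

Lemma tower_domain p B U :
  tower p B U -> is_domain U /\ forall q, U q -> D q.
Proof.
intros H; induction H as [B HB Hp|B C U HB HT [[UO UC] US] [q [Bq Cq]] HU].
- repeat split; [now apply cell_open|now apply cell_connected|now apply cell_sub].
- repeat split.
  + apply open_or; [now apply cell_open|easy].
  + apply union_connected with q; [now apply cell_connected|easy|easy|].
    now apply (tower_head p C U).
  + intros s [Hs|Hs]; [now apply (cell_sub B)|now apply US].
Qed.

(** Going back to the latest cell met by the new one cuts off the loops. *)
Lemma tower_extend p C U B :
  tower p C U -> cell l A D B -> (exists q, B q /\ U q) ->
  exists V, tower p B V.
Proof.
intros H HB; induction H as [C HC Hp|C C' U HC HT IH HCC' HU]; intros [q [Bq Uq]].
- exists (fun q => B q \/ C q); apply tower_add with C; auto.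
  + now apply tower_one.
  + now exists q.
- destruct (classic (exists q, B q /\ U q)) as [HBU|HBU]; [now apply IH|].
  exists (fun q => B q \/ (C q \/ U q)); apply tower_add with C; auto.
  + now apply tower_add with C'.
  + exists q; split; [easy|].
    destruct Uq as [Cq|Uq]; [easy|]; exfalso; apply HBU; now exists q.
  + intros s Bs [Cs|Us]; [easy|]; exfalso; apply HBU; now exists s.
Qed.

(** The points reached by towers form an open subset of D, and so do the others,
    since a cell around a point that is not reached meets no reached point. *)
Lemma tower_reaches p q :
  is_domain D -> D p -> D q -> exists B U, tower p B U /\ B q.
Proof.
intros [DO DC] Dp Dq.
set (R1 := fun q => exists B U, tower p B U /\ B q).
destruct (DC R1 (fun q => exists C, cell l A D C /\ C q /\ forall s, C s -> ~ R1 s))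
  as [H|H].
- intros s (B & U & HT & Bs).
  assert (BO : open B) by (apply cell_open; now apply (tower_head p B U)).
  apply (filter_imp B); [|now apply BO].
  intros t Bt; now exists B, U.
- intros s (C & HC & Cs & Hn).
  apply (filter_imp C); [|now apply (cell_open C HC)].
  intros t Ct; now exists C.
- intros [u v] Huv.
  destruct (cell_around l l_full A D u v DO A_smooth Huv) as [C [HC Cuv]].
  destruct (classic (exists s, C s /\ R1 s)) as [[s [Cs (B & U & HT & Bs)]]|Hn].
  + left; destruct (tower_extend p B U C HT HC) as [V HV].
    { exists s; split; [easy|now apply (tower_head p B U)]. }
    now exists C, V.
  + right; exists C; split; [easy|split; [easy|]].
    intros s Cs Hs; apply Hn; now exists s.
- intros s Ds Hs (C & HC & Cs & Hn); now apply (Hn s).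
- now apply H.
- destruct (H p Dp) as (C & HC & Cp & Hn); exfalso; apply (Hn p Cp).
  exists C, C; split; [now apply tower_one|easy].
Qed.

(** A solution below the top cell and one on the top cell that agree at a
    common point agree on the whole overlap, which lies in two cells. *)
Lemma solve_on_tower u0 v0 B U (w0 : I -> R) :
  tower (u0, v0) B U ->
  exists W, solves l A U W /\ forall i, W i u0 v0 = w0 i.
Proof.
intros H; induction H as [B HB Hp|B C U HB HT [W [HW W0]] [[s t] [Bq Cq]] HU].
{ now apply solve_on_cell. }
destruct (tower_head _ _ _ HT) as [HC CU].
destruct (tower_domain _ _ _ HT) as [[UO _] _].
destruct (solve_on_cell B s t (fun i => W i s t) HB Bq) as [W' [HW' E']].
assert (Hover : forall i u v, B (u, v) -> U (u, v) -> W' i u v = W i u v).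
{ intros i u v Bu Uu.
  apply (solves_unique l l_full A (fun p => B p /\ C p)) with (u0 := s) (v0 := t).
  - apply open_and; now apply cell_open.
  - now apply cells_meet_connected.
  - intros e j k; apply smooth_sub with D; [|easy].
    intros p [Bp _]; now apply (cell_sub B).
  - apply solves_sub with B; [tauto|easy].
  - apply solves_sub with U; [|easy]; intros p [_ Cp]; now apply CU.
  - easy.
  - easy.
  - split; [easy|now apply HU]. }
set (V := fun i u v =>
  if excluded_middle_informative (B (u, v)) then W' i u v else W i u v).
assert (VB : solves l A B V).
{ apply solves_ext with W'; [now apply cell_open| |easy].
  intros i u v Huv; unfold V.
  destruct excluded_middle_informative; [easy|contradiction]. }
assert (VU : solves l A U V).
{ apply solves_ext with W; [easy| |easy].
  intros i u v Huv; unfold V.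
  destruct excluded_middle_informative; [|easy].
  symmetry; now apply Hover. }
exists V; split.
- intros u v [Huv|Huv] i; [now apply VB|now apply VU].
- intros i; rewrite <- W0; unfold V.
  destruct excluded_middle_informative; [|easy].
  apply Hover; [easy|exact (tower_base _ _ _ HT)].
Qed.

(** A solution need not exist on all of D, which may have holes, but it exists
    on a subdomain joining any two given points. *)
Theorem flat_system_solvable u0 v0 q (HD : is_domain D) :
  D (u0, v0) -> D q ->
  exists U, is_domain U /\ (forall p, U p -> D p) /\ U (u0, v0) /\ U q /\
    forall w0 : I -> R,
      exists W, solves l A U W /\ forall i, W i u0 v0 = w0 i.
Proof.
intros H0 Hq.
destruct (tower_reaches (u0, v0) q HD H0 Hq) as (B & U & HT & Bq).
destruct (tower_domain _ _ _ HT) as [HU US].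
exists U; split; [easy|split; [easy|split; [exact (tower_base _ _ _ HT)|split]]].
- now apply (tower_head _ _ _ HT).
- intros w0; now apply solve_on_tower with B.
Qed.

End Existence.

(** * Vector fields in R^4_1 *)

Inductive coord : Type := c1 | c2 | c3 | c4.

Definition crd (k : coord) (w : R41) : R :=
  match k with c1 => x1 w | c2 => x2 w | c3 => x3 w | c4 => x4 w end.

Definition vec (g : coord -> R) : R41 := (g c1, g c2, g c3, g c4).

Lemma crd_vec k g : crd k (vec g) = g k.
Proof. now destruct k. Qed.

Lemma vec_ext (a b : R41) : (forall k, crd k a = crd k b) -> a = b.
Proof.
intros H; pose proof (H c1); pose proof (H c2); pose proof (H c3); pose proof (H c4).
destruct a as [[[a1 a2] a3] a4], b as [[[b1 b2] b3] b4]; cbv in *; now subst.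
Qed.

Lemma crd_plus k (a b : R41) : crd k (plus a b) = crd k a + crd k b.
Proof. now destruct k. Qed.

Lemma crd_scal k c (a : R41) : crd k (scal c a) = c * crd k a.
Proof. now destruct k. Qed.

Lemma crd_minus k (a b : R41) : crd k (minus a b) = crd k a - crd k b.
Proof. now destruct k. Qed.

Lemma crd_zero k : crd k (zero : R41) = 0.
Proof. now destruct k. Qed.

Lemma ip_crd (a b : R41) :
  ip a b = crd c1 a * crd c1 b + crd c2 a * crd c2 b + crd c3 a * crd c3 b
           - crd c4 a * crd c4 b.
Proof. easy. Qed.

Lemma ip_sym (a b : R41) : ip a b = ip b a.
Proof. rewrite !ip_crd; ring. Qed.

Lemma ip_plus_l (a b c : R41) : ip (plus a b) c = ip a c + ip b c.
Proof. rewrite !ip_crd, !crd_plus; ring. Qed.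

Lemma ip_scal_l t (a c : R41) : ip (scal t a) c = t * ip a c.
Proof. rewrite !ip_crd, !crd_scal; ring. Qed.

Lemma ip_plus_r (a b c : R41) : ip a (plus b c) = ip a b + ip a c.
Proof. rewrite !ip_crd, !crd_plus; ring. Qed.

Lemma ip_scal_r t (a c : R41) : ip a (scal t c) = t * ip a c.
Proof. rewrite !ip_crd, !crd_scal; ring. Qed.

Lemma ip_zero_l (a : R41) : ip zero a = 0.
Proof. rewrite !ip_crd, !crd_zero; ring. Qed.

Ltac vec_ring :=
  apply vec_ext; intros ?k;
  unfold lincomb; rewrite ?crd_minus, ?crd_plus, ?crd_scal, ?crd_plus, ?crd_scal,
    ?crd_zero; rewrite ?crd_minus, ?crd_plus, ?crd_scal, ?crd_zero.

Definition is_pdv (e : param) (F : R -> R -> R41) (u v : R) (d : R41) : Prop :=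
  forall k, is_pd e (fun s t => crd k (F s t)) u v (crd k d).

Lemma is_pdv_unique e F u v d : is_pdv e F u v d -> pdv e F u v = d.
Proof.
intros H; apply vec_ext; intros k.
transitivity (pd e (fun s t => crd k (F s t)) u v); [now destruct k|].
apply is_pd_unique, H.
Qed.

Lemma is_pdv_ext_on (D : R * R -> Prop) e F G u v d :
  open D -> D (u, v) -> (forall s t, D (s, t) -> F s t = G s t) ->
  is_pdv e F u v d -> is_pdv e G u v d.
Proof.
intros HD Huv H HF k; apply (is_pd_ext_on D e (fun s t => crd k (F s t))); auto.
intros s t Hst; now rewrite H.
Qed.

Lemma pdv_ext_on (D : R * R -> Prop) e F G u v :
  open D -> D (u, v) -> (forall s t, D (s, t) -> F s t = G s t) ->
  pdv e F u v = pdv e G u v.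
Proof.
intros HD Huv H.
assert (HC : forall g : R41 -> R, pd e (fun s t => g (F s t)) u v = pd e (fun s t => g (G s t)) u v).
{ intros g; apply (pd_ext_on D); auto; intros s t Hst; now rewrite H. }
unfold pdv; now rewrite !HC.
Qed.

Lemma is_pdv_scal e f F u v df dF :
  is_pd e f u v df -> is_pdv e F u v dF ->
  is_pdv e (fun s t => scal (f s t) (F s t)) u v
    (plus (scal df (F u v)) (scal (f u v) dF)).
Proof.
intros Hf HF k.
apply (is_pd_ext_loc e (fun s t => f s t * crd k (F s t))).
{ apply locally_2d_forall; intros s t; symmetry; apply crd_scal. }
rewrite crd_plus, !crd_scal; now apply is_pd_mult.
Qed.

Lemma is_pd_ip e F G u v dF dG :
  is_pdv e F u v dF -> is_pdv e G u v dG ->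
  is_pd e (fun s t => ip (F s t) (G s t)) u v (ip dF (G u v) + ip (F u v) dG).
Proof.
intros HF HG.
replace (ip dF (G u v) + ip (F u v) dG) with
  ((crd c1 dF * crd c1 (G u v) + crd c1 (F u v) * crd c1 dG) +
   (crd c2 dF * crd c2 (G u v) + crd c2 (F u v) * crd c2 dG) +
   (crd c3 dF * crd c3 (G u v) + crd c3 (F u v) * crd c3 dG) -
   (crd c4 dF * crd c4 (G u v) + crd c4 (F u v) * crd c4 dG))
  by (rewrite !ip_crd; ring).
apply (is_pd_minus e (fun s t => crd c1 (F s t) * crd c1 (G s t) +
  crd c2 (F s t) * crd c2 (G s t) + crd c3 (F s t) * crd c3 (G s t))
  (fun s t => crd c4 (F s t) * crd c4 (G s t))).
1: apply (is_pd_plus e (fun s t => crd c1 (F s t) * crd c1 (G s t) +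
  crd c2 (F s t) * crd c2 (G s t)) (fun s t => crd c3 (F s t) * crd c3 (G s t))).
1: apply (is_pd_plus e (fun s t => crd c1 (F s t) * crd c1 (G s t))
     (fun s t => crd c2 (F s t) * crd c2 (G s t))).
all: apply (is_pd_mult e (fun s t => crd _ (F s t)) (fun s t => crd _ (G s t))); auto.
Qed.

Lemma smooth_field_iff D F :
  smooth_field D F <-> forall k, smooth D (fun u v => crd k (F u v)).
Proof.
split.
- intros (H1 & H2 & H3 & H4) []; assumption.
- intros H; exact (conj (H c1) (conj (H c2) (conj (H c3) (H c4)))).
Qed.

Lemma smooth_field_is_pdv D F e u v :
  smooth_field D F -> D (u, v) -> is_pdv e F u v (pdv e F u v).
Proof.
intros H Huv k; rewrite smooth_field_iff in H.
replace (crd k (pdv e F u v)) with (pd e (fun s t => crd k (F s t)) u v)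
  by now destruct k.
now apply (smooth_is_pd D).
Qed.

Lemma smooth_field_pdv_comm D F u v :
  open D -> smooth_field D F -> D (u, v) ->
  pdv pU (pdv pV F) u v = pdv pV (pdv pU F) u v.
Proof.
intros HD H Huv; rewrite smooth_field_iff in H.
apply vec_ext; intros k.
transitivity (pd pU (pd pV (fun s t => crd k (F s t))) u v); [now destruct k|].
rewrite (smooth_pd_comm D HD _ u v (H k) Huv); now destruct k.
Qed.

(** * Pseudo-orthonormal frames *)

(** For such a frame the metric dual basis is -y, -x, n1, n2. *)
Definition expand (x y n1 n2 w : R41) : R41 :=
  lincomb (- ip w y) (- ip w x) (ip w n1) (ip w n2) x y n1 n2.

Ltac ip_simpl := rewrite ?ip_plus_l, ?ip_scal_l, ?ip_plus_r, ?ip_scal_r.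

Lemma ip_lincomb a b c d x y n1 n2 w :
  ip (lincomb a b c d x y n1 n2) w = a * ip x w + b * ip y w + c * ip n1 w + d * ip n2 w.
Proof. unfold lincomb; now rewrite !ip_plus_l, !ip_scal_l. Qed.

Section Frame.
Variables x y n1 n2 : R41.
Hypothesis P : pseudo_orthonormal x y n1 n2.

Lemma pseudo_orthonormal_gram :
  (ip x x = 0 /\ ip x y = -1 /\ ip x n1 = 0 /\ ip x n2 = 0) /\
  (ip y x = -1 /\ ip y y = 0 /\ ip y n1 = 0 /\ ip y n2 = 0) /\
  (ip n1 x = 0 /\ ip n1 y = 0 /\ ip n1 n1 = 1 /\ ip n1 n2 = 0) /\
  (ip n2 x = 0 /\ ip n2 y = 0 /\ ip n2 n1 = 0 /\ ip n2 n2 = 1).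
Proof.
destruct P; rewrite (ip_sym y x), (ip_sym n1 x), (ip_sym n1 y), (ip_sym n2 x),
  (ip_sym n2 y), (ip_sym n2 n1); intuition.
Qed.

Lemma lincomb_components a b c d :
  let w := lincomb a b c d x y n1 n2 in
  ip w x = - b /\ ip w y = - a /\ ip w n1 = c /\ ip w n2 = d.
Proof.
destruct pseudo_orthonormal_gram as
  ((G1 & G2 & G3 & G4) & (G5 & G6 & G7 & G8) & (G9 & G10 & G11 & G12) & (G13 & G14 & G15 & G16)).
simpl; rewrite !ip_lincomb, G1, G2, G3, G4, G5, G6, G7, G8, G9, G10, G11, G12,
  G13, G14, G15, G16; repeat split; ring.
Qed.

(** The inner products of w with the frame recover its coefficients, which exist
    because the frame spans. *)
Lemma pseudo_orthonormal_expand w : w = expand x y n1 n2 w.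
Proof.
destruct (po_basis _ _ _ _ P) as [_ Hs].
destruct (Hs w) as (a & b & c & d & ->).
destruct (lincomb_components a b c d) as (H1 & H2 & H3 & H4).
unfold expand; rewrite H1, H2, H3, H4, !Ropp_involutive; reflexivity.
Qed.

Lemma frame_vec_ext w w' :
  ip w x = ip w' x -> ip w y = ip w' y -> ip w n1 = ip w' n1 -> ip w n2 = ip w' n2 ->
  w = w'.
Proof.
intros H1 H2 H3 H4; rewrite (pseudo_orthonormal_expand w), (pseudo_orthonormal_expand w').
unfold expand; now rewrite H1, H2, H3, H4.
Qed.

End Frame.

Lemma pseudo_orthonormal_intro x y n1 n2 :
  ip x x = 0 -> ip y y = 0 -> ip x y = -1 -> ip n1 n1 = 1 -> ip n2 n2 = 1 ->
  ip n1 n2 = 0 -> ip x n1 = 0 -> ip x n2 = 0 -> ip y n1 = 0 -> ip y n2 = 0 ->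
  (forall w, w = expand x y n1 n2 w) -> pseudo_orthonormal x y n1 n2.
Proof.
intros Hxx Hyy Hxy H11 H22 H12 Hx1 Hx2 Hy1 Hy2 Hw; split; try easy; split.
- intros a b c d H0.
  assert (HZ : forall w, a * ip x w + b * ip y w + c * ip n1 w + d * ip n2 w = 0).
  { intros w; rewrite <- ip_lincomb, H0; apply ip_zero_l. }
  pose proof (HZ x) as Ex; pose proof (HZ y) as Ey;
  pose proof (HZ n1) as E1; pose proof (HZ n2) as E2.
  rewrite Hxx, (ip_sym y x), Hxy, (ip_sym n1 x), Hx1, (ip_sym n2 x), Hx2 in Ex.
  rewrite Hxy, Hyy, (ip_sym n1 y), Hy1, (ip_sym n2 y), Hy2 in Ey.
  rewrite Hx1, Hy1, H11, (ip_sym n2 n1), H12 in E1.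
  rewrite Hx2, Hy2, H12, H22 in E2.
  repeat split; lra.
- intros w; exists (- ip w y), (- ip w x), (ip w n1), (ip w n2); apply Hw.
Qed.

(** * Surfaces with an adapted frame *)

Section AdaptedPoint.
Variables (z : R -> R -> R41) (u v f : R) (x y n1 n2 : R41).
Hypothesis f_neq : f <> 0.
Hypothesis P : pseudo_orthonormal x y n1 n2.
Hypothesis zu : pdv pU z u v = scal f x.
Hypothesis zv : pdv pV z u v = scal f y.

Lemma adapted_first_form :
  first_form z pU pU u v = 0 /\ first_form z pV pV u v = 0 /\
  first_form z pU pV u v = - f ^ 2 /\ first_form z pV pU u v = - f ^ 2.
Proof.
unfold first_form; rewrite zu, zv; ip_simpl.
rewrite (ip_sym y x), (po_xx _ _ _ _ P), (po_yy _ _ _ _ P), (po_xy _ _ _ _ P).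
repeat split; ring.
Qed.

Lemma isotropic_g_inv (g : metric) :
  g pU pU u v = 0 -> g pV pV u v = 0 -> g pU pV u v = - f ^ 2 -> g pV pU u v = - f ^ 2 ->
  g_inv g pU pU u v = 0 /\ g_inv g pV pV u v = 0 /\
  g_inv g pU pV u v = - / f ^ 2 /\ g_inv g pV pU u v = - / f ^ 2.
Proof.
intros E1 E2 E3 E4; unfold g_inv, det_g; rewrite E1, E2, E3, E4.
repeat split; field; easy.
Qed.

Lemma adapted_g_inv :
  g_inv (first_form z) pU pU u v = 0 /\ g_inv (first_form z) pV pV u v = 0 /\
  g_inv (first_form z) pU pV u v = - / f ^ 2 /\ g_inv (first_form z) pV pU u v = - / f ^ 2.
Proof. apply isotropic_g_inv; apply adapted_first_form. Qed.

Lemma adapted_tangent_coord w :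
  tangent_coord z u v w pU = - ip w y / f /\ tangent_coord z u v w pV = - ip w x / f.
Proof.
unfold tangent_coord, sum_param.
destruct adapted_g_inv as (-> & -> & -> & ->).
rewrite zu, zv; ip_simpl; split; field; easy.
Qed.

(** The frame itself provides an orthonormal basis of the normal plane, so the
    normal part needs no reference to the metric coefficients. *)
Lemma adapted_normal_part w :
  normal_part z u v w = plus (scal (ip w n1) n1) (scal (ip w n2) n2).
Proof.
unfold normal_part, tangent_part.
destruct (adapted_tangent_coord w) as [-> ->]; rewrite zu, zv.
rewrite (pseudo_orthonormal_expand _ _ _ _ P w) at 1; unfold expand.
vec_ring; field; easy.
Qed.

Lemma adapted_flat_conn_x Y : flat_conn z x Y u v = scal (/ f) (pdv pU Y u v).
Proof.
unfold flat_conn; destruct (adapted_tangent_coord x) as [-> ->].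
rewrite (po_xx _ _ _ _ P), (po_xy _ _ _ _ P).
vec_ring; field; easy.
Qed.

Lemma adapted_flat_conn_y Y : flat_conn z y Y u v = scal (/ f) (pdv pV Y u v).
Proof.
unfold flat_conn; destruct (adapted_tangent_coord y) as [-> ->].
rewrite (po_yy _ _ _ _ P), (ip_sym y x), (po_xy _ _ _ _ P).
vec_ring; field; easy.
Qed.

Lemma adapted_flat_conn_tangent a b Y :
  flat_conn z (plus (scal a (pdv pU z u v)) (scal b (pdv pV z u v))) Y u v =
  plus (scal a (pdv pU Y u v)) (scal b (pdv pV Y u v)).
Proof.
unfold flat_conn.
destruct (adapted_tangent_coord
  (plus (scal a (pdv pU z u v)) (scal b (pdv pV z u v)))) as [-> ->].
rewrite zu, zv; ip_simpl.
rewrite (po_yy _ _ _ _ P), (po_xx _ _ _ _ P), (ip_sym y x), (po_xy _ _ _ _ P).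
vec_ring; field; easy.
Qed.

Lemma adapted_flat_conn_zu Y : flat_conn z (pdv pU z u v) Y u v = pdv pU Y u v.
Proof.
replace (pdv pU z u v) with
  (plus (scal 1 (pdv pU z u v)) (scal 0 (pdv pV z u v))) at 1 by (vec_ring; ring).
rewrite adapted_flat_conn_tangent; vec_ring; ring.
Qed.

Lemma adapted_flat_conn_zv Y : flat_conn z (pdv pV z u v) Y u v = pdv pV Y u v.
Proof.
replace (pdv pV z u v) with
  (plus (scal 0 (pdv pU z u v)) (scal 1 (pdv pV z u v))) at 1 by (vec_ring; ring).
rewrite adapted_flat_conn_tangent; vec_ring; ring.
Qed.

Lemma adapted_normal_part_eq w a b :
  normal_part z u v w = plus (scal a n1) (scal b n2) ->
  ip w n1 = a /\ ip w n2 = b.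
Proof.
rewrite adapted_normal_part; intros E.
assert (E1 := f_equal (fun w => ip w n1) E).
assert (E2 := f_equal (fun w => ip w n2) E).
simpl in E1, E2; revert E1 E2; ip_simpl.
rewrite (ip_sym n2 n1), (po_11 _ _ _ _ P), (po_22 _ _ _ _ P), (po_12 _ _ _ _ P).
intros; split; lra.
Qed.

End AdaptedPoint.

Record adapted (D : R * R -> Prop) (z : R -> R -> R41) (f : R -> R -> R)
    (x y n1 n2 : R -> R -> R41) : Prop := {
  ad_open : open D;
  ad_f : smooth D f;
  ad_z : smooth_field D z;
  ad_x : smooth_field D x;
  ad_y : smooth_field D y;
  ad_n1 : smooth_field D n1;
  ad_n2 : smooth_field D n2;
  ad_f_pos : forall u v, D (u, v) -> 0 < f u v;
  ad_po : forall u v, D (u, v) ->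
    pseudo_orthonormal (x u v) (y u v) (n1 u v) (n2 u v);
  ad_zu : forall u v, D (u, v) -> pdv pU z u v = scal (f u v) (x u v);
  ad_zv : forall u v, D (u, v) -> pdv pV z u v = scal (f u v) (y u v)
}.

Section Adapted.
Variables (D : R * R -> Prop) (z : R -> R -> R41) (f : R -> R -> R).
Variables (x y n1 n2 : R -> R -> R41).
Hypothesis H : adapted D z f x y n1 n2.

Let f_neq u v : D (u, v) -> f u v <> 0.
Proof. intros Huv; pose proof (ad_f_pos _ _ _ _ _ _ _ H u v Huv); lra. Qed.

Lemma adapted_timelike : timelike_surface D z.
Proof.
split; [apply H|split].
- intros u v Huv a b E.
  pose proof (f_neq u v Huv) as Hf.
  pose proof (ad_po _ _ _ _ _ _ _ H u v Huv) as P.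
  rewrite (ad_zu _ _ _ _ _ _ _ H u v Huv), (ad_zv _ _ _ _ _ _ _ H u v Huv) in E.
  assert (E1 := f_equal (fun w => ip w (y u v)) E).
  assert (E2 := f_equal (fun w => ip w (x u v)) E).
  simpl in E1, E2; rewrite ip_zero_l in E1, E2; revert E1 E2; ip_simpl.
  rewrite (ip_sym (y u v) (x u v)), (po_xx _ _ _ _ P), (po_yy _ _ _ _ P), (po_xy _ _ _ _ P).
  intros E1 E2; split.
  + apply Rmult_eq_reg_r with (f u v); [lra|easy].
  + apply Rmult_eq_reg_r with (f u v); [lra|easy].
- intros u v Huv.
  pose proof (f_neq u v Huv) as Hf.
  pose proof (ad_po _ _ _ _ _ _ _ H u v Huv) as P.
  pose proof (ad_zu _ _ _ _ _ _ _ H u v Huv) as Hu.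
  pose proof (ad_zv _ _ _ _ _ _ _ H u v Huv) as Hv.
  set (X := x u v) in *; set (Y := y u v) in *; set (c := f u v) in *.
  assert (Hs : / sqrt 2 * / sqrt 2 = / 2).
  { rewrite <- Rinv_mult, sqrt_sqrt; lra. }
  exists (plus (scal (/ sqrt 2) X) (scal (- / sqrt 2) Y)),
    (plus (scal (/ sqrt 2) X) (scal (/ sqrt 2) Y)).
  split; [|split; [|ip_simpl; rewrite (ip_sym Y X), (po_xx _ _ _ _ P),
    (po_yy _ _ _ _ P), (po_xy _ _ _ _ P); repeat split; lra]].
  + exists (/ sqrt 2 / c), (- / sqrt 2 / c); rewrite Hu, Hv.
    vec_ring; field; split; [apply sqrt2_neq_0|easy].
  + exists (/ sqrt 2 / c), (/ sqrt 2 / c); rewrite Hu, Hv.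
    vec_ring; field; split; [apply sqrt2_neq_0|easy].
Qed.

Lemma adapted_isotropic : isotropic_parameters D z f.
Proof.
split; [apply H|]; intros u v Huv; split; [now apply H|].
destruct (adapted_first_form z u v (f u v) (x u v) (y u v) (n1 u v) (n2 u v))
  as (E1 & E2 & E3 & _); try now apply H.
easy.
Qed.

(** In isotropic parameters the trace only involves sigma(z_u, z_v). *)
Lemma adapted_mean_curvature u v nu :
  D (u, v) ->
  ip (pdv pU y u v) (n1 u v) = - f u v * nu -> ip (pdv pU y u v) (n2 u v) = 0 ->
  ip (pdv pV x u v) (n1 u v) = - f u v * nu -> ip (pdv pV x u v) (n2 u v) = 0 ->
  mean_curvature z u v = scal nu (n1 u v).
Proof.
intros Huv Ey1 Ey2 Ex1 Ex2.
pose proof (f_neq u v Huv) as Hf.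
pose proof (ad_po _ _ _ _ _ _ _ H u v Huv) as P.
pose proof (ad_zu _ _ _ _ _ _ _ H u v Huv) as Hu.
pose proof (ad_zv _ _ _ _ _ _ _ H u v Huv) as Hv.
assert (Huv' : pdv pU (pdv pV z) u v =
  plus (scal (pd pU f u v) (y u v)) (scal (f u v) (pdv pU y u v))).
{ apply is_pdv_unique.
  apply (is_pdv_ext_on D) with (fun s t => scal (f s t) (y s t)); [apply H|easy| |].
  - intros s t Hst; symmetry; now apply (ad_zv _ _ _ _ _ _ _ H).
  - apply is_pdv_scal; [now apply (smooth_is_pd D); [apply H|]|].
    now apply (smooth_field_is_pdv D); [apply H|]. }
assert (Hvu' : pdv pV (pdv pU z) u v =
  plus (scal (pd pV f u v) (x u v)) (scal (f u v) (pdv pV x u v))).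
{ apply is_pdv_unique.
  apply (is_pdv_ext_on D) with (fun s t => scal (f s t) (x s t)); [apply H|easy| |].
  - intros s t Hst; symmetry; now apply (ad_zu _ _ _ _ _ _ _ H).
  - apply is_pdv_scal; [now apply (smooth_is_pd D); [apply H|]|].
    now apply (smooth_field_is_pdv D); [apply H|]. }
unfold mean_curvature, sigma.
destruct (adapted_g_inv z u v (f u v) _ _ _ _ Hf P Hu Hv) as (-> & -> & -> & ->).
rewrite (adapted_flat_conn_zu z u v (f u v) _ _ _ _ Hf P Hu Hv (pdv pV z)).
rewrite (adapted_flat_conn_zv z u v (f u v) _ _ _ _ Hf P Hu Hv (pdv pU z)).
rewrite !(adapted_normal_part z u v (f u v) _ _ _ _ Hf P Hu Hv).
rewrite Huv', Hvu'; ip_simpl.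
rewrite Ey1, Ey2, Ex1, Ex2, (po_x1 _ _ _ _ P), (po_x2 _ _ _ _ P),
  (po_y1 _ _ _ _ P), (po_y2 _ _ _ _ P).
vec_ring; field; easy.
Qed.

End Adapted.

(** * The frame equations *)

Inductive leg : Type := lx | ly | l1 | l2.

Definition legs : list leg := [lx; ly; l1; l2].

(** The position vector is carried along as an extra slot [None]. *)
Definition slots : list (option leg) := [None; Some lx; Some ly; Some l1; Some l2].

Lemma legs_full i : In i legs.
Proof. destruct i; simpl; tauto. Qed.

Lemma slots_full i : In i slots.
Proof. destruct i as [[]|]; simpl; tauto. Qed.

Lemma pd_scal (D : R * R -> Prop) e c g u v :
  smooth D g -> D (u, v) -> pd e (fun s t => c * g s t) u v = c * pd e g u v.
Proof.
intros Hg Huv; apply is_pd_unique.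
replace (c * pd e g u v) with (0 * g u v + c * pd e g u v) by ring.
apply (is_pd_mult e (fun _ _ => c) g); [apply is_pd_const|now apply (smooth_is_pd D)].
Qed.

Lemma pd_mult (D : R * R -> Prop) e f g u v :
  smooth D f -> smooth D g -> D (u, v) ->
  pd e (fun s t => f s t * g s t) u v = pd e f u v * g u v + f u v * pd e g u v.
Proof. intros Hf Hg Huv; apply is_pd_unique, is_pd_mult; now apply (smooth_is_pd D). Qed.

Lemma pd_const e c u v : pd e (fun _ _ => c) u v = 0.
Proof. apply is_pd_unique, is_pd_const. Qed.

Section Connection.
Variables (f L lam mu nu : R -> R -> R) (eps : R).

(** L stands for ln |mu|, so that f = exp (- L / 2) and the tangential
    coefficients f_u / f and - f_v / f are - L_u / 2 and L_v / 2. *)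
Definition connection (e : param) (i k : leg) : R -> R -> R :=
  match e, i, k with
  | pU, lx, lx => fun u v => - / 2 * pd pU L u v
  | pU, lx, l1 => fun u v => f u v * lam u v
  | pU, lx, l2 => fun u v => f u v * mu u v
  | pU, ly, ly => fun u v => / 2 * pd pU L u v
  | pU, ly, l1 => fun u v => -1 * (f u v * nu u v)
  | pU, l1, lx => fun u v => -1 * (f u v * nu u v)
  | pU, l1, ly => fun u v => f u v * lam u v
  | pU, l2, ly => fun u v => f u v * mu u v
  | pV, lx, lx => fun u v => / 2 * pd pV L u v
  | pV, lx, l1 => fun u v => -1 * (f u v * nu u v)
  | pV, ly, ly => fun u v => - / 2 * pd pV L u v
  | pV, ly, l1 => fun u v => - eps * (f u v * lam u v)
  | pV, ly, l2 => fun u v => - eps * (f u v * mu u v)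
  | pV, l1, lx => fun u v => - eps * (f u v * lam u v)
  | pV, l1, ly => fun u v => -1 * (f u v * nu u v)
  | pV, l2, lx => fun u v => - eps * (f u v * mu u v)
  | _, _, _ => fun _ _ => 0
  end.

Definition frame_coef (e : param) (i k : option leg) : R -> R -> R :=
  match i, k with
  | Some i, Some k => connection e i k
  | None, Some lx => match e with pU => f | pV => fun _ _ => 0 end
  | None, Some ly => match e with pU => fun _ _ => 0 | pV => f end
  | _, _ => fun _ _ => 0
  end.

Section Flatness.
Variable D : R * R -> Prop.
Hypothesis D_open : open D.
Hypothesis f_smooth : smooth D f.
Hypothesis L_smooth : smooth D L.
Hypothesis lam_smooth : smooth D lam.
Hypothesis mu_smooth : smooth D mu.
Hypothesis nu_smooth : smooth D nu.

Lemma connection_smooth : forall e i k, smooth D (connection e i k).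
Proof.
intros [] [] []; cbn [connection];
  repeat (apply (smooth_mult D D_open) || apply (smooth_const D D_open)
          || apply (smooth_pd D)); easy.
Qed.

Lemma frame_coef_smooth : smooth_coefs frame_coef D.
Proof.
intros e [i|] [k|]; simpl; try apply (smooth_const D D_open).
- apply connection_smooth.
- destruct e, k; try easy; apply (smooth_const D D_open).
Qed.

Hypothesis f_pd : forall e u v, D (u, v) -> pd e f u v = - / 2 * f u v * pd e L u v.
Hypothesis mu_pd : forall e u v, D (u, v) -> pd e mu u v = mu u v * pd e L u v.
Hypothesis codazzi1 : forall u v, D (u, v) ->
  pd pU nu u v + pd pV lam u v = lam u v * pd pV L u v.
Hypothesis codazzi2 : forall u v, D (u, v) ->
  pd pU lam u v - eps * pd pV nu u v = lam u v * pd pU L u v.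
Hypothesis gauss : forall u v, D (u, v) ->
  pd pV (pd pU L) u v =
  f u v ^ 2 * (- nu u v ^ 2 - eps * (lam u v ^ 2 + mu u v ^ 2)).
Hypothesis eps_cases : eps = 1 \/ eps = -1.

(** Of the entries of the curvature of omega, the tangential one is the Gauss
    equation and the ones mixing x, y with n1 are the two Codazzi equations; the
    others vanish identically or by f' = - f L' / 2 and mu' = mu L'. *)
Theorem frame_coef_flat : flat slots frame_coef D.
Proof.
intros i k u v Huv.
pose proof (smooth_pd D pU L L_smooth) as HLu.
pose proof (smooth_pd D pV L L_smooth) as HLv.
pose proof (codazzi1 u v Huv) as C1; pose proof (codazzi2 u v Huv) as C2.
pose proof (gauss u v Huv) as G.
assert (C1' : pd pU nu u v = lam u v * pd pV L u v - pd pV lam u v) by lra.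
assert (C2' : pd pU lam u v = lam u v * pd pU L u v + eps * pd pV nu u v) by lra.
assert (G' := smooth_pd_comm D D_open L u v L_smooth Huv); rewrite G in G'.
assert (Hfg : forall g, smooth D g -> smooth D (fun s t => f s t * g s t))
  by (intros; now apply smooth_mult).
destruct i as [[]|], k as [[]|]; unfold frame_coef, connection; cbn [lsum fold_right slots];
  rewrite ?pd_const;
  rewrite ?(pd_scal D _ _ (pd pU L)), ?(pd_scal D _ _ (pd pV L)) by easy;
  rewrite ?(pd_scal D _ _ (fun s t => f s t * _ s t)) by auto;
  rewrite ?(pd_mult D _ f) by easy;
  rewrite ?f_pd, ?mu_pd, ?C1', ?C2', ?G, ?G' by easy;
  destruct eps_cases as [E|E]; rewrite ?E; field.
Qed.

End Flatness.
End Connection.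

(** A function with vanishing partial derivatives solves the linear system
    with zero coefficients, as does any constant. *)
Lemma pd_zero_constant (D : R * R -> Prop) (g : R -> R -> R) u0 v0 :
  is_domain D -> D (u0, v0) ->
  (forall u v, D (u, v) ->
     continuity_2d_pt g u v /\ forall e, is_pd e g u v 0) ->
  forall u v, D (u, v) -> g u v = g u0 v0.
Proof.
intros [HD HC] H0 H u v Huv.
pose (A := fun (e : param) (i j : unit) (u v : R) => 0).
assert (HA : forall W i u v, act [tt] A i W tt u v = 0).
{ intros; unfold act, A; simpl; ring. }
apply (solves_unique [tt]) with (A := A) (D := D) (u0 := u0) (v0 := v0)
  (W := fun _ : unit => g) (W' := fun _ _ _ => g u0 v0); auto using tt.
- intros []; simpl; tauto.
- intros e i j; exact (smooth_const D HD 0).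
- intros s t Hst []; destruct (H s t Hst) as [Hc Hp]; split; [easy|].
  intros e; rewrite HA; apply Hp.
- intros s t Hst []; split; [apply continuity_2d_pt_const|].
  intros e; rewrite HA; apply is_pd_const.
Qed.

Lemma nonvanishing_sign (D : R * R -> Prop) (g : R -> R -> R) :
  is_domain D -> (forall u v, D (u, v) -> continuity_2d_pt g u v) ->
  (forall u v, D (u, v) -> g u v <> 0) ->
  exists s, (s = 1 \/ s = -1) /\ forall u v, D (u, v) -> 0 < s * g u v.
Proof.
intros [HD HC] Hc Hn.
assert (HO : forall s, open (fun p => D p /\ 0 < s * g (fst p) (snd p))).
{ intros s; apply locally_2d_open; intros u v [Huv Hp]; simpl in Hp.
  apply locally_2d_and; [now apply open_locally_2d|simpl].
  assert (Hs : continuity_2d_pt (fun u v => s * g u v) u v).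
  { apply continuity_2d_pt_mult; [apply continuity_2d_pt_const|now apply Hc]. }
  destruct (Hs (mkposreal _ Hp)) as [r Hr]; exists r; intros x y Hx Hy.
  specialize (Hr x y Hx Hy); apply Rabs_def2 in Hr; simpl in Hr; lra. }
destruct (HC _ _ (HO 1) (HO (-1))) as [H|H].
- intros [u v] Huv; simpl; specialize (Hn u v Huv).
  destruct (Rlt_dec 0 (g u v)); [left|right]; split; auto; lra.
- intros p Hp [_ H1] [_ H2]; lra.
- exists 1; split; [now left|]; intros u v Huv; now apply (H (u, v)).
- exists (-1); split; [now right|]; intros u v Huv; now apply (H (u, v)).
Qed.

(** In isotropic parameters the only Christoffel symbols are
    Gamma^u_uu = 2 f_u / f and Gamma^v_vv = 2 f_v / f. *)
Lemma isotropic_gauss_curvature (D : R * R -> Prop) (g : metric)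
    (f L : R -> R -> R) u v :
  open D -> smooth D f -> smooth D L ->
  (forall u v, D (u, v) -> 0 < f u v) ->
  (forall e u v, D (u, v) -> pd e f u v = - / 2 * f u v * pd e L u v) ->
  (forall u v, D (u, v) -> g pU pU u v = 0 /\ g pV pV u v = 0 /\
     g pU pV u v = - f u v ^ 2 /\ g pV pU u v = - f u v ^ 2) ->
  D (u, v) -> gauss_curvature g u v = - pd pV (pd pU L) u v / f u v ^ 2.
Proof.
intros HD Hf HL Hpos Hfp Hg Huv.
set (dg := fun (i j k : param) s t => match j, k with
  | pU, pV | pV, pU => f s t ^ 2 * pd i L s t | _, _ => 0 end).
assert (Hdg : forall i j k s t, D (s, t) -> pd i (g j k) s t = dg i j k s t).
{ intros i j k s t Hst.
  assert (H0 : forall h, (forall u v, D (u, v) -> h u v = 0) -> pd i h s t = 0).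
  { intros h Hh; rewrite (pd_ext_on D i h (fun _ _ => 0)); auto.
    apply pd_const. }
  assert (Hff : forall h, (forall u v, D (u, v) -> h u v = - f u v ^ 2) ->
    pd i h s t = f s t ^ 2 * pd i L s t).
  { intros h Hh.
    rewrite (pd_ext_on D i h (fun u v => -1 * (f u v * f u v))); auto.
    - rewrite (pd_scal D) by (auto; now apply smooth_mult).
      rewrite (pd_mult D), Hfp by easy; field.
    - intros p q Hpq; rewrite Hh by easy; ring. }
  destruct j, k; simpl; (apply H0 || apply Hff); intros p q Hpq; now apply Hg. }
set (Ga := fun (k i j : param) s t => match k, i, j with
  | pU, pU, pU => -1 * pd pU L s t
  | pV, pV, pV => -1 * pd pV L s t
  | _, _, _ => 0 end).
assert (HGa : forall k i j s t, D (s, t) -> christoffel g k i j s t = Ga k i j s t).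
{ intros k i j s t Hst; unfold christoffel, sum_param.
  assert (Hfn : f s t <> 0) by (specialize (Hpos s t Hst); lra).
  destruct (Hg s t Hst) as (E1 & E2 & E3 & E4).
  destruct (isotropic_g_inv s t (f s t) Hfn g E1 E2 E3 E4) as (I1 & I2 & I3 & I4).
  rewrite !Hdg by easy.
  destruct k, i, j; rewrite ?I1, ?I2, ?I3, ?I4; unfold dg, Ga; field; easy. }
assert (HdGa : forall e k i j, pd e (christoffel g k i j) u v = pd e (Ga k i j) u v).
{ intros e k i j; apply (pd_ext_on D); auto. }
assert (Hfn : f u v <> 0) by (specialize (Hpos u v Huv); lra).
destruct (Hg u v Huv) as (E1 & E2 & E3 & E4).
unfold gauss_curvature, riemann, sum_param, det_g.
rewrite !HdGa, !HGa, E1, E2, E3, E4 by easy; unfold Ga.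
rewrite !pd_const, (pd_scal D) by (auto; now apply smooth_pd).
rewrite (smooth_pd_comm D) by easy.
field; easy.
Qed.

Definition metric_coef (i k : leg) : R :=
  match i, k with
  | lx, ly | ly, lx => -1 | l1, l1 | l2, l2 => 1 | _, _ => 0
  end.

Section Frames.
Variables (f L lam mu nu : R -> R -> R) (eps : R).
Variable D : R * R -> Prop.
Hypothesis D_domain : is_domain D.
Hypothesis f_smooth : smooth D f.
Hypothesis L_smooth : smooth D L.
Hypothesis lam_smooth : smooth D lam.
Hypothesis mu_smooth : smooth D mu.
Hypothesis nu_smooth : smooth D nu.

Let D_open : open D := proj1 D_domain.
Let omega := connection f L lam mu nu eps.
Let coef := frame_coef f L lam mu nu eps.

Definition frame_equations (F : option leg -> R -> R -> R41) : Prop :=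
  forall u v, D (u, v) ->
    pdv pU (F None) u v = scal (f u v) (F (Some lx) u v) /\
    pdv pV (F None) u v = scal (f u v) (F (Some ly) u v) /\
    forall e i, pdv e (F (Some i)) u v =
      lincomb (omega e i lx u v) (omega e i ly u v)
              (omega e i l1 u v) (omega e i l2 u v)
              (F (Some lx) u v) (F (Some ly) u v)
              (F (Some l1) u v) (F (Some l2) u v).

Lemma act_frame_equations F :
  frame_equations F <->
  forall u v, D (u, v) -> forall e i k,
    crd k (pdv e (F i) u v) =
    act slots coef e (fun j s t => crd k (F j s t)) i u v.
Proof.
unfold act; split; intros H u v Huv.
- destruct (H u v Huv) as (Hu & Hv & He); intros e [i|] k.
  + rewrite He; unfold lincomb; rewrite !crd_plus, !crd_scal.
    cbn [lsum fold_right slots coef frame_coef]; unfold omega; ring.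
  + destruct e; rewrite ?Hu, ?Hv, crd_scal; cbn [lsum fold_right slots coef frame_coef]; ring.
- repeat split.
  + apply vec_ext; intros k; rewrite H, crd_scal by easy.
    cbn [lsum fold_right slots coef frame_coef]; ring.
  + apply vec_ext; intros k; rewrite H, crd_scal by easy.
    cbn [lsum fold_right slots coef frame_coef]; ring.
  + intros e i; apply vec_ext; intros k; rewrite H by easy.
    unfold lincomb; rewrite !crd_plus, !crd_scal.
    cbn [lsum fold_right slots coef frame_coef]; unfold omega; ring.
Qed.

Lemma crd_pdv k e F u v : crd k (pdv e F u v) = pd e (fun s t => crd k (F s t)) u v.
Proof. now destruct k. Qed.

Lemma frame_equations_solves F :
  (forall i, smooth_field D (F i)) -> frame_equations F ->
  forall k, solves slots coef D (fun i u v => crd k (F i u v)).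
Proof.
intros HF HE k u v Huv i.
specialize (HF i); rewrite smooth_field_iff in HF; split.
- now apply (smooth_continuous D).
- intros e; rewrite <- (proj1 (act_frame_equations F) HE u v Huv), crd_pdv.
  now apply (smooth_is_pd D).
Qed.

Lemma solves_frame_equations F :
  (forall k, solves slots coef D (fun i u v => crd k (F i u v))) ->
  (forall i, smooth_field D (F i)) /\ frame_equations F.
Proof.
intros H; split.
- intros i; rewrite smooth_field_iff; intros k.
  apply (solves_smooth slots coef D (fun i u v => crd k (F i u v)) D_open).
  + now apply frame_coef_smooth.
  + apply H.
- apply act_frame_equations; intros u v Huv e i k; rewrite crd_pdv.
  apply is_pd_unique; now apply (H k u v Huv i).
Qed.

(** Uniqueness for the linear system, one ambient coordinate at a time. *)
Lemma frame_equations_unique F F' u0 v0 :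
  (forall i, smooth_field D (F i)) -> (forall i, smooth_field D (F' i)) ->
  frame_equations F -> frame_equations F' ->
  D (u0, v0) -> (forall i, F i u0 v0 = F' i u0 v0) ->
  forall u v, D (u, v) -> forall i, F i u v = F' i u v.
Proof.
intros HF HF' HE HE' H0 E0 u v Huv i; apply vec_ext; intros k.
apply (solves_unique slots slots_full coef D (fun i u v => crd k (F i u v))
  (fun i u v => crd k (F' i u v)) u0 v0); try easy.
- apply D_domain.
- now apply frame_coef_smooth.
- now apply frame_equations_solves.
- now apply frame_equations_solves.
- intros j; now rewrite E0.
Qed.

Section Propagation.
Variable F : option leg -> R -> R -> R41.
Hypothesis F_smooth : forall i, smooth_field D (F i).
Hypothesis F_eq : frame_equations F.
Variables u0 v0 : R.
Hypothesis base : D (u0, v0).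
Hypothesis F_init : pseudo_orthonormal (F (Some lx) u0 v0) (F (Some ly) u0 v0)
  (F (Some l1) u0 v0) (F (Some l2) u0 v0).

Let leg_is_pdv e i u v : D (u, v) ->
  is_pdv e (F (Some i)) u v
    (lincomb (omega e i lx u v) (omega e i ly u v)
             (omega e i l1 u v) (omega e i l2 u v)
             (F (Some lx) u v) (F (Some ly) u v)
             (F (Some l1) u v) (F (Some l2) u v)).
Proof.
intros Huv; destruct (F_eq u v Huv) as (_ & _ & <-).
now apply (smooth_field_is_pdv D).
Qed.

Definition leg_pairs : list (leg * leg) := list_prod legs legs.

Definition delta (i k : leg) : R :=
  match i, k with lx, lx | ly, ly | l1, l1 | l2, l2 => 1 | _, _ => 0 end.

(** The system dG = omega G + G omega^T solved by the Gram matrix G of the legs. *)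
Definition gram_coef (e : param) (p q : leg * leg) (u v : R) : R :=
  omega e (fst p) (fst q) u v * delta (snd p) (snd q) +
  delta (fst p) (fst q) * omega e (snd p) (snd q) u v.

Lemma gram_coef_smooth : smooth_coefs gram_coef D.
Proof.
intros e p q; apply (smooth_plus D D_open); apply (smooth_mult D D_open);
  try apply (smooth_const D D_open); now apply connection_smooth.
Qed.

Lemma ip_continuous G G' u v :
  smooth_field D G -> smooth_field D G' -> D (u, v) ->
  continuity_2d_pt (fun s t => ip (G s t) (G' s t)) u v.
Proof.
intros HG HG' Huv; rewrite smooth_field_iff in HG, HG'.
assert (Hc : forall k, continuity_2d_pt (fun s t => crd k (G s t) * crd k (G' s t)) u v).
{ intros k; apply continuity_2d_pt_mult; now apply (smooth_continuous D). }
exact (continuity_2d_pt_minus _ _ u v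
  (continuity_2d_pt_plus _ _ u v
    (continuity_2d_pt_plus _ _ u v (Hc c1) (Hc c2)) (Hc c3)) (Hc c4)).
Qed.

(** The matrices omega take values in the Lie algebra of the isometry group,
    so the constant matrix [metric_coef] also solves the Gram system. *)
Lemma gram_constant u v i k : D (u, v) ->
  ip (F (Some i) u v) (F (Some k) u v) = metric_coef i k.
Proof.
intros Huv.
apply (solves_unique leg_pairs) with (A := gram_coef) (D := D) (u0 := u0) (v0 := v0)
  (W := fun p u v => ip (F (Some (fst p)) u v) (F (Some (snd p)) u v))
  (W' := fun p _ _ => metric_coef (fst p) (snd p)) (i := (i, k)); try easy.
- intros [i' k']; apply in_prod; apply legs_full.
- apply D_domain.
- apply gram_coef_smooth.
- intros s t Hst [a b]; simpl fst; simpl snd; split; [now apply ip_continuous|].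
  intros e.
  replace (act _ _ _ _ _ _ _) with
    (ip (lincomb (omega e a lx s t) (omega e a ly s t)
                 (omega e a l1 s t) (omega e a l2 s t)
                 (F (Some lx) s t) (F (Some ly) s t)
                 (F (Some l1) s t) (F (Some l2) s t)) (F (Some b) s t) +
     ip (F (Some a) s t)
        (lincomb (omega e b lx s t) (omega e b ly s t)
                 (omega e b l1 s t) (omega e b l2 s t)
                 (F (Some lx) s t) (F (Some ly) s t)
                 (F (Some l1) s t) (F (Some l2) s t))).
  + now apply is_pd_ip; apply leg_is_pdv.
  + rewrite (ip_sym (F (Some a) s t) (lincomb _ _ _ _ _ _ _ _)), !ip_lincomb.
    rewrite !(ip_sym _ (F (Some a) s t)).
    destruct a, b; unfold act, gram_coef;
      cbn [lsum fold_right leg_pairs legs list_prod map app fst snd delta]; ring.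
- intros s t Hst [a b]; split; [apply continuity_2d_pt_const|]; intros e.
  replace (act _ _ _ _ _ _ _) with 0; [apply is_pd_const|].
  destruct e, a, b; unfold act, gram_coef, omega;
    cbn [lsum fold_right leg_pairs legs list_prod map app fst snd delta connection
         metric_coef]; ring.
- destruct (pseudo_orthonormal_gram _ _ _ _ F_init) as
    ((G1 & G2 & G3 & G4) & (G5 & G6 & G7 & G8) & (G9 & G10 & G11 & G12) &
     (G13 & G14 & G15 & G16)).
  intros [[] []]; simpl; easy.
Qed.

(** The expansion of a fixed vector in the moving frame does not move, again by
    skew-symmetry of omega; hence the legs still span. *)
Lemma expand_constant u v w : D (u, v) ->
  w = expand (F (Some lx) u v) (F (Some ly) u v) (F (Some l1) u v) (F (Some l2) u v) w.
Proof.
intros Huv; apply vec_ext; intros k.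
set (leg_k := fun i s t => crd k (F (Some i) s t)).
set (ip_w := fun i s t => ip (F (Some i) s t) w).
set (g := fun s t =>
  -1 * (ip_w ly s t * leg_k lx s t) + -1 * (ip_w lx s t * leg_k ly s t) +
  ip_w l1 s t * leg_k l1 s t + ip_w l2 s t * leg_k l2 s t).
assert (Hg : forall s t, g s t = crd k (expand (F (Some lx) s t) (F (Some ly) s t)
  (F (Some l1) s t) (F (Some l2) s t) w)).
{ intros s t; unfold expand, lincomb, g, ip_w, leg_k.
  rewrite !crd_plus, !crd_scal, !(ip_sym w); ring. }
rewrite <- Hg, (pd_zero_constant D g u0 v0 D_domain base); [|clear u v Huv|easy].
- now rewrite Hg, <- (pseudo_orthonormal_expand _ _ _ _ F_init w).
- intros u v Huv.
  assert (Hw : smooth_field D (fun _ _ => w)).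
  { apply smooth_field_iff; intros j; apply (smooth_const D D_open). }
  assert (Hlc : forall i, continuity_2d_pt (leg_k i) u v).
  { intros i; apply (smooth_continuous D); [|easy].
    exact (proj1 (smooth_field_iff D _) (F_smooth (Some i)) k). }
  assert (Hic : forall i, continuity_2d_pt (ip_w i) u v).
  { intros i; now apply (ip_continuous (F (Some i)) (fun _ _ => w)). }
  split.
  { repeat apply continuity_2d_pt_plus; repeat apply continuity_2d_pt_mult;
      auto using continuity_2d_pt_const. }
  intros e.
  set (S := fun (h : leg -> R) i => omega e i lx u v * h lx + omega e i ly u v * h ly +
    omega e i l1 u v * h l1 + omega e i l2 u v * h l2).
  assert (Hld : forall i, is_pd e (leg_k i) u v (S (fun j => leg_k j u v) i)).
  { intros i; pose proof (leg_is_pdv e i u v Huv k) as H.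
    unfold lincomb in H; rewrite !crd_plus, !crd_scal in H; exact H. }
  assert (Hid : forall i, is_pd e (ip_w i) u v (S (fun j => ip_w j u v) i)).
  { intros i.
    assert (Hc : is_pdv e (fun _ _ => w) u v zero).
    { intros j; rewrite crd_zero; apply is_pd_const. }
    pose proof (is_pd_ip e _ _ u v _ _ (leg_is_pdv e i u v Huv) Hc) as H.
    rewrite ip_lincomb, (ip_sym _ zero), ip_zero_l, Rplus_0_r in H; exact H. }
  assert (Hprod : forall i j, is_pd e (fun s t => ip_w i s t * leg_k j s t) u v
    (S (fun j => ip_w j u v) i * leg_k j u v + ip_w i u v * S (fun j => leg_k j u v) j)).
  { intros i j; now apply is_pd_mult. }
  assert (Hneg : forall i j, is_pd e (fun s t => -1 * (ip_w i s t * leg_k j s t)) u v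
    (0 * (ip_w i u v * leg_k j u v) + -1 *
     (S (fun j => ip_w j u v) i * leg_k j u v + ip_w i u v * S (fun j => leg_k j u v) j))).
  { intros i j; apply (is_pd_mult e (fun _ _ => -1) (fun s t => ip_w i s t * leg_k j s t));
      [apply is_pd_const|apply Hprod]. }
  pose proof (is_pd_plus e _ _ u v _ _ (is_pd_plus e _ _ u v _ _
    (is_pd_plus e _ _ u v _ _ (Hneg ly lx) (Hneg lx ly)) (Hprod l1 l1)) (Hprod l2 l2)) as H.
  replace 0 with
   (0 * (ip_w ly u v * leg_k lx u v) + -1 *
    (S (fun j => ip_w j u v) ly * leg_k lx u v + ip_w ly u v * S (fun j => leg_k j u v) lx) +
    (0 * (ip_w lx u v * leg_k ly u v) + -1 *
     (S (fun j => ip_w j u v) lx * leg_k ly u v + ip_w lx u v * S (fun j => leg_k j u v) ly)) +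
    (S (fun j => ip_w j u v) l1 * leg_k l1 u v + ip_w l1 u v * S (fun j => leg_k j u v) l1) +
    (S (fun j => ip_w j u v) l2 * leg_k l2 u v + ip_w l2 u v * S (fun j => leg_k j u v) l2));
    [exact H|].
  unfold S, omega; destruct e; cbn [connection]; ring.
Qed.

Lemma frame_pseudo_orthonormal u v : D (u, v) ->
  pseudo_orthonormal (F (Some lx) u v) (F (Some ly) u v)
    (F (Some l1) u v) (F (Some l2) u v).
Proof.
intros Huv; apply pseudo_orthonormal_intro;
  try (rewrite gram_constant; easy).
intros w; now apply expand_constant.
Qed.

End Propagation.
End Frames.

(** * Surfaces whose frame satisfies the frame equations *)

Definition bundle (z x y n1 n2 : R -> R -> R41) (i : option leg) : R -> R -> R41 :=
  match i with
  | None => z | Some lx => x | Some ly => y | Some l1 => n1 | Some l2 => n2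
  end.

Section Surface.
Variables (f L lam mu nu : R -> R -> R) (eps : R).
Variable D : R * R -> Prop.
Hypothesis D_domain : is_domain D.
Hypothesis L_smooth : smooth D L.
Hypothesis nu_smooth : smooth D nu.
Hypothesis eps_cases : eps = 1 \/ eps = -1.
Hypothesis f_pd : forall e u v, D (u, v) -> pd e f u v = - / 2 * f u v * pd e L u v.
Hypothesis gauss : forall u v, D (u, v) ->
  pd pV (pd pU L) u v =
  f u v ^ 2 * (- nu u v ^ 2 - eps * (lam u v ^ 2 + mu u v ^ 2)).
Hypothesis mu_neq : forall u v, D (u, v) -> mu u v <> 0.
Hypothesis nu_neq : forall u v, D (u, v) -> nu u v <> 0.

Let D_open : open D := proj1 D_domain.

Variables z x y n1 n2 : R -> R -> R41.
Hypothesis A : adapted D z f x y n1 n2.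

Let f_neq u v : D (u, v) -> f u v <> 0.
Proof. intros Huv; pose proof (ad_f_pos _ _ _ _ _ _ _ A u v Huv); lra. Qed.
Let po := ad_po _ _ _ _ _ _ _ A.
Let zu := ad_zu _ _ _ _ _ _ _ A.
Let zv := ad_zv _ _ _ _ _ _ _ A.

Section FromEquations.
Hypothesis E : frame_equations f L lam mu nu eps D (bundle z x y n1 n2).

Let leg_normal e i u v : D (u, v) ->
  ip (pdv e (bundle z x y n1 n2 (Some i)) u v) (n1 u v) =
    connection f L lam mu nu eps e i l1 u v /\
  ip (pdv e (bundle z x y n1 n2 (Some i)) u v) (n2 u v) =
    connection f L lam mu nu eps e i l2 u v.
Proof.
intros Huv; destruct (E u v Huv) as (_ & _ & ->).
destruct (lincomb_components _ _ _ _ (po u v Huv)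
  (connection f L lam mu nu eps e i lx u v) (connection f L lam mu nu eps e i ly u v)
  (connection f L lam mu nu eps e i l1 u v) (connection f L lam mu nu eps e i l2 u v))
  as (_ & _ & H1 & H2).
now split.
Qed.

Lemma surface_mean_curvature u v : D (u, v) ->
  mean_curvature z u v = scal (nu u v) (n1 u v).
Proof.
intros Huv.
destruct (leg_normal pU ly u v Huv) as [H1 H2].
destruct (leg_normal pV lx u v Huv) as [H3 H4].
apply (adapted_mean_curvature D z f x y n1 n2 A); try easy.
- etransitivity; [exact H1|cbn [connection]; ring].
- etransitivity; [exact H3|cbn [connection]; ring].
Qed.

Lemma surface_sigma u v : D (u, v) ->
  let w := plus (scal (lam u v) (n1 u v)) (scal (mu u v) (n2 u v)) in
  sigma z (x u v) x u v = w /\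
  sigma z (x u v) y u v = scal (- nu u v) (n1 u v) /\
  sigma z (y u v) y u v = scal (- eps) w.
Proof.
intros Huv; unfold sigma.
pose proof (f_neq u v Huv) as Hf.
rewrite !(adapted_flat_conn_x z u v (f u v) _ _ _ _ Hf (po u v Huv) (zu u v Huv) (zv u v Huv)).
rewrite !(adapted_flat_conn_y z u v (f u v) _ _ _ _ Hf (po u v Huv) (zu u v Huv) (zv u v Huv)).
rewrite !(adapted_normal_part z u v (f u v) _ _ _ _ Hf (po u v Huv) (zu u v Huv) (zv u v Huv)).
rewrite !ip_scal_l.
destruct (leg_normal pU lx u v Huv) as [H1 H2].
destruct (leg_normal pU ly u v Huv) as [H3 H4].
destruct (leg_normal pV ly u v Huv) as [H5 H6].
cbn [bundle connection] in *; rewrite H1, H2, H3, H4, H5, H6.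
repeat split; vec_ring; field; easy.
Qed.

(** The Gauss equation for L turns K = - L_uv / f^2 into
    nu^2 + eps (lam^2 + mu^2), and H^2 = nu^2. *)
Lemma surface_K_minus_H2 u v : D (u, v) ->
  K_minus_H2 z u v = eps * (lam u v ^ 2 + mu u v ^ 2).
Proof.
intros Huv; unfold K_minus_H2.
rewrite surface_mean_curvature by easy; rewrite ip_scal_l, ip_scal_r.
rewrite (po_11 _ _ _ _ (po u v Huv)).
rewrite (isotropic_gauss_curvature D (first_form z) f L); try easy.
- rewrite gauss by easy; field; now apply f_neq.
- apply A.
- apply A.
- intros s t Hst.
  now apply (adapted_first_form z s t (f s t) _ _ _ _ (po s t Hst) (zu s t Hst) (zv s t Hst)).
Qed.

Lemma surface_K_minus_H2_sign u v : D (u, v) ->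
  (eps = 1 -> 0 < K_minus_H2 z u v) /\ (eps = -1 -> K_minus_H2 z u v < 0).
Proof.
intros Huv; rewrite surface_K_minus_H2 by easy.
assert (Hp : 0 < lam u v ^ 2 + mu u v ^ 2).
{ pose proof (pow2_ge_0 (lam u v)).
  pose proof (Rsqr_pos_lt _ (mu_neq u v Huv)) as Hm; unfold Rsqr in Hm; lra. }
split; intros He; rewrite He; lra.
Qed.

Lemma surface_sign u v : D (u, v) -> sign (K_minus_H2 z u v) = eps.
Proof.
intros Huv; destruct (surface_K_minus_H2_sign u v Huv) as [H1 H2].
destruct eps_cases as [->| ->].
- now apply sign_eq_1, H1.
- now apply sign_eq_m1, H2.
Qed.

Lemma surface_geometric_frame : geometric_frame_field D z f x y n1 n2.
Proof.
do 4 (split; [apply A|]); intros u v Huv.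
assert (Hf := f_neq u v Huv).
split; [now apply A|split; [|split]].
- rewrite zu by easy; vec_ring; field; easy.
- rewrite zv by easy; vec_ring; field; easy.
- exists (nu u v); now apply surface_mean_curvature.
Qed.

Lemma surface_geometric_functions :
  (forall u v, D (u, v) -> f u v = 1 / sqrt (Rabs (mu u v))) ->
  geometric_functions D z f x y n1 n2 lam mu nu.
Proof.
intros Hf u v Huv; rewrite surface_sign by easy.
destruct (surface_sigma u v Huv) as (H1 & H2 & H3).
split; [now apply mu_neq|auto].
Qed.

Lemma normal_conn_tangent xi a b u v : D (u, v) ->
  normal_conn z (plus (scal a (pdv pU z u v)) (scal b (pdv pV z u v))) xi u v =
  plus (scal (a * ip (pdv pU xi u v) (n1 u v) + b * ip (pdv pV xi u v) (n1 u v)) (n1 u v))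
       (scal (a * ip (pdv pU xi u v) (n2 u v) + b * ip (pdv pV xi u v) (n2 u v)) (n2 u v)).
Proof.
intros Huv; unfold normal_conn; pose proof (f_neq u v Huv) as Hf.
rewrite (adapted_flat_conn_tangent z u v (f u v) _ _ _ _ Hf (po u v Huv) (zu u v Huv) (zv u v Huv)).
rewrite (adapted_normal_part z u v (f u v) _ _ _ _ Hf (po u v Huv) (zu u v Huv) (zv u v Huv)).
now rewrite !ip_plus_l, !ip_scal_l.
Qed.

Lemma pdv_scal_const s xi e u v : smooth_field D xi -> D (u, v) ->
  pdv e (fun p q => scal s (xi p q)) u v = scal s (pdv e xi u v).
Proof.
intros Hxi Huv; apply is_pdv_unique.
replace (scal s (pdv e xi u v))
  with (plus (scal 0 (xi u v)) (scal s (pdv e xi u v))) by (vec_ring; ring).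
apply (is_pdv_scal e (fun _ _ => s)); [apply is_pd_const|].
now apply (smooth_field_is_pdv D).
Qed.

(** The connection matrices have no n1-n2 entry, so n1 is parallel, and
    H = nu n1 is parallel only where nu is locally constant. *)
Lemma surface_parallel_normalized :
  (~ exists c, forall u v, D (u, v) -> nu u v = c) ->
  (exists u0 v0, D (u0, v0)) ->
  parallel_normalized_mean_curvature D z.
Proof.
intros Hnc [u0 [v0 H0]].
assert (Hn1 : forall e u v, D (u, v) ->
  ip (pdv e n1 u v) (n1 u v) = 0 /\ ip (pdv e n1 u v) (n2 u v) = 0).
{ intros e u v Huv; destruct (leg_normal e l1 u v Huv) as [H1 H2]; split.
  - etransitivity; [exact H1|now destruct e].
  - etransitivity; [exact H2|now destruct e]. }
split; [|split].
- intros u v Huv HZ; rewrite surface_mean_curvature in HZ by easy.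
  apply (nu_neq u v Huv).
  assert (E1 := f_equal (fun w => ip w (n1 u v)) HZ); simpl in E1.
  rewrite ip_scal_l, ip_zero_l, (po_11 _ _ _ _ (po u v Huv)) in E1; lra.
- intros HP; apply Hnc; exists (nu u0 v0).
  apply (pd_zero_constant D nu u0 v0 D_domain H0).
  intros u v Huv; split; [now apply (smooth_continuous D)|].
  intros e.
  assert (Hz : normal_conn z (pdv e z u v) (mean_curvature z) u v = zero).
  { apply HP; [easy|destruct e].
    - exists 1, 0; vec_ring; ring.
    - exists 0, 1; vec_ring; ring. }
  assert (Hd : pdv e (mean_curvature z) u v =
    plus (scal (pd e nu u v) (n1 u v)) (scal (nu u v) (pdv e n1 u v))).
  { apply is_pdv_unique.
    apply (is_pdv_ext_on D) with (fun s t => scal (nu s t) (n1 s t)); auto.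
    - intros s t Hst; symmetry; now apply surface_mean_curvature.
    - apply is_pdv_scal; [now apply (smooth_is_pd D)|].
      apply (smooth_field_is_pdv D); [apply A|easy]. }
  assert (Hz0 : ip (pdv e (mean_curvature z) u v) (n1 u v) = 0).
  { replace (pdv e z u v) with
      (plus (scal (match e with pU => 1 | pV => 0 end) (pdv pU z u v))
            (scal (match e with pU => 0 | pV => 1 end) (pdv pV z u v)))
      in Hz by (destruct e; vec_ring; ring).
    rewrite normal_conn_tangent in Hz by easy.
    assert (E1 := f_equal (fun w => ip w (n1 u v)) Hz); simpl in E1.
    rewrite ip_plus_l, !ip_scal_l, ip_zero_l, (ip_sym (n2 u v)),
      (po_11 _ _ _ _ (po u v Huv)), (po_12 _ _ _ _ (po u v Huv)) in E1.
    destruct e; lra. }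
  rewrite Hd, ip_plus_l, !ip_scal_l, (po_11 _ _ _ _ (po u v Huv)),
    (proj1 (Hn1 e u v Huv)) in Hz0.
  replace 0 with (pd e nu u v) by lra; now apply (smooth_is_pd D).
- destruct (nonvanishing_sign D nu D_domain) as [s [Hs Hsp]]; try easy.
  { intros u v Huv; now apply (smooth_continuous D). }
  assert (Hss : s * s = 1) by (destruct Hs as [-> | ->]; ring).
  assert (Hsm : smooth_field D n1) by apply A.
  exists (fun u v => scal s (n1 u v)); split; [|split].
  + apply smooth_field_iff; intros k.
    apply (smooth_ext D D_open (fun u v => s * crd k (n1 u v))).
    * intros u v _; symmetry; apply crd_scal.
    * apply (smooth_mult D D_open); [apply (smooth_const D D_open)|].
      now apply smooth_field_iff.
  + intros u v Huv; split; [|split].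
    * intros X (a & b & ->); rewrite zu, zv by easy; ip_simpl.
      rewrite (ip_sym (n1 u v) (x u v)), (ip_sym (n1 u v) (y u v)),
        (po_x1 _ _ _ _ (po u v Huv)), (po_y1 _ _ _ _ (po u v Huv)); ring.
    * ip_simpl; rewrite (po_11 _ _ _ _ (po u v Huv)); lra.
    * exists (s * nu u v); split; [now apply Hsp|].
      rewrite surface_mean_curvature by easy; vec_ring.
      transitivity (s * s * (nu u v * crd k (n1 u v))); [rewrite Hss; ring|ring].
  + intros u v Huv X (a & b & ->).
    rewrite normal_conn_tangent by easy.
    rewrite !pdv_scal_const, !ip_scal_l by easy.
    rewrite !(proj1 (Hn1 _ u v Huv)), !(proj2 (Hn1 _ u v Huv)).
    vec_ring; ring.
Qed.

End FromEquations.

Section ToEquations.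
Hypothesis sigma_xx : forall u v, D (u, v) -> sigma z (x u v) x u v =
  plus (scal (lam u v) (n1 u v)) (scal (mu u v) (n2 u v)).
Hypothesis sigma_xy : forall u v, D (u, v) ->
  sigma z (x u v) y u v = scal (- nu u v) (n1 u v).
Hypothesis sigma_yy : forall u v, D (u, v) -> sigma z (y u v) y u v =
  scal (- eps) (plus (scal (lam u v) (n1 u v)) (scal (mu u v) (n2 u v))).

Lemma ip_constant_pdv G G' c e u v :
  smooth_field D G -> smooth_field D G' -> D (u, v) ->
  (forall s t, D (s, t) -> ip (G s t) (G' s t) = c) ->
  ip (pdv e G u v) (G' u v) = - ip (pdv e G' u v) (G u v).
Proof.
intros HG HG' Huv Hc.
pose proof (is_pd_ip e G G' u v _ _ (smooth_field_is_pdv D G e u v HG Huv)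
  (smooth_field_is_pdv D G' e u v HG' Huv)) as H1.
apply is_pd_unique in H1.
rewrite (pd_ext_on D e _ (fun _ _ => c)), pd_const in H1; try easy.
rewrite (ip_sym (pdv e G' u v)); lra.
Qed.

(** The normal components come from sigma; the remaining freedom is fixed by
    z_uv = z_vu and by the constancy of the inner products of the frame. *)
Lemma tangent_derivatives u v : D (u, v) ->
  (ip (pdv pU x u v) (n1 u v) = f u v * lam u v /\
   ip (pdv pU x u v) (n2 u v) = f u v * mu u v) /\
  (ip (pdv pU y u v) (n1 u v) = - (f u v * nu u v) /\
   ip (pdv pU y u v) (n2 u v) = 0) /\
  (ip (pdv pV x u v) (n1 u v) = - (f u v * nu u v) /\
   ip (pdv pV x u v) (n2 u v) = 0) /\
  (ip (pdv pV y u v) (n1 u v) = - eps * (f u v * lam u v) /\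
   ip (pdv pV y u v) (n2 u v) = - eps * (f u v * mu u v)) /\
  ip (pdv pU y u v) (x u v) = - / 2 * pd pU L u v /\
  ip (pdv pV x u v) (y u v) = - / 2 * pd pV L u v.
Proof.
intros Huv; pose proof (f_neq u v Huv) as Hf; pose proof (po u v Huv) as P.
pose proof (sigma_xx u v Huv) as Sxx; pose proof (sigma_xy u v Huv) as Sxy.
pose proof (sigma_yy u v Huv) as Syy; unfold sigma in Sxx, Sxy, Syy.
rewrite (adapted_flat_conn_x z u v (f u v) _ _ _ _ Hf P (zu u v Huv) (zv u v Huv)) in Sxx, Sxy.
rewrite (adapted_flat_conn_y z u v (f u v) _ _ _ _ Hf P (zu u v Huv) (zv u v Huv)) in Syy.
replace (scal (- nu u v) (n1 u v)) with
  (plus (scal (- nu u v) (n1 u v)) (scal 0 (n2 u v))) in Sxy by (vec_ring; ring).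
replace (scal (- eps) (plus (scal (lam u v) (n1 u v)) (scal (mu u v) (n2 u v)))) with
  (plus (scal (- eps * lam u v) (n1 u v)) (scal (- eps * mu u v) (n2 u v)))
  in Syy by (vec_ring; ring).
apply (adapted_normal_part_eq z u v (f u v) _ _ _ _ Hf P (zu u v Huv) (zv u v Huv))
  in Sxx, Sxy, Syy.
rewrite !ip_scal_l in Sxx, Sxy, Syy.
assert (Hdiv : forall a b, / f u v * a = b -> a = f u v * b).
{ intros a b <-; field; easy. }
destruct Sxx as [Sxx1 Sxx2], Sxy as [Sxy1 Sxy2], Syy as [Syy1 Syy2].
apply Hdiv in Sxx1, Sxx2, Sxy1, Sxy2, Syy1, Syy2.
assert (Hmix : plus (scal (pd pU f u v) (y u v)) (scal (f u v) (pdv pU y u v)) =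
               plus (scal (pd pV f u v) (x u v)) (scal (f u v) (pdv pV x u v))).
{ transitivity (pdv pU (pdv pV z) u v); [symmetry|
    transitivity (pdv pV (pdv pU z) u v); [now apply (smooth_field_pdv_comm D); [|apply A|]|]].
  - rewrite (pdv_ext_on D pU (pdv pV z) (fun s t => scal (f s t) (y s t))) by auto.
    apply is_pdv_unique, is_pdv_scal.
    + apply (smooth_is_pd D); [apply A|easy].
    + apply (smooth_field_is_pdv D); [apply A|easy].
  - rewrite (pdv_ext_on D pV (pdv pU z) (fun s t => scal (f s t) (x s t))) by auto.
    apply is_pdv_unique, is_pdv_scal.
    + apply (smooth_is_pd D); [apply A|easy].
    + apply (smooth_field_is_pdv D); [apply A|easy]. }
assert (Hmix' : forall w, pd pU f u v * ip (y u v) w + f u v * ip (pdv pU y u v) w =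
                          pd pV f u v * ip (x u v) w + f u v * ip (pdv pV x u v) w).
{ intros w; assert (Ew := f_equal (fun V => ip V w) Hmix); simpl in Ew.
  rewrite !ip_plus_l, !ip_scal_l in Ew; exact Ew. }
destruct (pseudo_orthonormal_gram _ _ _ _ P) as
  ((Gxx & Gxy & Gx1 & Gx2) & (Gyx & Gyy & Gy1 & Gy2) & _).
pose proof (Hmix' (x u v)) as Mx; pose proof (Hmix' (y u v)) as My.
pose proof (Hmix' (n1 u v)) as M1; pose proof (Hmix' (n2 u v)) as M2.
rewrite Gxx, Gyx, !f_pd in Mx by easy; rewrite Gxy, Gyy, !f_pd in My by easy.
rewrite Gx1, Gy1, Sxy1 in M1; rewrite Gx2, Gy2, Sxy2 in M2.
pose proof (ip_constant_pdv x x 0 pV u v (ad_x _ _ _ _ _ _ _ A) (ad_x _ _ _ _ _ _ _ A)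
  Huv (fun s t Hst => po_xx _ _ _ _ (po s t Hst))) as Nx.
pose proof (ip_constant_pdv y y 0 pU u v (ad_y _ _ _ _ _ _ _ A) (ad_y _ _ _ _ _ _ _ A)
  Huv (fun s t Hst => po_yy _ _ _ _ (po s t Hst))) as Ny.
assert (Nx0 : ip (pdv pV x u v) (x u v) = 0) by lra.
assert (Ny0 : ip (pdv pU y u v) (y u v) = 0) by lra.
rewrite Nx0 in Mx; rewrite Ny0 in My.
repeat split; try lra; apply Rmult_eq_reg_l with (f u v); lra.
Qed.

Hypothesis n1_parallel : forall e u v, D (u, v) -> ip (pdv e n1 u v) (n2 u v) = 0.

(** The skew-symmetry relations between the derivatives of the frame vectors give
    the derivatives of n1 and n2 from those of x and y, except for the n1-n2
    component, which is the hypothesis that n1 is parallel. *)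
Lemma adapted_frame_equations :
  frame_equations f L lam mu nu eps D (bundle z x y n1 n2).
Proof.
intros u v Huv; split; [now apply zu|split; [now apply zv|]].
pose proof (po u v Huv) as P.
destruct (tangent_derivatives u v Huv) as
  ((X1 & X2) & (Y1 & Y2) & (X1' & X2') & (Y1' & Y2') & Yx & Xy).
assert (Sm : forall i, smooth_field D (bundle z x y n1 n2 (Some i))).
{ intros []; apply A. }
assert (Sw : forall e i k,
  ip (pdv e (bundle z x y n1 n2 (Some i)) u v) (bundle z x y n1 n2 (Some k) u v) =
  - ip (pdv e (bundle z x y n1 n2 (Some k)) u v) (bundle z x y n1 n2 (Some i) u v)).
{ intros e i k; apply (ip_constant_pdv _ _ (metric_coef i k)); auto.
  intros s t Hst; destruct (pseudo_orthonormal_gram _ _ _ _ (po s t Hst)) as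
    ((G1 & G2 & G3 & G4) & (G5 & G6 & G7 & G8) & (G9 & G10 & G11 & G12) &
     (G13 & G14 & G15 & G16)).
  destruct i, k; assumption. }
intros e i.
apply (frame_vec_ext _ _ _ _ P);
  destruct (lincomb_components _ _ _ _ P
    (connection f L lam mu nu eps e i lx u v) (connection f L lam mu nu eps e i ly u v)
    (connection f L lam mu nu eps e i l1 u v) (connection f L lam mu nu eps e i l2 u v))
    as (C1 & C2 & C3 & C4); cbn [bundle];
  [rewrite C1|rewrite C2|rewrite C3|rewrite C4]; clear C1 C2 C3 C4.
all: pose proof (Sw e lx lx) as S1; pose proof (Sw e ly ly) as S2;
  pose proof (Sw e l1 l1) as S3; pose proof (Sw e l2 l2) as S4;
  pose proof (Sw e lx ly) as S5; pose proof (Sw e lx l1) as S6;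
  pose proof (Sw e lx l2) as S7; pose proof (Sw e ly l1) as S8;
  pose proof (Sw e ly l2) as S9; pose proof (Sw e l1 l2) as S10;
  pose proof (n1_parallel e u v Huv) as N; cbn [bundle] in *;
  destruct e, i; cbn [connection bundle]; lra.
Qed.

End ToEquations.

(** A unit field xi with H = c xi and c > 0 is n1 up to a sign, which is constant
    on a domain, so that n1 is parallel as well. *)
Lemma normalized_parallel_n1 :
  (forall u v, D (u, v) -> mean_curvature z u v = scal (nu u v) (n1 u v)) ->
  parallel_normalized_mean_curvature D z ->
  forall e u v, D (u, v) -> ip (pdv e n1 u v) (n2 u v) = 0.
Proof.
intros HH (_ & _ & xi & Sxi & Hxi & Pxi) e u v Huv.
destruct (nonvanishing_sign D nu D_domain) as [s [Hs Hsp]]; try easy.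
{ intros s t Hst; now apply (smooth_continuous D). }
assert (Hss : s * s = 1) by (destruct Hs as [-> | ->]; ring).
assert (Hn1 : forall p q, D (p, q) -> scal s (xi p q) = n1 p q).
{ intros p q Hpq; destruct (Hxi p q Hpq) as (_ & H1 & c & Hc & Hcx).
  rewrite HH in Hcx by easy.
  assert (Hsq : nu p q * nu p q = c * c).
  { assert (E1 := f_equal (fun w => ip w w) Hcx); simpl in E1; revert E1; ip_simpl.
    rewrite H1, (po_11 _ _ _ _ (po p q Hpq)); lra. }
  assert (Hcs : c = s * nu p q).
  { specialize (Hsp p q Hpq).
    assert (Hz : (c - s * nu p q) * (c + s * nu p q) = 0).
    { transitivity (c * c - s * s * (nu p q * nu p q)); [ring|rewrite Hss; lra]. }
    apply Rmult_integral in Hz; lra. }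
  apply vec_ext; intros k.
  assert (Ek := f_equal (crd k) Hcx); rewrite !crd_scal, Hcs in Ek.
  rewrite crd_scal; apply Rmult_eq_reg_l with (nu p q); [lra|now apply nu_neq]. }
rewrite <- (pdv_ext_on D e _ _ u v D_open Huv Hn1), pdv_scal_const, ip_scal_l by easy.
assert (Hz : normal_conn z (pdv e z u v) xi u v = zero).
{ apply Pxi; [easy|destruct e].
  - exists 1, 0; vec_ring; ring.
  - exists 0, 1; vec_ring; ring. }
replace (pdv e z u v) with
  (plus (scal (match e with pU => 1 | pV => 0 end) (pdv pU z u v))
        (scal (match e with pU => 0 | pV => 1 end) (pdv pV z u v)))
  in Hz by (destruct e; vec_ring; ring).
rewrite normal_conn_tangent in Hz by easy.
assert (E1 := f_equal (fun w => ip w (n2 u v)) Hz); simpl in E1.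
rewrite ip_plus_l, !ip_scal_l, ip_zero_l,
  (po_22 _ _ _ _ (po u v Huv)), (po_12 _ _ _ _ (po u v Huv)) in E1.
destruct e; [assert (Hq : ip (pdv pU xi u v) (n2 u v) = 0) by lra
            |assert (Hq : ip (pdv pV xi u v) (n2 u v) = 0) by lra];
  rewrite Hq; ring.
Qed.

End Surface.

(** * The metric function *)

Lemma is_derive_ln_Rabs m : m <> 0 -> is_derive (fun t => ln (Rabs t)) m (/ m).
Proof.
intros Hm.
replace (/ m) with (sign m * 1 * / Rabs m).
- apply (is_derive_comp ln Rabs m).
  + apply is_derive_Reals, derivable_pt_lim_ln; now apply Rabs_pos_lt.
  + apply (is_derive_Rabs (fun t => t)); [apply @is_derive_id|easy].
- destruct (Rlt_dec 0 m).
  + rewrite sign_eq_1, Rabs_pos_eq by lra; field; easy.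
  + rewrite sign_eq_m1, Rabs_left by lra; field; easy.
Qed.

Section MetricFunction.
Variables (D : R * R -> Prop) (mu : R -> R -> R).
Hypothesis D_open : open D.
Hypothesis mu_smooth : smooth D mu.
Hypothesis mu_neq : forall u v, D (u, v) -> mu u v <> 0.

Let L := fun u v => ln (Rabs (mu u v)).
Let f := fun u v => 1 / sqrt (Rabs (mu u v)).

Lemma ln_abs_is_pd e u v : D (u, v) -> is_pd e L u v (/ mu u v * pd e mu u v).
Proof.
intros Huv; apply (is_pd_comp e (fun t => ln (Rabs t))).
- now apply is_derive_ln_Rabs, mu_neq.
- now apply (smooth_is_pd D).
Qed.

Lemma ln_abs_smooth : smooth D L.
Proof.
assert (Hc : forall u v, D (u, v) -> continuity_2d_pt L u v).
{ intros u v Huv; apply (continuity_1d_2d_pt_comp (fun t => ln (Rabs t)) mu).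
  - eapply continuity_pt_of_is_derive; now apply is_derive_ln_Rabs, mu_neq.
  - now apply (smooth_continuous D). }
intros [|n] u v Huv; [split; [now apply Hc|easy]|].
apply (Cn_step D D_open n L (fun e u v => / mu u v * pd e mu u v)); auto.
- intros e s t Hst; now apply ln_abs_is_pd.
- intros e; apply (Cn_mult D D_open).
  + exact (smooth_inv D D_open mu mu_neq mu_smooth n).
  + exact (smooth_pd D e mu mu_smooth n).
Qed.

Lemma pd_mu_ln_abs e u v : D (u, v) -> pd e mu u v = mu u v * pd e L u v.
Proof.
intros Huv; rewrite (is_pd_unique _ _ _ _ _ (ln_abs_is_pd e u v Huv)).
field; now apply mu_neq.
Qed.

(** In exponential form the logarithmic derivative of f is visibly - L' / 2. *)
Lemma metric_function_exp u v : D (u, v) -> f u v = exp (- / 2 * L u v).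
Proof.
intros Huv; pose proof (Rabs_pos_lt _ (mu_neq u v Huv)) as Hp; unfold f, L.
rewrite <- Rpower_sqrt by easy; unfold Rpower, Rdiv.
rewrite Rmult_1_l, <- exp_Ropp; f_equal; ring.
Qed.

Lemma metric_function_is_pd e u v :
  D (u, v) -> is_pd e f u v (- / 2 * f u v * pd e L u v).
Proof.
intros Huv.
apply (is_pd_ext_on D e (fun u v => exp (- / 2 * L u v))); auto.
{ intros s t Hst; symmetry; now apply metric_function_exp. }
rewrite metric_function_exp by easy.
replace (- / 2 * exp (- / 2 * L u v) * pd e L u v)
  with (exp (- / 2 * L u v) * (0 * L u v + - / 2 * pd e L u v)) by ring.
apply (is_pd_comp e exp (fun u v => - / 2 * L u v)).
- apply is_derive_Reals, derivable_pt_lim_exp.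
- apply (is_pd_mult e (fun _ _ => - / 2) L); [apply is_pd_const|].
  apply (smooth_is_pd D); [apply ln_abs_smooth|easy].
Qed.

Lemma metric_function_smooth : smooth D f.
Proof.
assert (Hc : forall u v, D (u, v) -> continuity_2d_pt f u v).
{ intros u v Huv.
  destruct (open_locally_2d D u v D_open Huv) as [r Hr].
  apply continuity_2d_pt_ext_loc with (fun u v => exp (- / 2 * L u v)).
  { exists r; intros s t Hs Ht; symmetry; now apply metric_function_exp, Hr. }
  apply (continuity_1d_2d_pt_comp exp (fun u v => - / 2 * L u v)).
  - apply derivable_continuous_pt, derivable_pt_exp.
  - apply continuity_2d_pt_mult; [apply continuity_2d_pt_const|].
    apply (smooth_continuous D); [apply ln_abs_smooth|easy]. }
intros n; change (Cn D n f); induction n as [|n IH].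
- intros u v Huv; split; [now apply Hc|easy].
- apply (Cn_step D D_open n f (fun e u v => - / 2 * f u v * pd e L u v)); auto.
  + intros e u v Huv; now apply metric_function_is_pd.
  + intros e; apply (Cn_mult D D_open).
    * apply (Cn_mult D D_open); [now apply Cn_const|exact IH].
    * exact (smooth_pd D e L ln_abs_smooth n).
Qed.

Lemma metric_function_pos u v : D (u, v) -> 0 < f u v.
Proof. intros Huv; rewrite metric_function_exp by easy; apply exp_pos. Qed.

Lemma metric_function_sq u v : D (u, v) -> Rabs (mu u v) * f u v ^ 2 = 1.
Proof.
intros Huv; pose proof (Rabs_pos_lt _ (mu_neq u v Huv)) as Hp; unfold f.
pose proof (sqrt_lt_R0 _ Hp) as Hs.
rewrite <- (sqrt_sqrt (Rabs (mu u v))) at 1 by lra; field; lra.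
Qed.

End MetricFunction.

(** * The existence and uniqueness theorem *)

Theorem theorem4p1
  (eps : R) (D : R * R -> Prop) (lam mu nu : R -> R -> R)
  (u0 v0 : R) (p0 x0 y0 n10 n20 : R41)
  (Heps : eps = 1 \/ eps = -1)
  (HD : is_domain D)
  (Hlam : smooth D lam) (Hmu : smooth D mu) (Hnu : smooth D nu)
  (Hmu0 : forall u v : R, D (u, v) -> mu u v <> 0)
  (Hnu0 : forall u v : R, D (u, v) -> nu u v <> 0)
  (Hnuc : ~ exists c : R, forall u v : R, D (u, v) -> nu u v = c)
  (Hpde : let lnmu := fun u v : R => ln (Rabs (mu u v)) in
    forall u v : R, D (u, v) ->
      pd pU nu u v + pd pV lam u v = lam u v * pd pV lnmu u v /\
      pd pU lam u v - eps * pd pV nu u v = lam u v * pd pU lnmu u v /\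
      Rabs (mu u v) * pd pV (pd pU lnmu) u v
        = - (nu u v) ^ 2 - eps * ((lam u v) ^ 2 + (mu u v) ^ 2))
  (H0 : D (u0, v0))
  (Hframe : pseudo_orthonormal x0 y0 n10 n20) :
  exists D0 : R * R -> Prop,
    is_domain D0 /\ (forall p : R * R, D0 p -> D p) /\ D0 (u0, v0) /\
    let solution := fun z : R -> R -> R41 =>
      timelike_surface D0 z /\
      parallel_normalized_mean_curvature D0 z /\
      z u0 v0 = p0 /\
      canonical_isotropic_parameters D0 z /\
      (exists (f : R -> R -> R) (x y n1 n2 : R -> R -> R41),
         isotropic_parameters D0 z f /\
         geometric_frame_field D0 z f x y n1 n2 /\
         x u0 v0 = x0 /\ y u0 v0 = y0 /\ n1 u0 v0 = n10 /\ n2 u0 v0 = n20 /\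
         geometric_functions D0 z f x y n1 n2 lam mu nu) /\
      (forall u v : R, D0 (u, v) ->
         (eps = 1 -> 0 < K_minus_H2 z u v) /\
         (eps = -1 -> K_minus_H2 z u v < 0)) in
    exists z : R -> R -> R41,
      solution z /\
      forall z' : R -> R -> R41, solution z' ->
        forall u v : R, D0 (u, v) -> z' u v = z u v.
Proof.
set (L := fun u v => ln (Rabs (mu u v))).
set (f := fun u v => 1 / sqrt (Rabs (mu u v))).
cbv zeta in Hpde; fold L in Hpde.
assert (DO := proj1 HD).
assert (HL : smooth D L) by (apply ln_abs_smooth; easy).
assert (Hf : smooth D f) by (apply metric_function_smooth; easy).
assert (Hfpos : forall u v, D (u, v) -> 0 < f u v)
  by (intros u v Huv; apply (metric_function_pos D); easy).
assert (Hfpd : forall e u v, D (u, v) -> pd e f u v = - / 2 * f u v * pd e L u v).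
{ intros e u v Huv; apply is_pd_unique, (metric_function_is_pd D); easy. }
assert (Hmupd : forall e u v, D (u, v) -> pd e mu u v = mu u v * pd e L u v)
  by (intros e u v Huv; apply (pd_mu_ln_abs D); easy).
assert (Hgauss : forall u v, D (u, v) -> pd pV (pd pU L) u v =
  f u v ^ 2 * (- nu u v ^ 2 - eps * (lam u v ^ 2 + mu u v ^ 2))).
{ intros u v Huv; destruct (Hpde u v Huv) as (_ & _ & E).
  rewrite <- E, <- Rmult_assoc, (Rmult_comm (f u v ^ 2)).
  unfold f; rewrite (metric_function_sq D mu Hmu0 u v Huv); ring. }
(* Having q in D0 keeps nu from being constant, and H from being parallel,
   on D0. *)
assert (Hq : exists q, D q /\ nu (fst q) (snd q) <> nu u0 v0).
{ apply NNPP; intros Hn; apply Hnuc; exists (nu u0 v0); intros u v Huv.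
  apply NNPP; intros Hne; apply Hn; now exists (u, v). }
destruct Hq as [q [Dq Hq]].
set (coef := frame_coef f L lam mu nu eps).
assert (Hcoef : smooth_coefs coef D) by now apply frame_coef_smooth.
assert (Hflat : flat slots coef D).
{ apply frame_coef_flat; try easy; intros u v Huv; now apply Hpde. }
destruct (flat_system_solvable slots slots_full coef D Hcoef Hflat u0 v0 q HD H0 Dq)
  as (D0 & HD0 & Hsub & B0 & Bq & Hsolve).
exists D0; split; [easy|split; [easy|split; [easy|]]].
intros solution.
assert (D0O := proj1 HD0).
assert (Hsub2 : forall g, smooth D g -> smooth D0 g)
  by (intros g; now apply smooth_sub).
assert (Hnuc0 : ~ exists c, forall u v, D0 (u, v) -> nu u v = c).
{ intros [c Hc]; apply Hq; rewrite (Hc u0 v0 B0); destruct q; now apply Hc. }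
set (init := fun i : option leg => match i with
  | None => p0 | Some lx => x0 | Some ly => y0 | Some l1 => n10 | Some l2 => n20 end).
destruct (choice_function (fun k W => solves slots coef D0 W /\
  forall i, W i u0 v0 = crd k (init i))) as [W HW].
{ intros k; apply Hsolve. }
set (F := fun i u v => vec (fun k => W k i u v)).
destruct (solves_frame_equations f L lam mu nu eps D0 HD0 (Hsub2 _ Hf) (Hsub2 _ HL)
  (Hsub2 _ Hlam) (Hsub2 _ Hmu) (Hsub2 _ Hnu) F) as [FS FE].
{ intros k; apply (solves_ext slots coef D0 (W k)); [easy| |apply HW].
  intros i u v _; unfold F; now rewrite crd_vec. }
assert (Finit : forall i, F i u0 v0 = init i).
{ intros i; apply vec_ext; intros k; unfold F; rewrite crd_vec; apply HW. }
assert (FP : forall u v, D0 (u, v) -> pseudo_orthonormal (F (Some lx) u v)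
  (F (Some ly) u v) (F (Some l1) u v) (F (Some l2) u v)).
{ apply (frame_pseudo_orthonormal f L lam mu nu eps D0 HD0 (Hsub2 _ Hf) (Hsub2 _ HL)
    (Hsub2 _ Hlam) (Hsub2 _ Hmu) (Hsub2 _ Hnu) F FS FE u0 v0 B0).
  now rewrite !Finit. }
assert (FE' : frame_equations f L lam mu nu eps D0
  (bundle (F None) (F (Some lx)) (F (Some ly)) (F (Some l1)) (F (Some l2)))).
{ intros u v Huv; destruct (FE u v Huv) as (E1 & E2 & E3).
  split; [exact E1|split; [exact E2|]]; intros e []; apply E3. }
assert (Ad : adapted D0 (F None) f (F (Some lx)) (F (Some ly)) (F (Some l1)) (F (Some l2))).
{ split; auto; intros u v Huv; apply (FE u v Huv). }
assert (Hmu0' : forall u v, D0 (u, v) -> mu u v <> 0) by auto.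
assert (Hnu0' : forall u v, D0 (u, v) -> nu u v <> 0) by auto.
assert (Hfpd' : forall e u v, D0 (u, v) -> pd e f u v = - / 2 * f u v * pd e L u v) by auto.
assert (Hgauss' : forall u v, D0 (u, v) -> pd pV (pd pU L) u v =
  f u v ^ 2 * (- nu u v ^ 2 - eps * (lam u v ^ 2 + mu u v ^ 2))) by auto.
assert (Hiso := adapted_isotropic D0 _ _ _ _ _ _ Ad).
assert (Hgf := surface_geometric_frame f L lam mu nu eps D0 _ _ _ _ _ Ad FE').
assert (Hfun := surface_geometric_functions f L lam mu nu eps D0 HD0 (Hsub2 _ HL) Heps
  Hfpd' Hgauss' Hmu0' _ _ _ _ _ Ad FE' (fun u v _ => eq_refl)).
assert (HKs := surface_K_minus_H2_sign f L lam mu nu eps D0 HD0 (Hsub2 _ HL)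
  Hfpd' Hgauss' Hmu0' _ _ _ _ _ Ad FE').
exists (F None); split.
- split; [exact (adapted_timelike D0 _ _ _ _ _ _ Ad)|split; [|split; [|split; [|split]]]].
  + apply (surface_parallel_normalized f L lam mu nu eps D0 HD0 (Hsub2 _ Hnu) Hnu0'
      _ _ _ _ _ Ad FE' Hnuc0).
    now exists u0, v0.
  + apply Finit.
  + split.
    * intros u v Huv; destruct (HKs u v Huv) as [K1 K2].
      destruct Heps as [E|E]; [specialize (K1 E)|specialize (K2 E)]; lra.
    * now exists f, (F (Some lx)), (F (Some ly)), (F (Some l1)), (F (Some l2)), lam, mu, nu.
  + exists f, (F (Some lx)), (F (Some ly)), (F (Some l1)), (F (Some l2)).
    split; [easy|split; [easy|]].
    repeat (split; [apply Finit|]); exact Hfun.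
  + exact HKs.
- intros z' (HT & HPN & Hz0 & _ & (f' & x & y & n1 & n2 & Hiso' & Hgf' &
    Hx & Hy & Hn1 & Hn2 & Hfun') & HK').
  destruct Hgf' as (Sx & Sy & S1 & S2 & Hgf').
  assert (Hff : forall u v, D0 (u, v) -> f' u v = f u v).
  { intros u v Huv; now apply (Hfun' u v). }
  assert (Ad' : adapted D0 z' f x y n1 n2).
  { split; auto.
    - apply HT.
    - intros u v Huv; now apply Hgf'.
    - intros u v Huv; destruct (Hgf' u v Huv) as (_ & -> & _).
      rewrite Hff by easy; specialize (Hfpos u v (Hsub _ Huv)).
      vec_ring; field; lra.
    - intros u v Huv; destruct (Hgf' u v Huv) as (_ & _ & -> & _).
      rewrite Hff by easy; specialize (Hfpos u v (Hsub _ Huv)).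
      vec_ring; field; lra. }
  assert (Hsign : forall u v, D0 (u, v) -> sign (K_minus_H2 z' u v) = eps).
  { intros u v Huv; destruct (HK' u v Huv) as [K1 K2]; destruct Heps as [E|E]; rewrite E.
    - now apply sign_eq_1, K1.
    - now apply sign_eq_m1, K2. }
  assert (Sxx : forall u v, D0 (u, v) -> sigma z' (x u v) x u v =
    plus (scal (lam u v) (n1 u v)) (scal (mu u v) (n2 u v)))
    by (intros u v Huv; now apply (Hfun' u v)).
  assert (Sxy : forall u v, D0 (u, v) -> sigma z' (x u v) y u v = scal (- nu u v) (n1 u v))
    by (intros u v Huv; now apply (Hfun' u v)).
  assert (Syy : forall u v, D0 (u, v) -> sigma z' (y u v) y u v =
    scal (- eps) (plus (scal (lam u v) (n1 u v)) (scal (mu u v) (n2 u v)))).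
  { intros u v Huv; rewrite <- (Hsign u v Huv); now apply (Hfun' u v). }
  assert (HH : forall u v, D0 (u, v) -> mean_curvature z' u v = scal (nu u v) (n1 u v)).
  { intros u v Huv.
    destruct (tangent_derivatives f L lam mu nu eps D0 HD0 Hfpd' z' x y n1 n2 Ad'
      Sxx Sxy Syy u v Huv) as (_ & (Y1 & Y2) & (X1 & X2) & _).
    apply (adapted_mean_curvature D0 z' f x y n1 n2 Ad'); (easy || lra). }
  assert (FE'' : frame_equations f L lam mu nu eps D0 (bundle z' x y n1 n2)).
  { apply adapted_frame_equations; try easy.
    now apply (normalized_parallel_n1 f nu D0 HD0 (Hsub2 _ Hnu) Hnu0' z' x y n1 n2). }
  intros u v Huv.
  apply (frame_equations_unique f L lam mu nu eps D0 HD0 (Hsub2 _ Hf) (Hsub2 _ HL)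
    (Hsub2 _ Hlam) (Hsub2 _ Hmu) (Hsub2 _ Hnu) (bundle z' x y n1 n2) F u0 v0)
    with (i := None); try easy.
  + intros [[]|]; apply Ad'.
  + intros [[]|]; rewrite Finit; easy.
Qed.
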